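(* Let $(X,\mathscr A,\mu)$ be a $\sigma$-finite measure space, $w\colon X\to\mathbb C$ an $\mathscr A$-measurable function and $\phi\colon X\to X$ an $\mathscr A$-measurable transformation such that $\mu_w\circ\phi^{-1}\ll\mu$. Let $\alpha\in(0,1]$. Suppose that $C_{\phi,w}$ is densely defined. Then $C_{\phi,w}$ is quasinormal if and only if $\Delta_\alpha(C_{\phi,w})=C_{\phi,w}$.
   Context: A transformation $\phi\colon X\to X$ is $\mathscr A$-measurable if $\phi^{-1}(\Delta)\in\mathscr A$ for all $\Delta\in\mathscr A$. $\mu_w(\Delta)=\int_\Delta|w|^2\,\mathrm d\mu$ and $\mu_w\circ\phi^{-1}(\Delta)=\mu_w(\phi^{-1}(\Delta))$ for $\Delta\in\mathscr A$. If $\mu_w\circ\phi^{-1}\ll\mu$, the weighted composition operator $C_{\phi,w}$ in $L^2(\mu)$ is well defined by $\mathcal D(C_{\phi,w})=\{f\in L^2(\mu)\colon w\cdot(f\circ\phi)\in L^2(\mu)\}$, $C_{\phi,w}f=w\cdot(f\circ\phi)$; it is a closed operator. For a closed densely defined operator $A$ in a complex Hilbert space with polar decomposition $A=U|A|$ and $\alpha\in(0,1]$, the $\alpha$-Aluthge transform of $A$ is $\Delta_\alpha(A)=|A|^\alpha U|A|^{1-\alpha}$ (with its natural domain as a product of operators; $|A|^0$ is the identity). Equality of operators includes equality of domains. A closed densely defined operator $A$ with polar decomposition $A=U|A|$ is quasinormal if $U|A|\subseteq|A|U$ (equivalently, $A$ commutes with the spectral measure $E$ of $|A|$: $E(\sigma)A\subseteq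 AE(\sigma)$ for every Borel set $\sigma\subseteq[0,\infty)$). *)

(* Defs.v *)
From HB Require Import structures.
From mathcomp Require Import all_boot all_order all_algebra.
From mathcomp Require Import ring_quotient generic_quotient sesquilinear.
From mathcomp Require Import complex.
From mathcomp Require Import all_classical all_reals all_analysis.
From mathcomp Require Import measurable_realfun.
From mathcomp Require Import ring lra.

Set Implicit Arguments.
Unset Strict Implicit.
Unset Printing Implicit Defensive.

Import Order.TTheory GRing.Theory Num.Theory.
Import numFieldNormedType.Exports.

Local Open Scope classical_set_scope.
Local Open Scope ring_scope.

(* [abs2 z] is |z|^2, as a real number. *)
Definition abs2 (R : realType) (z : R[i]) : R :=
  complex.Re z ^+ 2 + complex.Im z ^+ 2.

Lemma abs2_ge0 (R : realType) (z : R[i]) : 0 <= abs2 z.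
Proof. by rewrite addr_ge0 // sqr_ge0. Qed.

Lemma ReM (R : realType) (x y : R[i]) : complex.Re (x * y) =
  complex.Re x * complex.Re y - complex.Im x * complex.Im y.
Proof. by case: x; case: y. Qed.

Lemma ImM (R : realType) (x y : R[i]) : complex.Im (x * y) =
  complex.Re x * complex.Im y + complex.Im x * complex.Re y.
Proof. by case: x; case: y. Qed.

Lemma ReJ (R : realType) (x : R[i]) : complex.Re (x^*)%C = complex.Re x.
Proof. by case: x. Qed.

Lemma ImJ (R : realType) (x : R[i]) : complex.Im (x^*)%C = - complex.Im x.
Proof. by case: x. Qed.

Lemma ReD (R : realType) (x y : R[i]) :
  complex.Re (x + y) = complex.Re x + complex.Re y.
Proof. by case: x; case: y. Qed.

Lemma ImD (R : realType) (x y : R[i]) :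
  complex.Im (x + y) = complex.Im x + complex.Im y.
Proof. by case: x; case: y. Qed.

Section L2fun.
Context d (X : measurableType d) (R : realType).

Definition cmeasurable (f : X -> R[i]) :=
  measurable_fun setT (fun x => complex.Re (f x)) /\
  measurable_fun setT (fun x => complex.Im (f x)).

Variable mu : {measure set X -> \bar R}.

Definition square_integrable (f : X -> R[i]) :=
  (\int[mu]_x (abs2 (f x))%:E < +oo)%E.

(* [R[i]^o] is [R[i]] seen as a vector space over itself. *)
Definition L2pred : {pred X -> R[i]^o} :=
  fun f => `[< cmeasurable f /\ square_integrable f >].

Lemma L2predP (f : X -> R[i]) :
  reflect (cmeasurable f /\ square_integrable f) (f \in L2pred).
Proof. exact: asboolP. Qed.

Lemma cmeasurable_abs2 f : cmeasurable f ->
  measurable_fun setT (fun x => abs2 (f x)).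
Proof.
move=> [mr mi].
by apply: measurable_funD; exact: measurable_funX.
Qed.

Lemma cmeasurable_lin a f g : cmeasurable f -> cmeasurable g ->
  cmeasurable (fun x => a * f x + g x).
Proof.
move=> [fr fi] [gr gi]; split.
  under eq_fun do rewrite ReD ReM.
  apply: measurable_funD => //; apply: measurable_funB;
  by apply: measurable_funM => //; exact: measurable_cst.
under eq_fun do rewrite ImD ImM.
apply: measurable_funD => //; apply: measurable_funD;
by apply: measurable_funM => //; exact: measurable_cst.
Qed.

Lemma square_integrableP f : cmeasurable f ->
  square_integrable f <-> mu.-integrable setT (fun x => (abs2 (f x))%:E).
Proof.
move=> mf.
have E : (\int[mu]_x `|(abs2 (f x))%:E| = \int[mu]_x (abs2 (f x))%:E)%E.
  by apply: eq_integral => x _; rewrite gee0_abs // lee_fin abs2_ge0.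
rewrite /square_integrable -E; split.
  move=> fi; apply/integrableP; split => //.
  by apply/measurable_EFinP; exact: cmeasurable_abs2.
by case/integrableP.
Qed.

Lemma abs2_lin (a x y : R[i]) :
  abs2 (a * x + y) <= 2 * (abs2 a * abs2 x + abs2 y).
Proof.
rewrite /abs2 ReD ImD ReM ImM.
set a1 := complex.Re a; set a2 := complex.Im a.
set x1 := complex.Re x; set x2 := complex.Im x.
set y1 := complex.Re y; set y2 := complex.Im y.
have := sqr_ge0 (a1 * x1 - a2 * x2 - y1).
have := sqr_ge0 (a1 * x2 + a2 * x1 - y2).
rewrite -subr_ge0 => h1 h2; rewrite -subr_ge0.
apply: le_trans (addr_ge0 h1 h2) _; rewrite le_eqVlt; apply/orP; left.
apply/eqP; ring.
Qed.

Lemma L2pred_submod_closed : submod_closed L2pred.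
Proof.
have m0 : cmeasurable (fun=> 0 : R[i]) by split; exact: measurable_cst.
split => [|a f g /L2predP[mf fi] /L2predP[mg gi]]; apply/L2predP.
  split => //; rewrite /square_integrable.
  under eq_integral do rewrite /abs2 /= expr0n /= addr0.
  by rewrite integral0.
have mfg := cmeasurable_lin a mf mg; split => //.
apply/square_integrableP => //.
move/square_integrableP : fi => /(_ mf) fi.
move/square_integrableP : gi => /(_ mg) gi.
pose h x := (((2 * abs2 a)%:E * (abs2 (f x))%:E) + (2%:E * (abs2 (g x))%:E))%E.
have hi : mu.-integrable setT h.
  by apply: integrableD => //; exact: integrableZl.
apply: (le_integrable measurableT _ _ hi).
  by apply/measurable_EFinP; exact: cmeasurable_abs2.
move=> x _; rewrite /h -!EFinM -EFinD /= lee_fin.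
rewrite ger0_norm ?abs2_ge0// (le_trans (abs2_lin _ _ _))//.
by rewrite (le_trans _ (ler_norm _))// mulrDr mulrA.
Qed.

HB.instance Definition _ :=
  GRing.isSubmodClosed.Build R[i] (X -> R[i]^o) L2pred L2pred_submod_closed.

Record L2fun := L2Fun { L2val :> X -> R[i]^o ; L2valP : L2val \in L2pred }.

HB.instance Definition _ := [isSub for L2val].
HB.instance Definition _ := [Choice of L2fun by <:].
HB.instance Definition _ := [SubChoice_isSubLmodule of L2fun by <:].

Definition ae_null : {pred L2fun} :=
  fun f => `[< {ae mu, forall x, f x = 0} >].

Lemma ae_null_zmod_closed : zmod_closed ae_null.
Proof.
split; first by apply/asboolP; exact: nearW.
move=> f g /asboolP f0 /asboolP g0; apply/asboolP.
by near=> x; rewrite /= [LHS](_ : _ = f x - g x)//;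
  rewrite (near f0 x _)// (near g0 x _)// subrr.
Unshelve. all: by end_near. Qed.

End L2fun.

Section L2.
Context d (X : measurableType d) (R : realType) (mu : {measure set X -> \bar R}).
Local Open Scope quotient_scope.

HB.instance Definition _ :=
  GRing.isZmodClosed.Build (L2fun mu) (@ae_null d X R mu) (ae_null_zmod_closed mu).

(* L^2(mu): square-integrable measurable functions X -> C modulo equality
   mu-almost everywhere; [repr u] picks a representative of the class [u]. *)
Definition L2 := Quotient.quot (@ae_null d X R mu).

HB.instance Definition _ := Choice.on L2.
HB.instance Definition _ := GRing.Zmodule.on L2.
HB.instance Definition _ := EqQuotient.on L2.

Definition L2class (f : L2fun mu) : L2 := \pi_L2 f.

Lemma L2classP (f g : L2fun mu) :
  L2class f = L2class g <-> {ae mu, forall x, f x = g x}.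
Proof.
have E : (f - g \in @ae_null d X R mu) = (L2class f == L2class g).
  by rewrite Quotient.idealrBE.
split => [/eqP|fg]; last apply/eqP; rewrite -E.
  by move/asboolP; apply: filterS => x /= /eqP; rewrite subr_eq0 => /eqP.
by apply/asboolP; move: fg; apply: filterS => x /= fg; apply/eqP; rewrite subr_eq0 fg.
Qed.

Lemma L2reprK (u : L2) : L2class (repr u) = u.
Proof. exact: reprK. Qed.

Lemma L2repr_ae (f : L2fun mu) : {ae mu, forall x, repr (L2class f) x = f x}.
Proof. by apply/L2classP; rewrite L2reprK. Qed.

Lemma L2classD f g : L2class (f + g) = L2class f + L2class g.
Proof. exact: (Quotient.pi_add _ f g). Qed.

Definition L2scale (a : R[i]) (u : L2) : L2 := L2class (a *: repr u).

Lemma L2class_scale a f : L2class (a *: f) = L2scale a (L2class f).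
Proof.
apply/L2classP; have := L2repr_ae f; apply: filterS => x E.
by rewrite [LHS](_ : _ = a * f x)// [RHS](_ : _ = a * repr (L2class f) x)// E.
Qed.

Fact L2scaleA a b u : L2scale a (L2scale b u) = L2scale (a * b) u.
Proof. by rewrite -(L2reprK u) -!L2class_scale scalerA. Qed.

Fact L2scale1 : left_id 1 L2scale.
Proof. by move=> u; rewrite -(L2reprK u) -!L2class_scale scale1r. Qed.

Fact L2scaleDr : right_distributive L2scale +%R.
Proof.
move=> a u v; rewrite -(L2reprK u) -(L2reprK v) -L2classD -!L2class_scale.
by rewrite -L2classD scalerDr.
Qed.

Fact L2scaleDl u : {morph L2scale^~ u : a b / a + b}.
Proof.
by move=> a b; rewrite -(L2reprK u) -!L2class_scale -L2classD scalerDl.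
Qed.

HB.instance Definition _ := GRing.Zmodule_isLmodule.Build R[i] L2
  L2scaleA L2scale1 L2scaleDr L2scaleDl.

Definition cintegral (f : X -> R[i]) : R[i] :=
  Complex (\int[mu]_x complex.Re (f x)) (\int[mu]_x complex.Im (f x)).

Definition L2dot (u v : L2) : R[i] := cintegral (fun x => repr u x * (repr v x)^*).

Definition cintegrable (f : X -> R[i]) :=
  mu.-integrable setT (fun x => (complex.Re (f x))%:E) /\
  mu.-integrable setT (fun x => (complex.Im (f x))%:E).

Lemma cintegral_lin a f g : cintegrable f -> cintegrable g ->
  cintegral (fun x => a * f x + g x) = a * cintegral f + cintegral g.
Proof.
move=> [fr fi] [gr gi]; rewrite /cintegral.
have Z c h : mu.-integrable setT (fun x => (h x : R)%:E) ->
    mu.-integrable setT (fun x => (c * h x)%:E).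
  move=> hi; have := integrableZl measurableT c hi.
  by apply: eq_integrable => // x _; rewrite EFinM.
under eq_Rintegral do rewrite ReD ReM.
under [X in Complex _ X]eq_Rintegral do rewrite ImD ImM.
have B h k : mu.-integrable setT (fun x => (h x : R)%:E) ->
    mu.-integrable setT (fun x => (k x : R)%:E) ->
    mu.-integrable setT (fun x => (h x - k x)%:E).
  move=> hi ki; have := integrableB measurableT hi ki.
  by apply: eq_integrable => // x _; rewrite EFinB.
have D h k : mu.-integrable setT (fun x => (h x : R)%:E) ->
    mu.-integrable setT (fun x => (k x : R)%:E) ->
    mu.-integrable setT (fun x => (h x + k x)%:E).
  move=> hi ki; have := integrableD measurableT hi ki.
  by apply: eq_integrable => // x _; rewrite EFinD.
transitivity (Complex
  (complex.Re a * (\int[mu]_x complex.Re (f x))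
    - complex.Im a * (\int[mu]_x complex.Im (f x)) + \int[mu]_x complex.Re (g x))
  (complex.Re a * (\int[mu]_x complex.Im (f x))
    + complex.Im a * (\int[mu]_x complex.Re (f x)) + \int[mu]_x complex.Im (g x)));
  last by case: a.
congr Complex.
  rewrite RintegralD//; last by apply: B; exact: Z.
  rewrite RintegralB//; [|exact: Z|exact: Z].
  by rewrite !RintegralZl.
rewrite RintegralD//; last by apply: D; exact: Z.
rewrite RintegralD//; [|exact: Z|exact: Z].
by rewrite !RintegralZl.
Qed.

Lemma L2_cintegrable (f g : L2fun mu) : cintegrable (fun x => f x * (g x)^*).
Proof.
have /L2predP[[fr fi] f2] := L2valP f; have /L2predP[[gr gi] g2] := L2valP g.
move/square_integrableP : f2 => /(_ (conj fr fi)) f2.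
move/square_integrableP : g2 => /(_ (conj gr gi)) g2.
have H (h : X -> R) : measurable_fun setT h ->
    (forall x, `|h x| <= abs2 (f x) + abs2 (g x)) ->
    mu.-integrable setT (fun x => (h x)%:E).
  move=> mh hle; apply: (le_integrable measurableT _ _ (integrableD measurableT f2 g2)).
    exact/measurable_EFinP.
  by move=> x _; rewrite -EFinD /= lee_fin (le_trans (hle x))// ler_norm.
have cE x : (g x)^* = ((g x)^*)%C :> R[i] by [].
have K (a b c e : R) : `|a * c - b * e| <= a ^+ 2 + b ^+ 2 + (c ^+ 2 + e ^+ 2).
  have := sqr_ge0 (a + c); have := sqr_ge0 (a - c).
  have := sqr_ge0 (b + e); have := sqr_ge0 (b - e).
  by rewrite ler_norml => *; apply/andP; split; nra.
split; apply: H => [|x].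
- under eq_fun do rewrite ReM cE ReJ ImJ.
  apply: measurable_funB; apply: measurable_funM => //.
  exact: measurableT_comp.
- by rewrite ReM cE ReJ ImJ (le_trans (K _ _ _ _))// sqrrN.
- under eq_fun do rewrite ImM cE ReJ ImJ.
  apply: measurable_funD; apply: measurable_funM => //.
  exact: measurableT_comp.
- by rewrite ImM cE ReJ ImJ mulrN addrC /abs2 [X in _ <= X + _]addrC K.
Qed.

Lemma eq_cintegral (f g : X -> R[i]) : cmeasurable f -> cmeasurable g ->
  {ae mu, forall x, f x = g x} -> cintegral f = cintegral g.
Proof.
move=> [fr fi] [gr gi] fg; congr Complex; congr fine;
  apply: ae_eq_integral => //; do ?exact/measurable_EFinP;
  by move: fg; apply: filterS => x /= ->.
Qed.

Lemma L2prod_measurable (f g : L2fun mu) :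
  cmeasurable (fun x => f x * (g x)^*).
Proof.
by have [/integrableP[/measurable_EFinP ? _] /integrableP[/measurable_EFinP ? _]]
  := L2_cintegrable f g.
Qed.

Lemma L2dotE (f g : L2fun mu) :
  L2dot (L2class f) (L2class g) = cintegral (fun x => f x * (g x)^*).
Proof.
apply: eq_cintegral; try exact: L2prod_measurable.
have := L2repr_ae f; have := L2repr_ae g; apply: filterS2 => x.
by move=> /= -> ->.
Qed.

Lemma L2dotC (u v : L2) : L2dot u v = (L2dot v u)^*.
Proof.
have [ur ui] := L2_cintegrable (repr v) (repr u).
rewrite /L2dot /cintegral; transitivity (Complex
   (\int[mu]_x complex.Re (repr v x * (repr u x)^* ))
   (- (\int[mu]_x complex.Im (repr v x * (repr u x)^* )))); last by [].
congr Complex.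
  apply: eq_Rintegral => x _.
  by case: (repr u x) => a b; case: (repr v x) => c e /=; ring.
rewrite -[RHS]mulN1r -RintegralZl//; apply: eq_Rintegral => x _.
by case: (repr u x) => a b; case: (repr v x) => c e /=; ring.
Qed.

Lemma L2dot_linear (v : L2) : linear_for *%R (L2dot^~ v).
Proof.
move=> a u w; rewrite -(L2reprK u) -(L2reprK v) -(L2reprK w).
rewrite -[a *: _]/(L2scale _ _) -L2class_scale -L2classD !L2dotE.
rewrite -cintegral_lin; try exact: L2_cintegrable.
congr cintegral; apply/funext => x.
rewrite [LHS](_ : _ = (a * repr u x + repr w x) * (repr v x)^*)//.
by rewrite mulrDl mulrA.
Qed.

Lemma L2dot_bilinear :
  bilinear_for (GRing.Scale.Law.clone _ _ *%R _)
    (GRing.Scale.Law.clone _ _ (Num.conj \; *%R) _) L2dot.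
Proof.
split => [v|u]; first exact: L2dot_linear.
move=> a v w /=; rewrite L2dotC L2dot_linear rmorphD rmorphM /=.
by rewrite -!(L2dotC u).
Qed.

Lemma L2dot_hermitian (u v : L2) :
  L2dot u v = (-1) ^+ false * Num.conj (L2dot v u).
Proof. by rewrite expr0 mul1r -L2dotC. Qed.

Lemma L2dot_gt0 (u : L2) : u != 0 -> 0 < L2dot u u.
Proof.
move=> u0; have /L2predP[um ui] := L2valP (repr u).
have mabs := cmeasurable_abs2 um.
have /square_integrableP-/(_ um) iabs := ui.
have -> : L2dot u u = Complex (\int[mu]_x abs2 (repr u x)) 0.
  congr Complex; last first.
    rewrite -[RHS](mul0r (fine (mu setT))) -(Rintegral_cst mu measurableT).
    apply: eq_Rintegral => x _.
    by case: (repr u x) => a b /=; ring.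
  apply: eq_Rintegral => x _.
  by case: (repr u x) => a b /=; rewrite /abs2 /=; ring.
rewrite ltcE /= eqxx /= lt_neqAle Rintegral_ge0 ?andbT; last first.
  by move=> x _; exact: abs2_ge0.
apply: contra_neq u0 => /esym i0; rewrite -(L2reprK u).
have -> : 0 = L2class 0 :> L2.
  by apply: (addrI (L2class 0)); rewrite addr0 -L2classD addr0.
apply/L2classP.
have : (\int[mu]_x `|(abs2 (repr u x))%:E| = 0)%E.
  under eq_integral do rewrite gee0_abs ?lee_fin ?abs2_ge0//.
  by rewrite -[LHS]fineK ?integrable_fin_num// -[fine _]/(Rintegral _ _ _) i0.
move/(ae_eq_integral_abs mu measurableT (proj2 (measurable_EFinP _ _ ) mabs)).
apply: filterS => x /(_ I) [] /eqP.
rewrite paddr_eq0 ?sqr_ge0// !sqrf_eq0.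
by case: (repr u x) => a b /= /andP[/eqP-> /eqP->].
Qed.

HB.instance Definition _ := bilinear_isBilinear.Build R[i] L2 L2 R[i]
  _ _ L2dot L2dot_bilinear.
HB.instance Definition _ := isHermitianSesquilinear.Build R[i] L2 false Num.conj
  L2dot L2dot_hermitian.
HB.instance Definition _ := isDotProduct.Build R[i] L2 L2dot L2dot_gt0.
End L2.

(* Unbounded operators in a complex inner product space H, given by their
   graphs, so that equality of operators includes equality of domains. The form
   [dot] is linear in its first argument. The notions below are meant for a
   Hilbert space; they are applied to L^2(mu), which is complete by the
   Riesz-Fischer theorem. *)
Section Operators.
Context (R : realType) (H : lmodType R[i]) (dot : {dot H for Num.conj}).
Local Notation "'[ u , v ]" := (dot u v).

Definition operator := set (H * H).

Implicit Types A B P U : operator.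

Definition linear_operator A := [/\ A (0, 0),
  forall (a : R[i]) f g f' g', A (f, g) -> A (f', g') ->
    A (a *: f + f', a *: g + g') &
  forall g, A (0, g) -> g = 0].

Definition opdom A : set H := [set f | exists g, A (f, g)].

Definition opker A : set H := [set f | A (f, 0)].

Definition densely_defined A :=
  forall (f : H) (e : R), 0 < e ->
    exists2 g, opdom A g & '[f - g, f - g] < (e%:C)%C.

(* The product AB with its natural domain: B is applied first. *)
Definition opcomp A B : operator :=
  [set fh | exists2 g, B (fh.1, g) & A (g, fh.2)].

(* For densely defined A this is the graph of A^*. *)
Definition adjoint A : operator :=
  [set hk | forall f g, A (f, g) -> '[g, hk.1] = '[f, hk.2]].

Definition positive_selfadjoint P :=
  [/\ linear_operator P, densely_defined P, adjoint P = P &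
      forall f g, P (f, g) -> 0 <= '[g, f]].

(* |A| = (A^* A)^(1/2), the unique positive selfadjoint square root of A^* A;
   as in the other uses of [xget], the first argument is an irrelevant default
   value for the case where no such object exists, which does not happen for a
   closed densely defined A. *)
Definition modulus A : operator :=
  xget set0 [set P | positive_selfadjoint P /\
                     opcomp P P = opcomp (adjoint A) A].

(* A bounded everywhere defined operator, isometric on the orthocomplement of its
   kernel. *)
Definition partial_isometry U := [/\ linear_operator U, opdom U = setT,
  exists M : R, forall f g, U (f, g) -> '[g, g] <= (M%:C)%C * '[f, f] &
  forall f g, U (f, g) -> (forall k, opker U k -> '[f, k] = 0) ->
    '[g, g] = '[f, f]].

(* The U of the polar decomposition A = U|A|. *)
Definition polar_isometry A : operator :=
  xget set0 [set U | [/\ partial_isometry U, opker U = opker A &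
                         A = opcomp U (modulus A)]].

(* For closed densely defined A: U|A| is contained in |A|U. *)
Definition quasinormal A :=
  opcomp (polar_isometry A) (modulus A) `<=`
  opcomp (modulus A) (polar_isometry A).

Definition orthogonal_projection (p : H -> H) :=
  [/\ linear p, forall f, p (p f) = p f & forall f g, '[p f, g] = '[f, p g]].

(* <E(.)f, f> *)
Definition diag_measure (E : set R -> H -> H) (f : H) : set R -> \bar R :=
  fun s => (complex.Re '[E s f, f])%:E.

(* Spectral measures on the Borel subsets of [0, +oo), encoded as functions on
   sets of reals, concentrated on [0, +oo); only their values on Borel sets
   matter. *)
Definition spectral_measure (E : set R -> H -> H) :=
  [/\ forall s, measurable s -> orthogonal_projection (E s),
      forall f, E `[0, +oo[%classic f = f &
      forall f, semi_sigma_additive (diag_measure E f)].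

(* The domain { f | int |phi|^2 d<E(.)f, f> < +oo } of int phi dE. *)
Definition spectral_dom (phi : R -> R) (E : set R -> H -> H) : set H :=
  [set f | (\int[diag_measure E f]_(t in `[0%R, +oo[) (phi t ^+ 2)%:E < +oo)%E].

(* The operator T = int phi dE, for phi >= 0 Borel: <Tf, h> = int phi d<E(.)f, h>
   for all f, h in its domain, where the integral with respect to the complex
   measure <E(.)f, h> is written by polarization
   <E(.)f, h> = 1/4 sum_(k < 4) i^k <E(.)(f + i^k h), f + i^k h>.
   The domain being dense, this determines Tf. *)
Definition spectral_integral (phi : R -> R) (E : set R -> H -> H) : operator :=
  [set fg | spectral_dom phi E fg.1 /\
    forall h, spectral_dom phi E h -> '[fg.2, h] =
      4^-1 * \sum_(k < 4) 'i ^+ k *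
        ((fine (\int[diag_measure E (fg.1 + 'i ^+ k *: h)]_(t in `[0%R, +oo[)
                 (phi t)%:E))%:C)%C].

Definition spectral_measure_of P : set R -> H -> H :=
  xget ((fun=> idfun) : set R -> H -> H)
    [set E | spectral_measure E /\ spectral_integral id E = P].

(* P^a = int t^a dE, for P positive selfadjoint with spectral measure E and
   a >= 0; since [0 `^ 0 = 1], P^0 is the identity. *)
Definition oppow P (a : R) : operator :=
  spectral_integral (fun t => t `^ a) (spectral_measure_of P).

Definition aluthge (alpha : R) A : operator :=
  opcomp (oppow (modulus A) alpha)
    (opcomp (polar_isometry A) (oppow (modulus A) (1 - alpha))).

End Operators.

Section WeightedComposition.
Context d (X : measurableType d) (R : realType) (mu : {measure set X -> \bar R}).
Context (w : X -> R[i]) (phi : X -> X).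

(* mu_w *)
Definition weighted_measure : set X -> \bar R :=
  fun D => (\int[mu]_(x in D) (abs2 (w x))%:E)%E.

(* The graph of C_(phi,w): (f, g) belongs to it when w (f o phi) = g in L^2(mu),
   so the domain consists of the f with w (f o phi) in L^2(mu). *)
Definition wcomp : operator (L2 mu) :=
  [set fg : L2 mu * L2 mu | {ae mu, forall x, repr fg.2 x = w x * repr fg.1 (phi x)}].

End WeightedComposition.

Arguments L2dot {d X R} mu.
Arguments weighted_measure {d X R} mu w.
Arguments wcomp {d X R} mu w phi.

(* Main.v *)
(* Density of the domain of C = C_(phi,w) makes mu_w o phi^-1 sigma-finite, so it
   has a real-valued density h, and |C| is the multiplication by s = sqrt h, since
   |C f| and s f have the same norm. The polar isometry U is the weighted
   composition by v = w / (s o phi), and |C|^a is the multiplication by s^a. Hence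
   |C| U and the Aluthge transform send f to [s v (f o phi)] and
   [s^alpha v (s o phi)^(1 - alpha) (f o phi)]; applied to indicators of the sets
   {s <= n} of finite measure, either condition becomes: s o phi = s almost
   everywhere on {w <> 0}.

   The modulus, the polar isometry and the spectral measure are obtained by choice,
   so uniqueness has to be shown for each. If P is a positive square root of the
   multiplication by h, or a spectral projection of the multiplication by s, then P
   commutes with the multiplication by (1 + h)^-1, hence with the bounded functions
   of h obtained from it by algebra operations, square roots and bounded pointwise
   limits; comparing quadratic forms then identifies P. *)
From HB Require Import structures.
From mathcomp Require Import all_boot all_order all_algebra.
From mathcomp Require Import complex sesquilinear.
From mathcomp Require Import all_classical all_reals all_analysis.
From mathcomp Require Import measurable_realfun.
From mathcomp Require Import ring lra.
Require Import Defs.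

Set Implicit Arguments.
Unset Strict Implicit.
Unset Printing Implicit Defensive.

Import Order.TTheory GRing.Theory Num.Theory.
Import numFieldNormedType.Exports.

Local Open Scope classical_set_scope.
Local Open Scope ring_scope.

(** * Integration *)

(** All that is used of [phi] beyond measurability and null sets is one formula: the integral of (G
    o phi) |w|^2 is that of G h. It yields the common domain and norms of C and of the
    multiplication by s, the vanishing of w almost everywhere on {s o phi = 0}, and the norm of U f.

    With T the multiplication by h, the function (1 + h)^-1 is the entry to the commutant because (1
    + T) f = u has a unique solution f and can be written with graphs alone. If P P = T, then P maps
    the solution for u to the solution for P u; no functional calculus of P is presupposed.

    A spectral integral sees E only through its diagonal measures, so these alone have to be
    identified, and agreement on the rays ]-oo, c[ is enough. There, E and the multiplication by the
    indicator of {s < c} are commuting projections, compared by computing the form of s in two ways.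

    Spectral integrals are taken against mere set functions, which are therefore first replaced by
    measures with the same values on measurable sets. As products of operators carry their natural
    domains, each factorization also calls for a proof that the intermediate vector is square
    integrable. *)

Section SetFunctionIntegral.
Context d (T : measurableType d) (R : realType).
Import HBNNSimple.

(* [m1] need not be a measure: no condition is put on its values at
   nonmeasurable sets. *)
Lemma eq_setfun_integral (m1 m2 : set T -> \bar R) (D : set T) (f : T -> \bar R) :
  (forall A, measurable A -> m1 A = m2 A) ->
  (\int[m1]_(x in D) f x = \int[m2]_(x in D) f x)%E.
Proof.
move=> m12.
have E (h : {nnsfun T >-> R}) : sintegral m1 h = sintegral m2 h.
  by apply: eq_fsbigr => r _; rewrite m12.
rewrite /integral.
by congr (ereal_sup _ - ereal_sup _)%E; apply/seteqP; split=> _ [h hf <-];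
  exists h => //; rewrite E.
Qed.

End SetFunctionIntegral.

(** A bundled measure is nonnegative on every set, so [F] is replaced by 0 off the measurable sets;
    sigma-additivity tests measurable sets only. *)
Lemma measure_of_setfun d (T : measurableType d) (R : realType)
    (F : set T -> \bar R) : F set0 = 0%E ->
  (forall A, measurable A -> (0 <= F A)%E) -> semi_sigma_additive F ->
  {m : {measure set T -> \bar R} | forall A, measurable A -> m A = F A}.
Proof.
move=> F0 Fge0 Fsigma; pose G A := if `[< measurable A >] then F A else 0%E.
have GE A : measurable A -> G A = F A by move=> mA; rewrite /G asboolT.
have G0 : G set0 = 0%E by rewrite GE.
have Gge0 A : (0 <= G A)%E by rewrite /G; case: asboolP => // mA; exact: Fge0.
have Gsigma : semi_sigma_additive G.
  move=> B mB tB mUB; rewrite GE//.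
  by under eq_fun do under eq_bigr do rewrite GE//; exact: Fsigma.
pose M := isMeasure.Build _ _ _ G G0 Gge0 Gsigma.
by exists (HB.pack G M : {measure set T -> \bar R}).
Qed.

Lemma density_measureP d (T : measurableType d) (R : realType)
    (mu : {measure set T -> \bar R}) (k : T -> R) :
  measurable_fun setT k -> (forall x, 0 <= k x) ->
  {m : {measure set T -> \bar R} |
    forall A, measurable A -> m A = (\int[mu]_(x in A) (k x)%:E)%E}.
Proof.
move=> mk k0; apply: (@measure_of_setfun _ _ _ (fun A => \int[mu]_(x in A) (k x)%:E)%E).
- exact: integral_set0.
- by move=> A _; apply: integral_ge0 => x _; rewrite lee_fin.
- apply: semi_sigma_additive_nng_induced => [|x]; last by rewrite lee_fin.
  exact/measurable_EFinP.
Qed.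

Lemma pushforward_measureP d d' (X : measurableType d) (Y : measurableType d')
    (R : realType) (m : {measure set X -> \bar R}) (psi : X -> Y) :
  measurable_fun setT psi ->
  {M : {measure set Y -> \bar R} | forall A, measurable A -> M A = m (psi @^-1` A)}.
Proof.
move=> mpsi.
have mpre A : measurable A -> measurable (psi @^-1` A).
  by move=> mA; rewrite -[X in measurable X]setTI; apply: mpsi.
apply: (@measure_of_setfun _ _ _ (fun A => m (psi @^-1` A))).
- by rewrite preimage_set0 measure0.
- by move=> A _; exact: measure_ge0.
- move=> F mF tF mUF; rewrite preimage_bigcup; apply: measure_semi_sigma_additive.
  + by move=> i; exact: mpre.
  + by move=> i j _ _ [x [Fi Fj]]; apply: tF => //; exists (psi x).
  + by rewrite -preimage_bigcup; exact: mpre.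
Qed.

Section Transfer.
Context d d' (X : measurableType d) (Y : measurableType d') (R : realType).
Import HBNNSimple.
Local Open Scope ereal_scope.

(** Image measures and densities are treated together: [psi] = id is integration against a density,
    [k] = |w|^2 and [psi] = [phi] is the measure behind C. Both sides are additive in [F], so
    monotone convergence reduces the claim to simple functions. *)
Lemma ge0_integral_transfer (mu : {measure set X -> \bar R})
    (m : {measure set Y -> \bar R}) (psi : X -> Y) (k : X -> R) (F : Y -> R) :
  measurable_fun setT psi -> measurable_fun setT k -> (forall x, 0 <= k x)%R ->
  (forall A, measurable A -> m A = \int[mu]_(x in psi @^-1` A) (k x)%:E) ->
  measurable_fun setT F -> (forall y, 0 <= F y)%R ->
  \int[m]_y (F y)%:E = \int[mu]_x (F (psi x) * k x)%:E.
Proof.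
move=> mpsi mk k0 mE mF F0.
have mEF : measurable_fun setT (EFin \o F) by exact/measurable_EFinP.
pose g := nnsfun_approx measurableT mEF.
have gF y : (g n y)%:E @[n --> \oo] --> (F y)%:E.
  by apply: cvg_nnsfun_approx => // z _; rewrite lee_fin.
have gnd y : nondecreasing_seq (fun n => g n y).
  by move=> i j ij; exact/lefP/nd_nnsfun_approx.
have mg n : measurable_fun setT (fun x => g n (psi x) * k x)%R.
  by apply: measurable_funM => //; exact: measurableT_comp.
transitivity (limn (fun n => \int[m]_y (g n y)%:E)).
  rewrite -monotone_convergence//.
  - by apply: eq_integral => y _; apply/esym/cvg_lim => //; exact: gF.
  - by move=> n; exact/measurable_EFinP.
  - by move=> n y _; rewrite lee_fin.
  - by move=> y _ i j ij; rewrite lee_fin gnd.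
transitivity (limn (fun n => \int[mu]_x (g n (psi x) * k x)%:E)); last first.
  rewrite -monotone_convergence//.
  - apply: eq_integral => x _; apply/cvg_lim => //.
    by under eq_fun do rewrite EFinM; rewrite EFinM; apply: cvgeZr => //; exact: gF.
  - by move=> n; exact/measurable_EFinP.
  - by move=> n y _; rewrite lee_fin mulr_ge0.
  - by move=> y _ i j ij; rewrite lee_fin ler_wpM2r// gnd.
congr (limn _); apply/funext => n.
have mpre r : measurable (psi @^-1` (g n @^-1` [set r])).
  by rewrite -[X in measurable X]setTI; apply: mpsi.
rewrite integral_nnsfun// sintegralE.
under [RHS]eq_integral => x _.
  rewrite [X in (X * _)%R](fimfunE (g n)).
  rewrite fsbig_finite//= mulr_suml -sumEFin -fsbig_finite//; over.
rewrite ge0_integral_fsum//; last 2 first.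
- move=> r; apply/measurable_EFinP; apply: measurable_funM => //.
  apply: measurable_funM => //; apply: measurableT_comp => //.
- move=> r x _; rewrite lee_fin mulr_ge0// -lee_fin.
  exact: nnfun_muleindic_ge0.
rewrite patch_setT.
apply: eq_fsbigr => r /[!inE] -[y _ yr].
have r0 : (0 <= r)%R by rewrite -yr.
under [RHS]eq_integral do rewrite -mulrA EFinM.
rewrite ge0_integralZl_EFin//; last 2 first.
- by move=> x _; rewrite lee_fin mulr_ge0.
- apply/measurable_EFinP; apply: measurable_funM => //.
  by apply: measurableT_comp.
rewrite mE// integral_mkcond; congr (_ * _); apply: eq_integral => x _.
rewrite patchE indicE; case: ifPn => [/set_mem/= xr|/negP xr].
  by rewrite mem_set// mul1r.
by rewrite memNset ?mul0r// => /= ?; apply: xr; rewrite inE.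
Qed.

End Transfer.

(** * Densities of measures that are finite on countably many pieces *)

Section RadonNikodym.
Context d (T : measurableType d) (R : realType).
Local Open Scope ereal_scope.

(** The restrictions of [nu] to disjoint pieces are finite and have densities. At each point at most
    one of these contributes to the sum [h], which is why [h] is real-valued. *)
Lemma radon_nikodym_exhaustion (mu : {sigma_finite_measure set T -> \bar R})
    (nu : {measure set T -> \bar R}) (A : nat -> set T) :
  nu `<< mu -> (forall k, measurable (A k)) -> (forall k, nu (A k) < +oo) ->
  nu (~` \bigcup_k A k) = 0 ->
  exists h : T -> R, [/\ measurable_fun setT h, forall x, (0 <= h x)%R &
    forall E, measurable E -> nu E = \int[mu]_(x in E) (h x)%:E].
Proof.
move=> numu mA nuA nuC.
pose B := seqDU A.
have mB k : measurable (B k).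
  by apply: measurableD => //; exact: bigsetU_measurable.
have nuB k : nu (B k) < +oo.
  by rewrite (le_lt_trans _ (nuA k))// le_measure ?inE//; exact: subDsetl.
have tB : trivIset setT B by exact: trivIset_seqDU.
have UB : \bigcup_k B k = \bigcup_k A k by rewrite [RHS]seqDU_bigcup_eq.
pose nu_ k : {finite_measure set T -> \bar R} := mfrestr (mB k) (nuB k).
have nu_mu k : nu_ k `<< mu.
  apply/null_content_dominatesP => S mS muS0.
  move/null_content_dominatesP : numu; apply; first exact: measurableI.
  apply/eqP; rewrite -measure_le0 -muS0 le_measure ?inE//.
  exact: measurableI.
have [g] := choice (fun k => radon_nikodym_sigma_finite (nu_mu k)).
move=> /all_and4[g0 gfin gint gE].
(* The density [g k] of the restriction is not known to vanish outside [B k]; the indicator makes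
   the supports disjoint at every point. *)
pose f k x := (fine (g k x) * \1_(B k) x)%R.
have mg k : measurable_fun setT (g k) by exact: measurable_int (gint k).
have mf k : measurable_fun setT (f k).
  apply: measurable_funM => //.
  by apply: measurableT_comp => //; exact: mg.
have f0 k x : (0 <= f k x)%R by rewrite mulr_ge0// fine_ge0.
pose h x := \sum_(k <oo) (f k x)%:E.
have fdisj x j k : B j x -> k != j -> f k x = 0%R.
  move=> Bjx kj; rewrite /f indicE memNset ?mulr0// => Bkx.
  by move: kj; rewrite (tB k j I I (ex_intro _ x (conj Bkx Bjx))) eqxx.
have hfin x : h x \is a fin_num.
  have [[j _ Bjx]|nB] := pselect ((\bigcup_k B k) x); last first.
    rewrite /h eseries0// => k _ _; congr EFin.
    by rewrite /f indicE memNset ?mulr0// => Bkx; apply: nB; exists k.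
  rewrite /h (@nneseriesD1 _ _ j)//; last by move=> k _; rewrite lee_fin.
  by rewrite eseries0 ?adde0// => k _ /= kj; rewrite (fdisj _ _ _ Bjx).
have mh : measurable_fun setT h.
  by apply: ge0_emeasurable_sum => // k *; [rewrite lee_fin|exact/measurable_EFinP].
exists (fine \o h); split.
- exact: measurableT_comp.
- by move=> x; rewrite fine_ge0// nneseries_ge0// => k _ _; rewrite lee_fin.
move=> E mE; under eq_integral do rewrite /= fineK//.
rewrite integral_nneseries//; last 2 first.
- by move=> k; apply/measurable_EFinP/measurable_funTS.
- by move=> k x _; rewrite lee_fin.
transitivity (nu (E `&` \bigcup_k B k)).
  have mUB : measurable (\bigcup_k B k) by exact: bigcup_measurable.
  rewrite -{1}(setUIDK E (\bigcup_k B k)) measureU//; last 3 first.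
  - exact: measurableI.
  - exact: measurableD.
  - by rewrite setDE setIACA setICr setI0.
  rewrite [X in _ + X](_ : _ = 0) ?adde0//.
  apply/eqP; rewrite -measure_le0 -nuC le_measure ?inE//.
  - exact: measurableD.
  - by apply: measurableC; rewrite -UB.
  - by rewrite UB setDE; exact: subIsetr.
rewrite setI_bigcupr measure_bigcup//; last 2 first.
- by move=> k _; exact: measurableI.
- exact: trivIset_setIl.
rewrite [RHS](@eq_eseriesl _ _ (fun k => k \in [set: nat])); last by move=> k; rewrite in_setT.
apply: eq_eseriesr => k _.
have -> : nu (E `&` B k) = nu_ k (E `&` B k).
  by rewrite /nu_/= /mfrestr /mrestr -setIA setIid.
rewrite gE; last exact: measurableI.
rewrite integral_mkcondr; apply: eq_integral => x _.
by rewrite /f patchE indicE; case: ifPn => _; rewrite ?mulr1 ?mulr0// fineK.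
Qed.

End RadonNikodym.

(** * Square integrable functions *)

Section ComplexMeasurable.
Context d (X : measurableType d) (R : realType).

Lemma abs2M (x y : R[i]) : abs2 (x * y) = abs2 x * abs2 y.
Proof. by case: x y => [a b] [c e]; rewrite /abs2 /=; ring. Qed.

Lemma abs2C (r : R) : abs2 (r%:C)%C = r ^+ 2.
Proof. by rewrite /abs2 /= expr0n addr0. Qed.

Lemma abs2_eq0 (x : R[i]) : (abs2 x == 0) = (x == 0).
Proof.
by case: x => a b; rewrite /abs2 paddr_eq0 ?sqr_ge0//= !sqrf_eq0 eq_complex.
Qed.

Lemma abs20 : abs2 (0 : R[i]) = 0.
Proof. by apply/eqP; rewrite abs2_eq0. Qed.

Lemma mul_conj_real (a : R) (x y : R[i]) :
  x * (a%:C%C * y)^* = a%:C%C * (x * y^* ).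
Proof.
case: x y => [x1 x2] [y1 y2]; apply/eqP; rewrite eq_complex /=.
by apply/andP; split; apply/eqP; ring.
Qed.

Lemma cmeasurableM (f g : X -> R[i]) :
  cmeasurable f -> cmeasurable g -> cmeasurable (fun x => f x * g x).
Proof.
move=> [fr fi] [gr gi]; split.
  under eq_fun do rewrite Defs.ReM.
  by apply: measurable_funB; apply: measurable_funM.
under eq_fun do rewrite Defs.ImM.
by apply: measurable_funD; apply: measurable_funM.
Qed.

Lemma cmeasurable_real (k : X -> R) :
  measurable_fun setT k -> cmeasurable (fun x => (k x)%:C%C).
Proof. by move=> mk; split => //=; exact: measurable_cst. Qed.

Lemma cmeasurable_comp d' (Y : measurableType d') (f : Y -> R[i]) (psi : X -> Y) :
  cmeasurable f -> measurable_fun setT psi -> cmeasurable (f \o psi).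
Proof.
by move=> [fr fi] mpsi; split; [apply: (measurableT_comp fr)|apply: (measurableT_comp fi)].
Qed.

End ComplexMeasurable.

(* [ip], [toL2], [bmul] and [nsq] are locked because failing conversion checks
   between instances of them would otherwise unfold integrals and quotients. *)
HB.lock Definition L2_inner {d} {X : measurableType d} {R : realType}
  {mu : {measure set X -> \bar R}} (u v : L2 mu) : R[i] := L2dot mu u v.

HB.lock Definition L2_of_fun {d} {X : measurableType d} {R : realType}
  (mu : {measure set X -> \bar R}) (f : X -> R[i]) : L2 mu :=
  L2class (insubd (0 : L2fun mu) (f : X -> R[i]^o)).

HB.lock Definition L2_mult {d} {X : measurableType d} {R : realType}
  {mu : {measure set X -> \bar R}} (k : X -> R) (u : L2 mu) : L2 mu :=
  @L2_of_fun.body _ _ _ mu (fun x => (k x)%:C%C * repr u x).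

HB.lock Definition L2_normsq {d} {X : measurableType d} {R : realType}
  {mu : {measure set X -> \bar R}} (u : L2 mu) : R :=
  \int[mu]_x abs2 (repr u x).

Notation ip := L2_inner.body.
Notation toL2 := L2_of_fun.body.
Notation bmul := L2_mult.body.
Notation nsq := L2_normsq.body.

Section L2Toolkit.
Context d (X : measurableType d) (R : realType) (mu : {measure set X -> \bar R}).
Implicit Types (u v : L2 mu) (f g : X -> R[i]) (k : X -> R).

Definition isL2 f := cmeasurable f /\ square_integrable mu f.

Lemma isL2_repr u : isL2 (repr u).
Proof. by have /L2predP := L2valP (repr u). Qed.

Lemma measurable_abs2_repr u : measurable_fun setT (fun x => abs2 (repr u x)).
Proof. by apply: cmeasurable_abs2; case: (isL2_repr u). Qed.

Lemma repr_toL2 f : isL2 f -> {ae mu, forall x, repr (toL2 mu f) x = f x}.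
Proof.
move=> fL2; rewrite L2_of_fun.unlock; have := L2repr_ae (insubd (0 : L2fun mu) (f : X -> R[i]^o)).
apply: filterS => x -> /=.
by have -> : L2val (insubd (0 : L2fun mu) (f : X -> R[i]^o)) = f
  by apply: insubdK; apply/L2predP.
Qed.

Lemma L2_ext u v : {ae mu, forall x, repr u x = repr v x} -> u = v.
Proof. by move=> /L2classP; rewrite !L2reprK. Qed.

Lemma repr_lin a u v :
  {ae mu, forall x, repr (a *: u + v) x = a * repr u x + repr v x}.
Proof.
have -> : a *: u + v = L2class (a *: repr u + repr v).
  by rewrite L2classD L2class_scale !L2reprK.
exact: L2repr_ae.
Qed.

Lemma reprD u v : {ae mu, forall x, repr (u + v) x = repr u x + repr v x}.
Proof.
by have := repr_lin 1 u v; rewrite scale1r; apply: filterS => x; rewrite mul1r.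
Qed.

Lemma reprB u v : {ae mu, forall x, repr (u - v) x = repr u x - repr v x}.
Proof.
have := repr_lin (-1) v u; rewrite scaleN1r addrC; apply: filterS => x ->.
by rewrite mulN1r addrC.
Qed.

Lemma repr0 : {ae mu, forall x, repr (0 : L2 mu) x = 0}.
Proof.
by have := reprB 0 0; rewrite subr0; apply: filterS => x ->; rewrite subrr.
Qed.

Lemma reprZ a u : {ae mu, forall x, repr (a *: u) x = a * repr u x}.
Proof.
have := repr_lin a u 0; rewrite addr0; have := repr0.
by apply: filterS2 => x -> ->; rewrite addr0.
Qed.

Lemma isL2_le f g (c : R) : cmeasurable f -> isL2 g ->
  {ae mu, forall x, abs2 (f x) <= c * abs2 (g x)} -> isL2 f.
Proof.
move=> mf [mg g2] fg; split=> //.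
move/square_integrableP : g2 => /(_ mg) ig.
have := integrableZl measurableT c ig => icg.
rewrite /square_integrable.
apply: (@le_lt_trans _ _ (\int[mu]_x `|c%:E * (abs2 (g x))%:E|)%E); last first.
  by have /integrableP[] := icg.
apply: ae_ge0_le_integral => //.
- by move=> x _; rewrite lee_fin abs2_ge0.
- by apply/measurable_EFinP; exact: cmeasurable_abs2.
- by apply: measurableT_comp => //; exact: measurable_int icg.
- apply: filterS fg => x fgx _; rewrite -EFinM /= lee_fin.
  by rewrite (le_trans fgx)// ler_norm.
Qed.

Definition bounded_mfun k :=
  measurable_fun setT k /\ exists M, forall x, `|k x| <= M.

Lemma isL2_bmul k f : bounded_mfun k -> isL2 f -> isL2 (fun x => (k x)%:C%C * f x).
Proof.
move=> [mk [M kM]] fL2; apply: (@isL2_le _ f (M ^+ 2)) => //.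
  by apply: cmeasurableM; [exact: cmeasurable_real|case: fL2].
apply: aeW => x; rewrite abs2M abs2C ler_wpM2r ?abs2_ge0//.
by rewrite -(real_normK (num_real _)) lerXn2r ?nnegrE// (le_trans _ (kM x)).
Qed.

Lemma bmulE k u : bounded_mfun k ->
  {ae mu, forall x, repr (bmul k u) x = (k x)%:C%C * repr u x}.
Proof. by move=> bk; rewrite L2_mult.unlock; apply/repr_toL2/isL2_bmul => //; exact: isL2_repr. Qed.

Lemma dotDl u v w : ip (u + v) w = ip u w + ip v w.
Proof. by rewrite L2_inner.unlock; have := L2dot_linear w 1 u v; rewrite scale1r mul1r. Qed.

Lemma dot0l w : ip (0 : L2 mu) w = 0.
Proof. by apply: (addrI (ip 0 w)); rewrite -dotDl !addr0. Qed.

Lemma dotZl a u w : ip (a *: u) w = a * ip u w.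
Proof.
have := dot0l w; rewrite L2_inner.unlock => z.
by have := L2dot_linear w a u 0; rewrite z !addr0.
Qed.

Lemma dotBl u v w : ip (u - v) w = ip u w - ip v w.
Proof. by rewrite dotDl -scaleN1r dotZl mulN1r. Qed.

Lemma dotNl u w : ip (- u) w = - ip u w.
Proof. by rewrite -scaleN1r dotZl mulN1r. Qed.

Lemma dotC u v : ip u v = (ip v u)^*.
Proof. by rewrite L2_inner.unlock; exact: L2dotC. Qed.

Lemma dotDr u v w : ip w (u + v) = ip w u + ip w v.
Proof. by rewrite dotC dotDl rmorphD /= -!dotC. Qed.

Lemma dotZr a u w : ip w (a *: u) = a^* * ip w u.
Proof. by rewrite dotC dotZl rmorphM /= -!dotC. Qed.

Lemma dotBr u v w : ip w (u - v) = ip w u - ip w v.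
Proof. by rewrite dotC dotBl rmorphB /= -!dotC. Qed.

Lemma dot0r w : ip w (0 : L2 mu) = 0.
Proof. by rewrite dotC dot0l rmorph0. Qed.

Lemma integrable_abs2 f : isL2 f ->
  mu.-integrable setT (fun x => (abs2 (f x))%:E).
Proof. by move=> [mf f2]; apply/square_integrableP. Qed.

Lemma nsq_ge0 u : 0 <= nsq u.
Proof. by rewrite L2_normsq.unlock; apply: Rintegral_ge0 => x _; exact: abs2_ge0. Qed.

Lemma nsqE u : (nsq u)%:E = (\int[mu]_x (abs2 (repr u x))%:E)%E.
Proof.
by rewrite L2_normsq.unlock fineK// integrable_fin_num//; apply: integrable_abs2; exact: isL2_repr.
Qed.

Lemma dotuu u : ip u u = (nsq u)%:C%C.
Proof.
rewrite L2_inner.unlock L2_normsq.unlock; congr Complex.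
  apply: eq_Rintegral => x _.
  by case: (repr u x) => a b /=; rewrite /abs2 /=; ring.
rewrite -[RHS](mul0r (fine (mu setT))) -(Rintegral_cst mu measurableT).
by apply: eq_Rintegral => x _; case: (repr u x) => a b /=; ring.
Qed.

Lemma dotuu_eq0 u : ip u u = 0 -> u = 0.
Proof.
by rewrite L2_inner.unlock; apply: contra_eq => /L2dot_gt0; rewrite lt_neqAle eq_sym => /andP[].
Qed.

Lemma nsq_eq0 u : nsq u = 0 -> u = 0.
Proof. by move=> u0; apply: dotuu_eq0; rewrite dotuu u0. Qed.

Lemma dotP u v : (forall w, ip w u = ip w v) -> u = v.
Proof.
move=> uv; apply/eqP; rewrite -subr_eq0; apply/eqP/dotuu_eq0.
by rewrite dotBr uv subrr.
Qed.

Lemma cintegrable_dot u v : cintegrable mu (fun x => repr u x * (repr v x)^* ).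
Proof. exact: L2_cintegrable. Qed.

Lemma eq_dot u v f : cmeasurable f ->
  {ae mu, forall x, repr u x * (repr v x)^* = f x} ->
  ip u v = cintegral mu f.
Proof. by move=> mf; rewrite L2_inner.unlock; apply: eq_cintegral => //; exact: L2prod_measurable. Qed.

Lemma dot_bmulr k u v : bounded_mfun k -> ip u (bmul k v) =
  cintegral mu (fun x => (k x)%:C%C * (repr u x * (repr v x)^* )).
Proof.
move=> bk; apply: eq_dot.
  apply: cmeasurableM; first by case: bk => mk _; exact: cmeasurable_real.
  exact: L2prod_measurable.
apply: filterS (bmulE v bk) => x ->.
exact: mul_conj_real.
Qed.

Lemma dot_bmulC k u v : bounded_mfun k ->
  ip (bmul k u) v = ip u (bmul k v).
Proof.
move=> bk; rewrite dot_bmulr//; apply: eq_dot.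
  apply: cmeasurableM; first by case: bk => mk _; exact: cmeasurable_real.
  exact: L2prod_measurable.
by apply: filterS (bmulE u bk) => x ->; rewrite mulrA.
Qed.

Lemma adjointP (Z : operator (L2 mu)) u v : adjoint (L2dot mu) Z (u, v) <->
  forall f g : L2 mu, Z (f, g) -> ip g u = ip f v.
Proof. by rewrite L2_inner.unlock. Qed.

Lemma densely_definedP (Z : operator (L2 mu)) : densely_defined (L2dot mu) Z <->
  forall (f : L2 mu) (e : R), 0 < e -> exists2 g, opdom Z g & nsq (f - g) < e.
Proof.
split => H f e e0; have [g gZ fg] := H f e e0; exists g => //.
  have : (L2dot mu (f - g) (f - g) < (e%:C)%C) by [].
  by have := dotuu (f - g); rewrite L2_inner.unlock => ->; rewrite ltcR.
have : (L2dot mu (f - g) (f - g) < (e%:C)%C) -> _ := id; apply.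
by have := dotuu (f - g); rewrite L2_inner.unlock => ->; rewrite ltcR.
Qed.

End L2Toolkit.

Section BoundedMultipliers.
Context d (X : measurableType d) (R : realType) (mu : {measure set X -> \bar R}).
Implicit Types (u v : L2 mu) (f g : X -> R[i]) (k : X -> R).

Lemma bounded_mfun_cst (a : R) : bounded_mfun (fun _ : X => a).
Proof. by split; [exact: measurable_cst|exists `|a|]. Qed.

Lemma bounded_mfunM k1 k2 : bounded_mfun k1 -> bounded_mfun k2 ->
  bounded_mfun (fun x => k1 x * k2 x).
Proof.
move=> [mk1 [M1 b1]] [mk2 [M2 b2]]; split; first exact: measurable_funM.
by exists (M1 * M2) => x; rewrite normrM ler_pM.
Qed.

Lemma bounded_mfunD k1 k2 : bounded_mfun k1 -> bounded_mfun k2 ->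
  bounded_mfun (fun x => k1 x + k2 x).
Proof.
move=> [mk1 [M1 b1]] [mk2 [M2 b2]]; split; first exact: measurable_funD.
by exists (M1 + M2) => x; rewrite (le_trans (ler_normD _ _))// lerD.
Qed.

Lemma bounded_mfun01 k : measurable_fun setT k ->
  (forall x, 0 <= k x <= 1) -> bounded_mfun k.
Proof.
move=> mk k01; split => //; exists 1 => x.
by have /andP[k0 k1] := k01 x; rewrite ger0_norm.
Qed.

Lemma bounded_mfun_indic (A : set X) : measurable A ->
  bounded_mfun (\1_A : X -> R).
Proof.
move=> mA; apply: bounded_mfun01 => // x.
by rewrite indicE; case: (_ \in _); rewrite /= ?lexx ?ler01.
Qed.

Lemma bmulM k1 k2 u : bounded_mfun k1 -> bounded_mfun k2 ->
  bmul (fun x => k1 x * k2 x) u = bmul k1 (bmul k2 u).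
Proof.
move=> b1 b2; apply: L2_ext.
move: (bmulE u (bounded_mfunM b1 b2)) (bmulE (bmul k2 u) b1) (bmulE u b2).
by apply: filterS3 => x -> -> ->; rewrite rmorphM mulrA.
Qed.

Lemma bmulD k1 k2 u : bounded_mfun k1 -> bounded_mfun k2 ->
  bmul (fun x => k1 x + k2 x) u = bmul k1 u + bmul k2 u.
Proof.
move=> b1 b2; apply: L2_ext.
have E : {ae mu, forall x, repr (bmul (fun x => k1 x + k2 x) u) x =
    (k1 x)%:C%C * repr u x + (k2 x)%:C%C * repr u x}.
  by apply: filterS (bmulE u (bounded_mfunD b1 b2)) => x ->; rewrite rmorphD mulrDl.
have D := reprD (bmul k1 u) (bmul k2 u).
near=> x; rewrite (near D x _)//.
by rewrite (near (bmulE u b1) x _)// (near (bmulE u b2) x _)// (near E x _).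
Unshelve. all: by end_near. Qed.

Lemma bmul_cst (a : R) u : bmul (fun=> a) u = a%:C%C *: u.
Proof.
apply: L2_ext; move: (bmulE u (bounded_mfun_cst a)) (reprZ a%:C%C u).
by apply: filterS2 => x -> ->.
Qed.

Lemma eq_bmul k1 k2 u : bounded_mfun k1 -> k1 =1 k2 -> bmul k1 u = bmul k2 u.
Proof. by move=> b1 /funext ->. Qed.

Lemma bmul_lin k (a : R[i]) u v : bounded_mfun k ->
  bmul k (a *: u + v) = a *: bmul k u + bmul k v.
Proof.
move=> bk; apply: L2_ext.
have E1 := bmulE (a *: u + v) bk; have E2 := repr_lin a u v.
have E3 := repr_lin a (bmul k u) (bmul k v).
have E4 := bmulE u bk; have E5 := bmulE v bk.
near=> x.
rewrite (near E1 x _)// (near E2 x _)// (near E3 x _)// (near E4 x _)// (near E5 x _)//.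
by rewrite mulrDr mulrCA.
Unshelve. all: by end_near. Qed.

Lemma cvg_Rintegral_bounded (z : X -> R) (kn : nat -> X -> R) k (M : R) :
  mu.-integrable setT (EFin \o z) -> (forall n, measurable_fun setT (kn n)) ->
  measurable_fun setT k -> (forall n x, `|kn n x| <= M) ->
  (forall x, kn n x @[n --> \oo] --> k x) ->
  \int[mu]_x (kn n x * z x) @[n --> \oo] --> \int[mu]_x (k x * z x).
Proof.
move=> iz mkn mk knM knk.
have mz : measurable_fun setT z by apply/measurable_EFinP; exact: measurable_int iz.
have ig : mu.-integrable setT (fun x => (M%:E * `|(z x)%:E|)%E).
  by apply: integrableZl => //; exact: integrable_abse.
have mknz n : measurable_fun setT (fun x => (kn n x * z x)%:E).
  by apply/measurable_EFinP; exact: measurable_funM.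
have mkz : measurable_fun setT (fun x => (k x * z x)%:E).
  by apply/measurable_EFinP; exact: measurable_funM.
have f_f : {ae mu, forall x, setT x ->
    (kn n x * z x)%:E @[n --> \oo] --> (k x * z x)%:E}.
  by apply: aeW => x _; apply: cvg_EFin; [exact: nearW|exact: cvgMr_tmp].
have f_g : {ae mu, forall x n, setT x ->
    (`|(kn n x * z x)%:E| <= M%:E * `|(z x)%:E|)%E}.
  by apply: aeW => x n _; rewrite -EFinM /= lee_fin normrM ler_wpM2r.
have [ikz _ cvgI] := dominated_convergence measurableT mknz mkz f_f ig f_g.
rewrite -(fineK (integrable_fin_num measurableT ikz)) in cvgI; exact: (fine_cvg cvgI).
Qed.

(** Dominated convergence gives weak convergence, which is all that is required to pass to the limit
    inside a selfadjoint graph. *)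
Lemma cvg_dot_bmul (kn : nat -> X -> R) k (M : R) u v :
  (forall n, bounded_mfun (kn n)) -> bounded_mfun k ->
  (forall n x, `|kn n x| <= M) -> (forall x, kn n x @[n --> \oo] --> k x) ->
  complex.Re (ip u (bmul (kn n) v)) @[n --> \oo] -->
    complex.Re (ip u (bmul k v)) /\
  complex.Im (ip u (bmul (kn n) v)) @[n --> \oo] -->
    complex.Im (ip u (bmul k v)).
Proof.
move=> bkn bk knM knk; have [ir ii] := cintegrable_dot u v.
pose zr x := complex.Re (repr u x * (repr v x)^* ).
pose zi x := complex.Im (repr u x * (repr v x)^* ).
have rE l : bounded_mfun l ->
    complex.Re (ip u (bmul l v)) = \int[mu]_x (l x * zr x).
  move=> bl; rewrite dot_bmulr//=; apply: eq_Rintegral => x _.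
  by rewrite Defs.ReM /= mul0r subr0.
have iE l : bounded_mfun l ->
    complex.Im (ip u (bmul l v)) = \int[mu]_x (l x * zi x).
  move=> bl; rewrite dot_bmulr//=; apply: eq_Rintegral => x _.
  by rewrite Defs.ImM /= mul0r addr0.
rewrite (rE k bk) (iE k bk); split.
- rewrite (funext (fun n => rE (kn n) (bkn n))).
  apply: (cvg_Rintegral_bounded (M := M)) => //; last by case: bk.
  by move=> n; case: (bkn n).
- rewrite (funext (fun n => iE (kn n) (bkn n))).
  apply: (cvg_Rintegral_bounded (M := M)) => //; last by case: bk.
  by move=> n; case: (bkn n).
Qed.

End BoundedMultipliers.

(** * Multipliers commuting with a selfadjoint operator *)

Section Commutant.
Context d (X : measurableType d) (R : realType) (mu : {measure set X -> \bar R}).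
Variable Z : operator (L2 mu).
Hypothesis Zsa : adjoint (L2dot mu) Z = Z.
Implicit Types (u v f g : L2 mu) (k : X -> R).

(** An adjoint is cut out by equations that are linear in the pair, so linearity of [Z] comes for
    free from [Zsa]. *)
Lemma selfadjoint_lin a f g f' g' :
  Z (f, g) -> Z (f', g') -> Z (a *: f + f', a *: g + g').
Proof.
rewrite -Zsa => /adjointP Zf /adjointP Zf'; apply/adjointP => u v Zuv.
by rewrite !dotDr !dotZr (Zf _ _ Zuv) (Zf' _ _ Zuv).
Qed.

(** This is commutation of a bounded operator with an unbounded one: the product k Z is contained in
    Z k. Boundedness is included so that the closure lemmas carry no side conditions. *)
Definition commutes k :=
  bounded_mfun k /\ forall f g, Z (f, g) -> Z (bmul k f, bmul k g).

Lemma commutesM k1 k2 : commutes k1 -> commutes k2 ->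
  commutes (fun x => k1 x * k2 x).
Proof.
move=> [b1 c1] [b2 c2]; split; first exact: bounded_mfunM.
by move=> f g Zfg; rewrite !bmulM//; exact/c1/c2.
Qed.

Lemma commutesD k1 k2 : commutes k1 -> commutes k2 ->
  commutes (fun x => k1 x + k2 x).
Proof.
move=> [b1 c1] [b2 c2]; split; first exact: bounded_mfunD.
move=> f g Zfg; rewrite !bmulD// -[bmul k1 f]scale1r -[bmul k1 g]scale1r.
by apply: selfadjoint_lin; [exact: c1|exact: c2].
Qed.

Lemma selfadjoint00 : Z (0, 0).
Proof. by rewrite -Zsa; apply/adjointP => f g _; rewrite !dot0r. Qed.

Lemma commutes_cst (a : R) : commutes (fun=> a).
Proof.
split; first exact: bounded_mfun_cst.
move=> f g Zfg; rewrite !bmul_cst -[_ *: f]addr0 -[_ *: g]addr0.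
by apply: selfadjoint_lin => //; exact: selfadjoint00.
Qed.

Lemma commutes_ext k1 k2 : k1 =1 k2 -> commutes k1 -> commutes k2.
Proof. by move=> /funext ->. Qed.

(** Since [Z] is its own adjoint, membership in [Z] is a family of equations between inner products,
    and each of them survives a weak limit. *)
Lemma commutes_cvg (kn : nat -> X -> R) k (M : R) :
  (forall n, commutes (kn n)) ->
  (forall n x, `|kn n x| <= M) -> (forall x, kn n x @[n --> \oo] --> k x) ->
  commutes k.
Proof.
move=> ckn knM knk; have bkn n : bounded_mfun (kn n) by case: (ckn n).
have bk : bounded_mfun k.
  split.
    apply: (measurable_fun_cvg (h := kn)) => // n.
    by case: (bkn n).
  by exists M => x; apply: (cvgr_to_le (cvg_norm (knk x))); exact: nearW.
split=> // f g Zfg; rewrite -Zsa; apply/adjointP => u v Zuv.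
have [vr vi] := cvg_dot_bmul v f bkn bk knM knk.
have [ur ui] := cvg_dot_bmul u g bkn bk knM knk.
have E n : ip v (bmul (kn n) f) = ip u (bmul (kn n) g).
  have [_ /(_ _ _ Zfg)] := ckn n.
  by rewrite -{1}Zsa => /adjointP/(_ _ _ Zuv).
apply/eqP; rewrite eq_complex; apply/andP; split; apply/eqP.
- have E' : (fun n => complex.Re (ip v (bmul (kn n) f))) =
      (fun n => complex.Re (ip u (bmul (kn n) g))).
    by apply/funext => n; rewrite E.
  by rewrite E' in vr; exact: cvg_unique vr ur.
- have E' : (fun n => complex.Im (ip v (bmul (kn n) f))) =
      (fun n => complex.Im (ip u (bmul (kn n) g))).
    by apply/funext => n; rewrite E.
  by rewrite E' in vi; exact: cvg_unique vi ui.
Qed.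

End Commutant.

(** * Polynomial approximation of the square root *)

Section SqrtIteration.
Context (R : realType).

(** The classical iteration for the square root of a positive contraction. In contrast to Newton's
    method it involves no division, so every iterate is a polynomial in [t]. *)
Fixpoint sqrt_iter (t : R) (n : nat) : R :=
  if n is n'.+1 then sqrt_iter t n' + 2^-1 * (t - sqrt_iter t n' * sqrt_iter t n')
  else 0.

(** With s the square root and y an iterate, a step multiplies the error s - y by 1 - (s + y) / 2.
    This factor lies between 0 and 1 - s / 2 because 0 <= y <= s <= 1. *)
Lemma sqrt_iter_bounds (t : R) n : 0 <= t <= 1 ->
  0 <= sqrt_iter t n <= Num.sqrt t /\
  Num.sqrt t - sqrt_iter t n <= (1 - Num.sqrt t / 2) ^+ n.
Proof.
move=> /andP[t0 t1]; set s := Num.sqrt t.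
have s0 : 0 <= s by exact: sqrtr_ge0.
have s1 : s <= 1 by rewrite -sqrtr1 ler_sqrt.
have st : t = s * s by rewrite -expr2 sqr_sqrtr.
elim: n => [|n [/andP[y0 ys] yn]]; first by rewrite /= subr0 expr0 s0 lexx s1.
rewrite /= -/s; set y := sqrt_iter t n in y0 ys yn *.
have E : s - (y + 2^-1 * (t - y * y)) = (s - y) * (1 - (s + y) / 2).
  by rewrite st; field.
split.
  apply/andP; split; first by rewrite addr_ge0// mulr_ge0// st; nra.
  by rewrite -subr_ge0 E mulr_ge0//; nra.
rewrite E exprSr; apply: ler_pM => //; nra.
Qed.

Lemma cvg_sqrt_iter (t : R) : 0 <= t <= 1 ->
  sqrt_iter t n @[n --> \oo] --> Num.sqrt t.
Proof.
move=> t01; set s := Num.sqrt t.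
have s0 : 0 <= s by exact: sqrtr_ge0.
have s1 : s <= 1 by rewrite -sqrtr1 ler_sqrt//; case/andP: t01.
(* For s = 0 the geometric bound is constantly 1, but then the iterates are squeezed between 0 and
   s. *)
have [s_eq0|sgt0] := eqVneq s 0.
  rewrite s_eq0; have E : sqrt_iter t = fun=> 0.
    apply/funext => n; have [/andP[y0 ys] _] := sqrt_iter_bounds n t01.
    by apply/eqP; rewrite eq_le y0 andbT -s_eq0.
  by rewrite E; exact: cvg_cst.
have sp : 0 < s by rewrite lt_neqAle eq_sym sgt0.
apply/subr_cvg0/cvgNP; rewrite oppr0.
apply: (@squeeze_cvgr _ _ _ _ (fun=> 0) (fun n => (1 - s / 2) ^+ n)).
- near=> n; have [/andP[y0 ys] yn] := sqrt_iter_bounds n t01.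
  by rewrite /= opprB subr_ge0 ys yn.
- exact: cvg_cst.
- by apply: cvg_expr; rewrite ger0_norm; nra.
Unshelve. all: by end_near. Qed.

End SqrtIteration.

Section CommutantCalculus.
Context d (X : measurableType d) (R : realType) (mu : {measure set X -> \bar R}).
Variable Z : operator (L2 mu).
Hypothesis Zsa : adjoint (L2dot mu) Z = Z.
Implicit Types (k : X -> R).

Lemma commutesZ (a : R) k : commutes Z k -> commutes Z (fun x => a * k x).
Proof. by move=> ck; apply: commutesM ck; exact: commutes_cst. Qed.

Lemma commutesB k1 k2 : commutes Z k1 -> commutes Z k2 ->
  commutes Z (fun x => k1 x - k2 x).
Proof.
move=> c1 c2; have := commutesD Zsa c1 (commutesZ (-1) c2).
by apply: commutes_ext => x; rewrite mulN1r.
Qed.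

Lemma commutesX k n : commutes Z k -> commutes Z (fun x => k x ^+ n).
Proof.
move=> ck; elim: n => [|n IH].
  by apply: commutes_ext (commutes_cst Zsa 1) => x; rewrite expr0.
by apply: commutes_ext (commutesM ck IH) => x; rewrite exprS.
Qed.

(* The iteration y + (k - y^2) / 2 stays in the commutant. *)
Lemma commutes_sqrt k : commutes Z k -> (forall x, 0 <= k x <= 1) ->
  commutes Z (fun x => Num.sqrt (k x)).
Proof.
move=> ck k01.
apply: (@commutes_cvg _ _ _ _ _ Zsa (fun n x => sqrt_iter (k x) n) _ 1).
- elim => [|n IH] /=; first exact: commutes_cst.
  by apply/commutesD/commutesZ/commutesB/commutesM.
- move=> n x; have [/andP[y0 ys] _] := sqrt_iter_bounds n (k01 x).
  rewrite ger0_norm// (le_trans ys)// -sqrtr1 ler_sqrt//.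
  by case/andP: (k01 x).
- by move=> x; exact: cvg_sqrt_iter.
Qed.

(** The minimum of [k] and [c] is reached through |k - c|, the square root of (k - c)^2; that square
    has values in [0, 1] because [k] and [c] do. *)
Lemma commutes_indic k (c : R) : commutes Z k -> (forall x, 0 <= k x <= 1) ->
  0 < c -> c <= 1 -> commutes Z (\1_[set x | c <= k x]).
Proof.
move=> ck k01 c0 c1.
have cabs : commutes Z (fun x => Num.sqrt ((k x - c) ^+ 2)).
  apply: commutes_sqrt; first by apply/commutesX/commutesB/commutes_cst.
  move=> x; have /andP[k0 k1] := k01 x.
  rewrite sqr_ge0 /= -subr_ge0.
  have -> : 1 - (k x - c) ^+ 2 = (1 - (k x - c)) * (1 + (k x - c)) by ring.
  by apply: mulr_ge0; lra.
(* [m] is [min(k / c, 1)], whose powers decrease to the indicator. *)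
pose m x := (2 * c)^-1 * (k x + c - Num.sqrt ((k x - c) ^+ 2)).
have cm : commutes Z m.
  by apply/commutesZ/commutesB => //; apply/commutesD => //; exact: commutes_cst.
have mE x : m x = if c <= k x then 1 else k x / c.
  rewrite /m sqrtr_sqr; case: (leP c (k x)) => kc.
    by rewrite ger0_norm ?subr_ge0//; field; rewrite gt_eqF.
  by rewrite ltr0_norm ?subr_lt0//; field; rewrite gt_eqF.
have m01 x : 0 <= m x <= 1.
  rewrite mE; have /andP[k0 k1] := k01 x; case: ifPn => kc; first by rewrite ler01 lexx.
  by rewrite divr_ge0 ?(ltW c0)//= ler_pdivrMr// mul1r ltW// ltNge.
apply: (@commutes_cvg _ _ _ _ _ Zsa (fun n x => m x ^+ n) _ 1).
- by move=> n; exact: commutesX.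
- move=> n x; have /andP[m0 m1] := m01 x.
  by rewrite ger0_norm ?exprn_ge0// exprn_ile1.
- move=> x; rewrite indicE mE; case: ifPn => kc.
    by rewrite mem_set//=; under eq_fun do rewrite expr1n; exact: cvg_cst.
  rewrite memNset//=; last exact/negP.
  apply: cvg_expr; have /andP[k0 k1] := k01 x.
  rewrite ger0_norm ?divr_ge0 ?(ltW c0)//.
  by rewrite ltr_pdivrMr// mul1r ltNge.
Qed.

End CommutantCalculus.

(** * Multiplication operators and their square roots *)

Section Multiplication.
Context d (X : measurableType d) (R : realType) (mu : {measure set X -> \bar R}).
Implicit Types (u v f g : L2 mu) (k : X -> R).

Lemma integrable_ae_le (f g : X -> R) : measurable_fun setT f ->
  mu.-integrable setT (EFin \o g) -> {ae mu, forall x, `|f x| <= `|g x|} ->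
  mu.-integrable setT (EFin \o f).
Proof.
move=> mf /integrableP[mg ig] fg; apply/integrableP; split.
  exact/measurable_EFinP.
apply: le_lt_trans ig; apply: ae_ge0_le_integral => //.
- by apply: measurableT_comp => //; exact/measurable_EFinP.
- exact: measurableT_comp.
- by apply: filterS fg => x fgx _; rewrite lee_fin.
Qed.

Lemma isL2_dom (f : X -> R[i]) (G : X -> R) : cmeasurable f ->
  mu.-integrable setT (EFin \o G) ->
  {ae mu, forall x, abs2 (f x) <= G x} -> isL2 mu f.
Proof.
move=> mf iG fG; split=> //; rewrite /square_integrable.
apply: (@le_lt_trans _ _ (\int[mu]_x `|(G x)%:E|)%E); last first.
  by have /integrableP[] := iG.
apply: ae_ge0_le_integral => //.
- by move=> x _; rewrite lee_fin abs2_ge0.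
- by apply/measurable_EFinP; exact: cmeasurable_abs2.
- by apply: measurableT_comp => //; exact: measurable_int iG.
- by apply: filterS fG => x fGx _; rewrite /= lee_fin (le_trans fGx)// ler_norm.
Qed.

(** As a weighted composition with the identity transformation, it inherits [wcomp_ext] and
    [wcomp_linear]. *)
Definition mulop k : operator (L2 mu) := wcomp mu (fun x => (k x)%:C%C) id.

Lemma mulopE k f g : mulop k (f, g) =
  {ae mu, forall x, repr g x = (k x)%:C%C * repr f x}.
Proof. by []. Qed.

(** For [k] >= 0 this cut-off sends every vector into the domain of the multiplication by [k], and
    at each point it is 1 from some [n] on. *)
Definition trunc k (n : nat) : X -> R := \1_[set x | k x <= n%:R].

Lemma truncE k n x : trunc k n x = (k x <= n%:R)%R%:R.
Proof.
rewrite /trunc indicE; case: leP => kn; first by rewrite mem_set.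
by rewrite memNset//=; apply/negP; rewrite -ltNge.
Qed.

Lemma bounded_trunc k n : measurable_fun setT k -> bounded_mfun (trunc k n).
Proof.
move=> mk; apply: bounded_mfun_indic.
rewrite -[X in measurable X]setTI; exact: measurable_fun_le.
Qed.

Lemma trunc_near k x : \forall n \near \oo, trunc k n x = 1.
Proof.
have [m km] : exists m : nat, k x <= m%:R.
  by exists (Num.bound `|k x|); rewrite (le_trans (ler_norm _))// ltW// archi_boundP.
exists m => // n /= mn; rewrite truncE (le_trans km) ?ler_nat//.
Qed.

Lemma bounded_mul_trunc k n : measurable_fun setT k -> (forall x, 0 <= k x) ->
  bounded_mfun (fun x => k x * trunc k n x).
Proof.
move=> mk k0; split.
  by apply: measurable_funM => //; case: (bounded_trunc n mk).
exists n%:R => x; rewrite truncE; case: (leP (k x) n%:R) => kn; rewrite ?mulr1 ?mulr0 ?normr0//.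
by rewrite ger0_norm.
Qed.

Lemma mulop_bmul k k' u : bounded_mfun k' -> bounded_mfun (fun x => k x * k' x) ->
  mulop k (bmul k' u, bmul (fun x => k x * k' x) u).
Proof.
move=> b1 b2; rewrite mulopE; move: (bmulE u b1) (bmulE u b2).
by apply: filterS2 => x -> ->; rewrite rmorphM mulrA.
Qed.

Lemma bmul_trunc_ext k u v : measurable_fun setT k ->
  (forall n, bmul (trunc k n) u = bmul (trunc k n) v) -> u = v.
Proof.
move=> mk H; apply: L2_ext.
have A : {ae mu, forall x n, (trunc k n x)%:C%C * repr u x =
                             (trunc k n x)%:C%C * repr v x :> R[i]}.
  apply/ae_foralln => n.
  move: (bmulE u (bounded_trunc n mk)) (bmulE v (bounded_trunc n mk)).
  by rewrite H; apply: filterS2 => x <- <-.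
apply: filterS A => x A; have [m _ /(_ m)/= E] := trunc_near k x.
by have := A m; rewrite E// !mul1r.
Qed.

Lemma bmul_trunc_cvg k u (e : R) : measurable_fun setT k -> 0 < e ->
  exists n, nsq (u - bmul (trunc k n) u) < e.
Proof.
move=> mk e0.
have E n : nsq (u - bmul (trunc k n) u) =
    \int[mu]_x ((1 - trunc k n x) * abs2 (repr u x)).
  rewrite L2_normsq.unlock; congr fine; apply: ae_eq_integral => //.
  - by apply/measurable_EFinP/cmeasurable_abs2; case: (isL2_repr (u - bmul (trunc k n) u)).
  - apply/measurable_EFinP/measurable_funM; last first.
      by apply: cmeasurable_abs2; case: (isL2_repr u).
    by apply: measurable_funB => //; case: (bounded_trunc n mk).
  - move: (reprB u (bmul (trunc k n) u)) (bmulE u (bounded_trunc n mk)).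
    apply: filterS2 => x -> -> _; congr EFin; rewrite truncE.
    by case: leP => _; rewrite ?mul1r ?mul0r ?subrr ?subr0 ?mul0r ?mul1r ?abs20.
have : \int[mu]_x ((1 - trunc k n x) * abs2 (repr u x)) @[n --> \oo] -->
    \int[mu]_x ((fun=> 0 : R) x * abs2 (repr u x)).
  apply: (cvg_Rintegral_bounded (M := 1)).
  - exact: integrable_abs2 (isL2_repr u).
  - by move=> n; apply: measurable_funB => //; case: (bounded_trunc n mk).
  - exact: measurable_cst.
  - by move=> n x; rewrite truncE; case: (leP (k x) n%:R) => _; rewrite ?subrr ?subr0 ?normr0 ?normr1.
  - move=> x; apply: cvg_near_cst; apply: filterS (trunc_near k x) => n ->.
    by rewrite subrr.
have -> : \int[mu]_x ((fun=> 0 : R) x * abs2 (repr u x)) = 0.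
  under eq_Rintegral do rewrite mul0r.
  by rewrite Rintegral_cst// mul0r.
move=> /cvgrPdist_lt/(_ _ e0)[N _ /(_ N (leqnn N))] /=.
rewrite -E sub0r normrN ger0_norm ?nsq_ge0// => H.
by exists N.
Qed.

End Multiplication.

Arguments mulop {d X R} mu k.

Section OperatorFacts.
Context d (X : measurableType d) (R : realType) (mu : {measure set X -> \bar R}).
Implicit Types (u v f g : L2 mu) (k : X -> R).

Lemma wcomp_ext (w : X -> R[i]) (psi : X -> X) f g g' :
  wcomp mu w psi (f, g) -> wcomp mu w psi (f, g') -> g = g'.
Proof.
by move=> /= fg fg'; apply: L2_ext; move: fg fg'; apply: filterS2 => x -> ->.
Qed.

(* What makes the weighted composition [w (f o psi)] depend only on the class of [f]. *)
Definition nonsingular (w : X -> R[i]) (psi : X -> X) := forall P : X -> Prop,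
  {ae mu, forall x, P x} -> {ae mu, forall x, w x = 0 \/ P (psi x)}.

Lemma nonsingular_id (w : X -> R[i]) : nonsingular w id.
Proof. by move=> P; apply: filterS => x; right. Qed.

Lemma wcomp_linear (w : X -> R[i]) (psi : X -> X) : nonsingular w psi ->
  linear_operator (wcomp mu w psi).
Proof.
move=> ns; split.
- move: (ns _ (repr0 mu)) (repr0 mu); apply: filterS2 => x /= [->|->] ->.
    by rewrite mul0r.
  by rewrite mulr0.
- move=> a f g f' g' fg fg'; have E := ns _ (repr_lin a f f').
  have E' := repr_lin a g g'.
  have {}fg : {ae mu, forall x, repr g x = w x * repr f (psi x)} := fg.
  have {}fg' : {ae mu, forall x, repr g' x = w x * repr f' (psi x)} := fg'.
  suff: {ae mu, forall x, repr (a *: g + g') x = w x * repr (a *: f + f') (psi x)} by [].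
  near=> x; rewrite (near E' x _)// (near fg x _)// (near fg' x _)//.
  have [->|->] : w x = 0 \/ repr (a *: f + f') (psi x) =
    a * repr f (psi x) + repr f' (psi x) by near: x; exact: E.
    by rewrite !mul0r mulr0 addr0.
  by rewrite mulrDr mulrCA.
- move=> g fg; apply: (wcomp_ext (f := 0) fg).
  move: (ns _ (repr0 mu)) (repr0 mu); apply: filterS2 => x /= [->|->] ->.
    by rewrite mul0r.
  by rewrite mulr0.
Unshelve. all: by end_near. Qed.

Lemma mulop_dense k : measurable_fun setT k -> (forall x, 0 <= k x) ->
  densely_defined (L2dot mu) (mulop mu k).
Proof.
move=> mk k0; apply/densely_definedP => u e e0.
have [n ne] := bmul_trunc_cvg u mk e0; exists (bmul (trunc k n) u) => //.
exists (bmul (fun x => k x * trunc k n x) u).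
by apply: mulop_bmul; [exact: bounded_trunc|exact: bounded_mul_trunc].
Qed.

(** That the adjoint is no larger is seen by testing against truncated vectors: they give v = k u on
    each set {k <= n}, and these sets exhaust the space. *)
Lemma mulop_selfadjoint k : measurable_fun setT k -> (forall x, 0 <= k x) ->
  adjoint (L2dot mu) (mulop mu k) = mulop mu k.
Proof.
move=> mk k0; apply/seteqP; split=> -[u v].
- move=> /adjointP uv.
  have E n : bmul (fun x => k x * trunc k n x) u = bmul (trunc k n) v.
    have bt := bounded_trunc n mk; have bkt := bounded_mul_trunc n mk k0.
    by apply: dotP => z; rewrite -!dot_bmulC//; apply: uv; exact: mulop_bmul.
  have A : {ae mu, forall x n, (k x * trunc k n x)%:C%C * repr u x =
                               (trunc k n x)%:C%C * repr v x :> R[i]}.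
    apply/ae_foralln => n; have bt := bounded_trunc n mk.
    move: (bmulE u (bounded_mul_trunc n mk k0)) (bmulE v bt).
    by rewrite E; apply: filterS2 => x <- <-.
  apply: filterS A => x A; have [m _ /(_ m)/= Em] := trunc_near k x.
  by have := A m; rewrite Em// mulr1 mul1r.
- move=> uv; apply/adjointP => f g fg.
  rewrite [RHS](_ : _ = cintegral mu (fun x => repr f x * (repr v x)^* )); last first.
    by apply: eq_dot; [exact: L2prod_measurable|exact: aeW].
  apply: eq_dot; first exact: L2prod_measurable.
  move: uv fg; apply: filterS2 => x /= -> ->.
  by rewrite [RHS]mul_conj_real mulrA.
Qed.

Lemma mulop_pos k u v : measurable_fun setT k -> (forall x, 0 <= k x) ->
  mulop mu k (u, v) ->
  ip v u = (\int[mu]_x (k x * abs2 (repr u x)))%:C%C.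
Proof.
move=> mk k0 uv.
rewrite (@eq_dot _ _ _ _ _ _ (fun x => (k x * abs2 (repr u x))%:C%C)).
- congr Complex => /=.
  by rewrite Rintegral_cst// mul0r.
- apply/cmeasurable_real/measurable_funM => //.
  by apply: cmeasurable_abs2; case: (isL2_repr u).
- apply: filterS uv => x /= ->.
  rewrite -mulrA rmorphM /=; congr (_ * _).
  by case: (repr u x) => a b; apply/eqP; rewrite eq_complex /abs2 /=;
    apply/andP; split; apply/eqP; ring.
Qed.

Lemma mulop_pos_integrable k u v : measurable_fun setT k -> mulop mu k (u, v) ->
  mu.-integrable setT (fun x => (k x * abs2 (repr u x))%:E).
Proof.
move=> mk uv; have [ir _] := cintegrable_dot v u.
apply: (integrable_ae_le _ ir).
  apply: measurable_funM => //.
  by apply: cmeasurable_abs2; case: (isL2_repr u).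
apply: filterS uv => x /= ->.
suff -> : complex.Re ((k x)%:C%C * repr u x * (repr u x)^*) = k x * abs2 (repr u x) by [].
by case: (repr u x) => a b; rewrite /abs2 /=; ring.
Qed.

Lemma mulop_pos_eq0 k u v : measurable_fun setT k -> (forall x, 0 <= k x) ->
  mulop mu k (u, v) -> ip v u = 0 -> v = 0.
Proof.
move=> mk k0 uv; rewrite (mulop_pos mk k0 uv) => -[i0].
have iz := mulop_pos_integrable mk uv.
have : (\int[mu]_x `|(k x * abs2 (repr u x))%:E| = 0)%E.
  under eq_integral do rewrite gee0_abs ?lee_fin ?mulr_ge0 ?abs2_ge0//.
  by rewrite -[LHS]fineK ?integrable_fin_num// -[fine _]/(Rintegral _ _ _) i0.
move/(ae_eq_integral_abs mu measurableT (measurable_int _ iz)) => z.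
apply: L2_ext; move: z uv (repr0 mu); apply: filterS3 => x /(_ I) [] z -> ->.
move/eqP: z; rewrite mulf_eq0 abs2_eq0 => /orP[/eqP->|/eqP->]; last by rewrite mulr0.
by rewrite mul0r.
Qed.

(** The point is the domain: if u and k^2 u are square integrable, so is k u, because k^2 <= 1 +
    k^4. *)
Lemma mulop_comp k : measurable_fun setT k -> (forall x, 0 <= k x) ->
  opcomp (mulop mu k) (mulop mu k) = mulop mu (fun x => k x ^+ 2).
Proof.
move=> mk k0; apply/seteqP; split=> -[u v] /=.
  move=> [g /= ug gv]; move: ug gv; apply: filterS2 => x /= -> ->.
  by rewrite expr2 rmorphM mulrA.
move=> uv.
have gL2 : isL2 mu (fun x => (k x)%:C%C * repr u x).
  apply: (isL2_dom (G := fun x => abs2 (repr u x) + abs2 (repr v x))).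
  - by apply: cmeasurableM; [exact: cmeasurable_real|case: (isL2_repr u)].
  - have iu := integrable_abs2 (isL2_repr u).
    have iv := integrable_abs2 (isL2_repr v).
    by have := integrableD measurableT iu iv; apply: eq_integrable.
  - apply: filterS uv => x /= ->; rewrite !abs2M !abs2C.
    have := abs2_ge0 (repr u x); set t := abs2 _ => t0.
    have : 0 <= (k x ^+ 2 - 1) ^+ 2 * t by rewrite mulr_ge0 ?sqr_ge0.
    by have := sqr_ge0 (k x); nra.
exists (toL2 mu (fun x => (k x)%:C%C * repr u x)).
  exact: repr_toL2.
move: uv (repr_toL2 gL2); apply: filterS2 => x /= -> ->.
by rewrite expr2 rmorphM mulrA.
Qed.

End OperatorFacts.

(** * Uniqueness of the positive square root of a multiplication operator *)

Section SquareRoot.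
Context d (X : measurableType d) (R : realType) (mu : {measure set X -> \bar R}).
Variable h : X -> R.
Hypotheses (mh : measurable_fun setT h) (h0 : forall x, 0 <= h x).
Implicit Types (u v f g : L2 mu) (k : X -> R).

Lemma measurable_sqrt_comp : measurable_fun setT (fun x => Num.sqrt (h x)).
Proof.
have -> : (fun x => Num.sqrt (h x)) = (fun t => t `^ 2^-1) \o h.
  by apply/funext => x; rewrite /= powR12_sqrt.
by apply: measurableT_comp => //; exact: measurable_powR.
Qed.

(** The symbol of the bounded operator (1 + T)^-1, where T is the multiplication by [h]. *)
Definition resolvent x : R := (1 + h x)^-1.

Lemma resolvent_gt0 x : 0 < resolvent x.
Proof. by rewrite invr_gt0 ltr_pwDl. Qed.

Lemma resolvent01 x : 0 <= resolvent x <= 1.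
Proof.
by rewrite (ltW (resolvent_gt0 x)) /= /resolvent invf_le1 ?ltr_pwDl// lerDl.
Qed.

Lemma measurable_resolvent : measurable_fun setT resolvent.
Proof.
have -> : resolvent = (fun t => t `^ (-1)) \o (fun x => 1 + h x).
  by apply/funext => x; rewrite /= powR_inv1// addr_ge0.
apply: measurableT_comp; first exact: measurable_powR.
by apply: measurable_funD.
Qed.

Lemma bounded_resolvent : bounded_mfun resolvent.
Proof. by apply: bounded_mfun01; [exact: measurable_resolvent|exact: resolvent01]. Qed.

Lemma mul_resolvent x : h x * resolvent x = 1 - resolvent x.
Proof. by rewrite /resolvent; field; rewrite gt_eqF// ltr_pwDl. Qed.

Lemma mulop_resolvent u : mulop mu h (bmul resolvent u, u - bmul resolvent u).
Proof.
rewrite mulopE.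
move: (bmulE u bounded_resolvent) (reprB u (bmul resolvent u)).
apply: filterS2 => x E ->; rewrite E mulrA -rmorphM mul_resolvent rmorphB /=.
by rewrite mulrBl mul1r.
Qed.

(** The hypothesis is the equation (1 + T) f = u. Written as a membership in a graph, it can be
    transported by any operator that is compatible with T. *)
Lemma eq_bmul_resolvent f u : mulop mu h (f, u - f) -> f = bmul resolvent u.
Proof.
move=> H; apply: L2_ext; move: H (reprB u f) (bmulE u bounded_resolvent).
apply: filterS3 => x /= -> E ->.
have -> : repr u x = (1 + h x)%:C%C * repr f x.
  by rewrite rmorphD /= mulrDl mul1r E addrC subrK.
by rewrite mulrA -rmorphM mulVf ?mul1r// gt_eqF// ltr_pwDl.
Qed.

(** The symbol of T^(1/2) (1 + T)^-1, in a form to which [commutes_sqrt] applies: with b the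
    resolvent, b - b^2 = h b^2. *)
Definition sqrt_resolvent x : R := Num.sqrt (resolvent x - resolvent x * resolvent x).

Lemma sqrt_resolventE x : sqrt_resolvent x = Num.sqrt (h x) * resolvent x.
Proof.
rewrite /sqrt_resolvent.
have -> : resolvent x - resolvent x * resolvent x = h x * resolvent x ^+ 2.
  by rewrite expr2 mulrA mul_resolvent mulrBl mul1r.
rewrite sqrtrM// sqrtr_sqr ger0_norm//.
exact/ltW/resolvent_gt0.
Qed.

Lemma resolvent_sub01 x : 0 <= resolvent x - resolvent x * resolvent x <= 1.
Proof. by have /andP[b0 b1] := resolvent01 x; apply/andP; split; nra. Qed.

Local Notation S := (mulop mu (fun x => Num.sqrt (h x))).

Variable P : operator (L2 mu).
Hypothesis Psa : positive_selfadjoint (L2dot mu) P.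
Hypothesis PP : opcomp P P = mulop mu h.

Let Padj : adjoint (L2dot mu) P = P. Proof. by case: Psa. Qed.

Let Pfun f g g' : P (f, g) -> P (f, g') -> g = g'.
Proof.
move=> fg fg'; have [[_ _ inj] _ _ _] := Psa.
have := selfadjoint_lin Padj (-1) fg fg'; rewrite !scaleN1r addNr => /inj /eqP.
by rewrite addrC subr_eq0 => /eqP.
Qed.

Let PB f g f' g' : P (f, g) -> P (f', g') -> P (f - f', g - g').
Proof.
move=> fg fg'; have := selfadjoint_lin Padj (-1) fg' fg.
by rewrite !scaleN1r ![- _ + _]addrC.
Qed.

Let Psym f g f' g' : P (f, g) -> P (f', g') -> ip g f' = ip f g'.
Proof.
by move=> fg; rewrite -{1}Padj => /adjointP; apply.
Qed.

(** Put m = P (b f), so that P m = T (b f) = f - b f. Applying P once more gives T m = g - m, and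
    uniqueness of the solution yields m = b g. *)
Let comm_resolvent : commutes P resolvent.
Proof.
split; first exact: bounded_resolvent.
move=> f g fg; have := mulop_resolvent f; rewrite -PP => -[m /= bfm mbf].
suff <- : m = bmul resolvent g by [].
by apply: eq_bmul_resolvent; rewrite -PP; exists (f - bmul resolvent f) => //=; exact: PB.
Qed.

Let comm_sqrt_resolvent : commutes P sqrt_resolvent.
Proof.
apply: commutes_sqrt => //; last exact: resolvent_sub01.
by apply: commutesB => //; exact: commutesM.
Qed.

(* With b = (1 + h)^-1 and M = sqrt h b, both commuting with P, the vector
   u = M b f - b b g satisfies P u = - sqrt h u, so positivity of both sides
   gives P u = 0, and then <u, u> = 0. *)
Let P_sqrt f g : P (f, g) -> S (f, g).
Proof.
move=> fg; set b := resolvent; set M := sqrt_resolvent.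
have bb := bounded_resolvent; have [bM _] := comm_sqrt_resolvent.
have cb := proj2 comm_resolvent; have cM := proj2 comm_sqrt_resolvent.
have P1 := cb _ _ (cb _ _ fg); have P2 := cM _ _ (cb _ _ fg).
pose a := bmul M (bmul b f); pose d' := bmul b (bmul b g); pose u := a - d'.
have [m Pm mP] : opcomp P P (bmul b (bmul b f), bmul b f - bmul b (bmul b f)).
  by rewrite PP; exact: mulop_resolvent.
have {m Pm mP}P3 : P (d', bmul b f - bmul b (bmul b f)).
  by move: mP; rewrite -[m](Pfun P1 Pm).
have P4 := PB P2 P3; rewrite -/a -/u in P4.
pose v := bmul b f - bmul b (bmul b f) - bmul M (bmul b g).
have {}P4 : P (u, - v) by rewrite /v opprB.
have Suv : S (u, v).
  have E1 := reprB a d'; have E2 := reprB (bmul b f - bmul b (bmul b f)) (bmul M (bmul b g)).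
  have E3 := reprB (bmul b f) (bmul b (bmul b f)).
  have E4 := bmulE f bb; have E5 := bmulE (bmul b f) bb; have E6 := bmulE (bmul b g) bb.
  have E7 := bmulE (bmul b f) bM; have E8 := bmulE (bmul b g) bM.
  rewrite mulopE; near=> x.
  rewrite (near E1 x _)// (near E2 x _)// (near E3 x _)// (near E5 x _)// (near E6 x _)//.
  rewrite (near E7 x _)// (near E8 x _)//.
  have mR : (Num.sqrt (h x))%:C%C * (M x)%:C%C = (1 - b x)%:C%C :> R[i].
    rewrite -rmorphM /M sqrt_resolventE mulrA -expr2 sqr_sqrtr//.
    by rewrite mul_resolvent.
  have mR' : (M x)%:C%C = (Num.sqrt (h x))%:C%C * (b x)%:C%C :> R[i].
    by rewrite -rmorphM /M sqrt_resolventE.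
  rewrite mulrBr !mulrA mR -mR' rmorphB /= mulrBl mul1r.
  by [].
have S1 : S (bmul b (bmul b f), a).
  rewrite /a (@eq_bmul _ _ _ _ M (fun x => Num.sqrt (h x) * b x))//; last first.
    exact: sqrt_resolventE.
  apply: mulop_bmul => //.
  by rewrite -(funext sqrt_resolventE).
have ms := measurable_sqrt_comp.
have v0 : v = 0.
  apply: (mulop_pos_eq0 ms _ Suv) => [x|]; first exact: sqrtr_ge0.
  have : 0 <= ip (- v) u by rewrite L2_inner.unlock; have [_ _ _] := Psa; exact.
  rewrite dotNl.
  rewrite (mulop_pos ms _ Suv) => [|x]; last exact: sqrtr_ge0.
  rewrite oppr_ge0 lecR => i0; congr (_%:C%C); apply/eqP; rewrite eq_le i0 /=.
  by apply: Rintegral_ge0 => x _; rewrite mulr_ge0 ?sqrtr_ge0 ?abs2_ge0.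
(* Both [a] and [d'] are images of the vector b b f, under sqrt h and under [P] respectively;
   symmetry moves these operators onto [u], which they annihilate. *)
have u0 : u = 0.
  apply: dotuu_eq0; rewrite {2}/u dotBr.
  have Sadj := @mulop_selfadjoint _ _ _ mu _ ms (fun x => sqrtr_ge0 (h x)).
  move: (S1); rewrite -{1}Sadj => /adjointP/(_ _ _ Suv) <-.
  by rewrite -(Psym P4 P1) v0 oppr0 !dot0l subrr.
(* This reads M b f = b b g with M = b sqrt h; dividing by b^2 > 0 gives g = sqrt h f. *)
have E : a = d' by apply/eqP; rewrite -subr_eq0 -/u u0.
have E4 := bmulE f bb; have E5 := bmulE g bb.
have E6 := bmulE (bmul b g) bb; have E7 := bmulE (bmul b f) bM.
rewrite mulopE; near=> x.
have : repr a x = repr d' x by rewrite E.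
rewrite (near E6 x _)// (near E7 x _)// (near E4 x _)// (near E5 x _)//.
have b0 : (b x)%:C%C != 0 :> R[i].
  by apply/eqP => -[/eqP]; rewrite gt_eqF// resolvent_gt0.
have -> : (M x)%:C%C = (b x)%:C%C * (Num.sqrt (h x))%:C%C :> R[i].
  by rewrite -rmorphM /M sqrt_resolventE mulrC.
rewrite -mulrA => /(mulfI b0); rewrite mulrCA => /(mulfI b0) ->.
by [].
Unshelve. all: by end_near. Qed.

(** Adjoints reverse inclusions, so a selfadjoint operator contained in another selfadjoint one
    equals it. *)
Lemma positive_sqrt_unique : P = S.
Proof.
apply/seteqP; split=> -[f g]; first exact: P_sqrt.
have ms := measurable_sqrt_comp.
rewrite -(mulop_selfadjoint mu ms (fun x => sqrtr_ge0 (h x))) => /adjointP fg.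
by rewrite -Padj; apply/adjointP => u v /P_sqrt; exact: fg.
Qed.

End SquareRoot.

(** * Spectral integrals of multiplication operators *)

Section Polarization.
Context (R : realType).

Lemma polarization_sum (a : nat -> R) :
  4^-1 * \sum_(k < 4) 'i ^+ k * ((a k)%:C)%C =
  Complex ((a 0 - a 2) / 4) ((a 1 - a 3) / 4) :> R[i].
Proof.
rewrite !big_ord_recr big_ord0 /= add0r -complexiE expr0 mul1r expr1.
rewrite exprS expr1 -expr2 sqr_i exprSr sqr_i.
have -> : (4^-1 : R[i]) = (4^-1)%:C%C by rewrite fmorphV rmorph_nat.
by apply/eqP; rewrite eq_complex /=; apply/andP; split; apply/eqP; field.
Qed.

(** The four powers of i sum to 0, so a summand independent of [k] drops out. *)
Lemma polarization_sum_shift (a b x : nat -> R) (c c' : R) :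
  (forall k, a k = x k + c) -> (forall k, b k = x k + c') ->
  4^-1 * \sum_(k < 4) 'i ^+ k * ((a k)%:C)%C =
  4^-1 * \sum_(k < 4) 'i ^+ k * ((b k)%:C)%C :> R[i].
Proof.
move=> ax bx; rewrite !polarization_sum !ax !bx.
by congr Complex; congr (_ / _); ring.
Qed.

Lemma abs2_polar_re (x y : R[i]) :
  abs2 (x + y) - abs2 (x - y) = 4 * complex.Re (x * y^*).
Proof. by case: x y => [a b] [c e]; rewrite /abs2 /=; ring. Qed.

Lemma abs2_polar_im (x y : R[i]) :
  abs2 (x + 'i * y) - abs2 (x - 'i * y) = 4 * complex.Im (x * y^*).
Proof.
by rewrite -complexiE; case: x y => [a b] [c e]; rewrite /abs2 /=; ring.
Qed.

Lemma ReCM (a : R) (z : R[i]) : complex.Re (a%:C%C * z) = a * complex.Re z.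
Proof. by rewrite Defs.ReM /= mul0r subr0. Qed.

Lemma ImCM (a : R) (z : R[i]) : complex.Im (a%:C%C * z) = a * complex.Im z.
Proof. by rewrite Defs.ImM /= mul0r addr0. Qed.

End Polarization.

Section SpectralCalculus.
Context d (X : measurableType d) (R : realType) (mu : {measure set X -> \bar R}).
Variable s : X -> R.
Hypotheses (ms : measurable_fun setT s) (s0 : forall x, 0 <= s x).
Implicit Types (u v f g : L2 mu) (A : set R).

Definition mulop_spectrum A f : L2 mu := bmul (\1_(s @^-1` A)) f.

Lemma measurable_preim A : measurable A -> measurable (s @^-1` A).
Proof. by move=> mA; rewrite -[X in measurable X]setTI; apply: ms. Qed.

Let bounded_preim A : measurable A -> bounded_mfun (\1_(s @^-1` A) : X -> R).
Proof. by move=> mA; apply/bounded_mfun_indic/measurable_preim. Qed.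

Lemma indicK (T : Type) (B : set T) x : (\1_B x * \1_B x : R) = \1_B x.
Proof. by rewrite indicE; case: (_ \in _); rewrite ?mulr1 ?mulr0. Qed.

Lemma nsq_indic (B : set X) u : measurable B ->
  (nsq (bmul (\1_B) u))%:E = (\int[mu]_(x in B) (abs2 (repr u x))%:E)%E.
Proof.
move=> mB; have bB := bounded_mfun_indic R mB.
rewrite nsqE [RHS]integral_mkcond; apply: ae_eq_integral => //.
- by apply/measurable_EFinP/cmeasurable_abs2; case: (isL2_repr (bmul (\1_B) u)).
- apply/(measurable_restrictT _ mB).
  by apply/measurable_EFinP/measurable_funTS/cmeasurable_abs2; case: (isL2_repr u).
- apply: filterS (bmulE u bB) => x -> _.
  rewrite abs2M abs2C patchE expr2 indicK indicE.
  by case: ifPn => _; rewrite ?mul1r ?mul0r.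
Qed.

Lemma mulop_spectrum_proj A : measurable A ->
  orthogonal_projection (L2dot mu) (mulop_spectrum A).
Proof.
move=> mA; have bA := bounded_preim mA; split.
- by move=> a u v; exact: bmul_lin.
- move=> f; rewrite /mulop_spectrum -bmulM//.
  by apply: eq_bmul => [|x]; [exact: bounded_mfunM|exact: indicK].
- by move=> f g; have := dot_bmulC f g bA; rewrite L2_inner.unlock.
Qed.

Lemma projection_nsq (p : L2 mu -> L2 mu) f : orthogonal_projection (L2dot mu) p ->
  complex.Re (L2dot mu (p f) f) = nsq (p f).
Proof.
move=> [_ pp psym].
have -> : L2dot mu (p f) f = L2dot mu (p f) (p f) by rewrite -{1}pp; exact: psym.
by have := dotuu (p f); rewrite L2_inner.unlock => ->.
Qed.

Lemma diag_mulop_spectrum f A : measurable A ->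
  diag_measure (L2dot mu) mulop_spectrum f A =
  (\int[mu]_(x in s @^-1` A) (abs2 (repr f x))%:E)%E.
Proof.
move=> mA; rewrite -nsq_indic; last exact: measurable_preim.
by congr EFin; apply: projection_nsq; exact: mulop_spectrum_proj.
Qed.

Lemma mulop_spectrum_spectral : spectral_measure (L2dot mu) mulop_spectrum.
Proof.
split.
- exact: mulop_spectrum_proj.
- move=> f; rewrite /mulop_spectrum -[RHS]scale1r -(bmul_cst 1).
  apply: eq_bmul => [|x]; first by apply: bounded_preim; exact: measurable_itv.
  by rewrite indicE mem_set//= in_itv /= s0.
- move=> f F mF tF mUF.
  have [m mE] := density_measureP mu (cmeasurable_abs2 (proj1 (isL2_repr f)))
    (fun x => abs2_ge0 _).
  have mDE A : measurable A -> diag_measure (L2dot mu) mulop_spectrum f A = m (s @^-1` A).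
    by move=> mA; rewrite mE ?diag_mulop_spectrum//; exact: measurable_preim.
  have [M ME] := pushforward_measureP m ms.
  have DE A : measurable A -> diag_measure (L2dot mu) mulop_spectrum f A = M A.
    by move=> mA; rewrite ME// mDE.
  rewrite DE//; under eq_fun do under eq_bigr do rewrite DE//.
  exact: measure_semi_sigma_additive.
Qed.

Section Integral.
Variable E : set R -> L2 mu -> L2 mu.
Hypothesis EE : forall f A, measurable A -> diag_measure (L2dot mu) E f A =
  (\int[mu]_(x in s @^-1` A) (abs2 (repr f x))%:E)%E.
Variable th : R -> R.
Hypotheses (mth : measurable_fun setT th) (th0 : forall t, 0 <= t -> 0 <= th t).

Let ths0 x : 0 <= th (s x). Proof. exact: th0. Qed.

Let mths : measurable_fun setT (fun x => th (s x)).
Proof. exact: measurableT_comp. Qed.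

Lemma integral_diag_measure (k : R -> R) f : measurable_fun setT k ->
  (forall t, 0 <= t -> 0 <= k t) ->
  (\int[diag_measure (L2dot mu) E f]_(t in `[0%R, +oo[) (k t)%:E =
   \int[mu]_x (k (s x) * abs2 (repr f x))%:E)%E.
Proof.
move=> mk k0.
have mf : measurable_fun setT (fun x => abs2 (repr f x)).
  by apply: cmeasurable_abs2; case: (isL2_repr f).
have [m mE] := density_measureP mu mf (fun x => abs2_ge0 _).
have [M ME] := pushforward_measureP m ms.
rewrite (@eq_setfun_integral _ _ _ _ M); last first.
  by move=> A mA; rewrite EE// ME// mE//; exact: measurable_preim.
(* [ge0_integral_transfer] asks for a function that is nonnegative everywhere, whereas [k] is so on
   the half-line only. *)
pose K t := (k t * \1_(`[0%R, +oo[%classic) t)%R.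
rewrite integral_mkcond (eq_integral (fun t => (K t)%:E)); last first.
  by move=> t _; rewrite patchE /K indicE; case: ifPn => _; rewrite ?mulr1 ?mulr0.
rewrite (@ge0_integral_transfer _ _ _ _ _ mu M s (fun x => abs2 (repr f x)))//.
- by apply: eq_integral => x _; rewrite /K indicE mem_set ?mulr1//= in_itv /= s0.
- by move=> x; exact: abs2_ge0.
- by move=> A mA; rewrite ME// mE//; exact: measurable_preim.
- by apply: measurable_funM.
- move=> t; rewrite /K indicE; case: (boolP (t \in _)) => [|_]; last by rewrite mulr0.
  by rewrite inE /= in_itv /= andbT mulr1 => /k0.
Qed.


Let weighted u := fun x => (th (s x))%:C%C * repr u x : R[i].

Let cm_weighted u : cmeasurable (weighted u).
Proof. by apply: cmeasurableM; [exact: cmeasurable_real|case: (isL2_repr u)]. Qed.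

Let domP u : spectral_dom (L2dot mu) th E u <-> isL2 mu (weighted u).
Proof.
rewrite /spectral_dom /= (@integral_diag_measure (fun t => th t ^+ 2)); last 2 first.
- exact: measurable_funX.
- by move=> t _; exact: sqr_ge0.
have E' : (\int[mu]_x (th (s x) ^+ 2 * abs2 (repr u x))%:E =
    \int[mu]_x (abs2 (weighted u x))%:E)%E.
  by apply: eq_integral => x _; rewrite abs2M abs2C.
by rewrite E'; split => [|[]].
Qed.

Let I u : R := \int[mu]_x (th (s x) * abs2 (repr u x)).

Let int_I u : isL2 mu (weighted u) ->
  mu.-integrable setT (EFin \o (fun x => th (s x) * abs2 (repr u x))).
Proof.
move=> uL2; have i1 := integrable_abs2 uL2; have i2 := integrable_abs2 (isL2_repr u).
apply: (integrable_ae_le _ (g := fun x => abs2 (weighted u x) + abs2 (repr u x))).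
- by apply: measurable_funM => //; apply: cmeasurable_abs2; case: (isL2_repr u).
- by have := integrableD measurableT i1 i2; apply: eq_integrable.
- apply: aeW => x; rewrite abs2M abs2C.
  have := abs2_ge0 (repr u x); set t := abs2 _ => t0.
  have h0 := ths0 x; rewrite !ger0_norm ?mulr_ge0 ?addr_ge0 ?sqr_ge0//; last first.
    by rewrite mulr_ge0// sqr_ge0.
  have := mulr_ge0 (sqr_ge0 (th (s x) - 1)) t0; nra.
Qed.

Let weighted_lin u v (a : R[i]) : isL2 mu (weighted u) -> isL2 mu (weighted v) ->
  isL2 mu (weighted (u + a *: v)).
Proof.
move=> uL2 vL2.
apply: (isL2_dom (G := fun x => 2 * (abs2 a * abs2 (weighted v x) + abs2 (weighted u x)))) => //.
  have i1 := integrable_abs2 uL2; have i2 := integrable_abs2 vL2.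
  have := integrableZl measurableT 2 (integrableD measurableT
    (integrableZl measurableT (abs2 a) i2) i1).
  by apply: eq_integrable.
have := repr_lin a v u; rewrite addrC; apply: filterS => x E1.
have -> : weighted (u + a *: v) x = a * weighted v x + weighted u x.
  by rewrite /weighted E1 mulrDr mulrCA.
exact: abs2_lin.
Qed.

Let I_sub u v (c : R[i]) : isL2 mu (weighted u) -> isL2 mu (weighted v) ->
  I (u + c *: v) - I (u + (- c) *: v) =
  \int[mu]_x (th (s x) * (abs2 (repr u x + c * repr v x) - abs2 (repr u x - c * repr v x))).
Proof.
move=> uL2 vL2.
rewrite /I -RintegralB//; [|exact/int_I/weighted_lin..].
congr fine; apply: ae_eq_integral => //.
- apply/measurable_EFinP; apply: measurable_funB; apply: measurable_funM => //;
    exact: measurable_abs2_repr.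
- apply/measurable_EFinP; apply: measurable_funM => //; apply: measurable_funB.
  + apply: cmeasurable_abs2; under eq_fun do rewrite addrC.
    by apply: cmeasurable_lin; [case: (isL2_repr v)|case: (isL2_repr u)].
  + apply: cmeasurable_abs2; under eq_fun do rewrite addrC -mulNr.
    by apply: cmeasurable_lin; [case: (isL2_repr v)|case: (isL2_repr u)].
- move: (repr_lin c v u) (repr_lin (- c) v u).
  rewrite ![_ + u]addrC; apply: filterS2 => x E1 E2 _; congr EFin.
  rewrite E1 E2 mulrBr; congr (_ * abs2 _ - _ * abs2 _); first exact: addrC.
  by rewrite mulNr addrC.
Qed.

Let polarization u v : isL2 mu (weighted u) -> isL2 mu (weighted v) ->
  4^-1 * \sum_(k < 4) 'i ^+ k * ((fine (\int[diag_measure (L2dot mu) E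
    (u + 'i ^+ k *: v)]_(t in `[0%R, +oo[) (th t)%:E)%E)%:C)%C =
  cintegral mu (fun x => (th (s x))%:C%C * (repr u x * (repr v x)^* )).
Proof.
move=> uL2 vL2.
have IE w : fine (\int[diag_measure (L2dot mu) E w]_(t in `[0%R, +oo[) (th t)%:E)%E = I w.
  by rewrite (integral_diag_measure w mth th0).
under eq_bigr do rewrite IE.
rewrite (polarization_sum (fun k => I (u + 'i ^+ k *: v))).
have i2 : 'i ^+ 2 = - 1 :> R[i] by rewrite -complexiE sqr_i.
have i3 : 'i ^+ 3 = - 'i :> R[i] by rewrite exprS i2 mulrN1.
rewrite i2 i3 expr0 expr1 !I_sub//.
have four (k : X -> R) : mu.-integrable setT (EFin \o k) ->
    (\int[mu]_x (4 * k x)) / 4 = \int[mu]_x k x.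
  by move=> ik; rewrite RintegralZl//; field.
have mre : measurable_fun setT (fun x => complex.Re (repr u x * (repr v x)^* )).
  by case: (L2prod_measurable (repr u) (repr v)).
have mim : measurable_fun setT (fun x => complex.Im (repr u x * (repr v x)^* )).
  by case: (L2prod_measurable (repr u) (repr v)).
have [ire iim] : cintegrable mu (fun x => (th (s x))%:C%C * (repr u x * (repr v x)^* )).
  have [r1 r2] := L2_cintegrable (L2Fun (introT (L2predP _ _) uL2)) (repr v).
  split; [move: r1|move: r2]; apply: eq_integrable => // x _; congr EFin; congr (_ _);
    by rewrite /= /weighted mulrA.
congr Complex.
- rewrite -(four _ ire); congr (_ / _); apply: eq_Rintegral => x _.
  by rewrite !mul1r abs2_polar_re mulrCA; rewrite ReCM.
- rewrite -(four _ iim); congr (_ / _); apply: eq_Rintegral => x _.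
  by rewrite abs2_polar_im mulrCA; rewrite ImCM.
Qed.

Lemma spectral_integral_mulop :
  spectral_integral (L2dot mu) th E = mulop mu (fun x => th (s x)).
Proof.
have wE u v g : isL2 mu (weighted u) -> mulop mu (fun x => th (s x)) (u, g) ->
    ip g v = cintegral mu (fun x => (th (s x))%:C%C * (repr u x * (repr v x)^* )).
  move=> uL2 ug; apply: eq_dot.
    apply: cmeasurableM; first exact: cmeasurable_real.
    exact: L2prod_measurable.
  by apply: filterS ug => x /= ->; rewrite mulrA.
apply/seteqP; split=> -[f g] /=.
- move=> [/domP fL2 fg]; pose g' := toL2 mu (weighted f).
  have fg' : mulop mu (fun x => th (s x)) (f, g') by exact: repr_toL2.
  suff -> : g = g' by [].
  (* The equation [fg] is available only for test vectors in the domain, and the truncation of any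
     [z] at {th o s <= n} is such a vector. *)
  apply: (bmul_trunc_ext (k := fun x => th (s x))) => // n.
  have bt := bounded_trunc n mths; have btk := bounded_mul_trunc n mths ths0.
  apply: dotP => z; rewrite -!dot_bmulC// dotC [RHS]dotC; congr (_^*).
  have zL2 : isL2 mu (weighted (bmul (trunc (fun x => th (s x)) n) z)).
    apply: (isL2_le (g := repr (bmul (fun x => th (s x) * trunc (fun x => th (s x)) n x) z)) (c := 1)).
    + exact: cm_weighted.
    + exact: isL2_repr.
    + move: (bmulE z bt) (bmulE z btk); apply: filterS2 => x E1 E2.
      by rewrite /weighted E1 E2 mul1r rmorphM mulrA.
  rewrite (wE _ _ _ fL2 fg') -polarization// L2_inner.unlock.
  by apply: fg; exact/domP.
- move=> fg.
  have fL2 : isL2 mu (weighted f).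
    apply: (isL2_le (g := repr g) (c := 1)) => //; first exact: isL2_repr.
    by apply: filterS fg => x /= ->; rewrite mul1r.
  split=> [|v /domP vL2]; first exact/domP.
  by rewrite polarization// -(wE _ _ _ fL2 fg) L2_inner.unlock.
Qed.

End Integral.
End SpectralCalculus.

(** * Uniqueness of the spectral measure *)

Section Projection.
Context d (X : measurableType d) (R : realType) (mu : {measure set X -> \bar R}).
Variable p : L2 mu -> L2 mu.
Hypothesis pp : orthogonal_projection (L2dot mu) p.
Implicit Types u v : L2 mu.

Lemma projection_lin a u v : p (a *: u + v) = a *: p u + p v.
Proof. by case: pp => lp _ _; exact: lp. Qed.

Lemma projection_idem u : p (p u) = p u.
Proof. by case: pp. Qed.

Lemma projection_sym u v : ip (p u) v = ip u (p v).
Proof. by case: pp => _ _ sp; rewrite L2_inner.unlock; exact: sp. Qed.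

Lemma projection0 : p 0 = 0.
Proof.
have := projection_lin 1 0 0; rewrite !scale1r addr0 => /eqP.
by rewrite -{1}[p 0]addr0 => /eqP/addrI <-.
Qed.

Lemma projectionZ a u : p (a *: u) = a *: p u.
Proof. by rewrite -[a *: u]addr0 projection_lin projection0 addr0. Qed.

Lemma projectionD u v : p (u + v) = p u + p v.
Proof. by rewrite -{1}[u]scale1r projection_lin scale1r. Qed.

Lemma projectionB u v : p (u - v) = p u - p v.
Proof. by rewrite projectionD -scaleN1r projectionZ scaleN1r. Qed.

Lemma nsq_projectionB u : nsq (u - p u) = nsq u - nsq (p u).
Proof.
have E : ip u (p u) = (nsq (p u))%:C%C.
  by rewrite -dotuu projection_sym projection_idem.
have E' : ip (p u) u = (nsq (p u))%:C%C by rewrite projection_sym E.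
apply: (@complexI R); rewrite rmorphB /= -dotuu.
by rewrite dotBl !dotBr !dotuu E E' subrr subr0.
Qed.

Lemma nsq_projection_le u : nsq (p u) <= nsq u.
Proof. by rewrite -subr_ge0 -nsq_projectionB nsq_ge0. Qed.

End Projection.

Section Norms.
Context d (X : measurableType d) (R : realType) (mu : {measure set X -> \bar R}).
Implicit Types u v : L2 mu.

Lemma nsqZ (a : R[i]) u : nsq (a *: u) = abs2 a * nsq u.
Proof.
apply: (@complexI R); rewrite -dotuu dotZl dotZr dotuu rmorphM mulrA; congr (_ * _).
by case: a => a b; apply/eqP; rewrite eq_complex /abs2 /=; apply/andP; split; apply/eqP; ring.
Qed.

Lemma nsq0 : nsq (0 : L2 mu) = 0.
Proof. by rewrite -(scale0r (0 : L2 mu)) nsqZ abs20 mul0r. Qed.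

Lemma nsqD_le u v : nsq (u + v) <= 2 * nsq u + 2 * nsq v.
Proof.
have E : nsq (u + v) + nsq (u - v) = 2 * nsq u + 2 * nsq v.
  apply: (@complexI R); rewrite !rmorphD !rmorphM /= -!dotuu.
  rewrite !dotDl !dotDr !dotNl.
  have N w : ip w (- v) = - ip w v by rewrite -[- v]sub0r dotBr dot0r sub0r.
  by rewrite !N rmorph_nat; ring.
by rewrite -E lerDl nsq_ge0.
Qed.

End Norms.

Section SpectralUniqueness.
Context d (X : measurableType d) (R : realType) (mu : {measure set X -> \bar R}).
Variable E : set R -> L2 mu -> L2 mu.
Hypothesis Esp : spectral_measure (L2dot mu) E.
Implicit Types (u v f g : L2 mu) (A B : set R).

Let Eproj A : measurable A -> orthogonal_projection (L2dot mu) (E A).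
Proof. by case: Esp => + _ _; apply. Qed.

Let diagE u A : measurable A -> diag_measure (L2dot mu) E u A = (nsq (E A u))%:E.
Proof. by move=> mA; congr EFin; apply: projection_nsq; exact: Eproj. Qed.

Lemma spectral_measureP u :
  {m : {measure set R -> \bar R} | forall A, measurable A -> m A = (nsq (E A u))%:E}.
Proof.
have [_ _ /(_ u) sigma] := Esp.
have sigma' : semi_sigma_additive (fun A => (nsq (E A u))%:E).
  move=> F mF tF mUF; have := sigma F mF tF mUF; rewrite diagE//.
  by under eq_fun do under eq_bigr do rewrite diagE//.
apply: measure_of_setfun => //; last by move=> A mA; rewrite lee_fin nsq_ge0.
(* Additivity on the constant sequence of empty sets says that n r tends to r, where r is the value
   at the empty set. Consecutive differences, all equal to r, therefore tend to 0. *)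
have t0 : trivIset setT (fun _ : nat => set0 : set R) by move=> i j _ _ [x []].
have := sigma' (fun=> set0) (fun=> measurable0) t0; rewrite bigcup0//.
move=> /(_ measurable0); set r := nsq _ => r_cvg; congr EFin.
have {}r_cvg : r *+ n @[n --> \oo] --> r.
  move/fine_cvg: r_cvg; apply: cvg_trans; apply: near_eq_cvg; apply: nearW => n /=.
  by rewrite sumEFin /= sumr_const_nat subn0.
have r_cvg' : r *+ n.+1 @[n --> \oo] --> r by rewrite cvg_shiftS.
have : (r *+ n.+1 - r *+ n) @[n --> \oo] --> r - r by exact: cvgB.
under eq_fun do rewrite mulrS addrK.
rewrite subrr => H; exact: (cvg_unique _ (cvg_cst r) H).
Qed.

Lemma spectral_monotone u A B : measurable A -> measurable B -> A `<=` B ->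
  nsq (E A u) <= nsq (E B u).
Proof.
move=> mA mB AB; have [m mE] := spectral_measureP u.
by rewrite -lee_fin -!mE// le_measure// inE.
Qed.

Lemma spectral_add u A B : measurable A -> measurable B -> A `&` B = set0 ->
  nsq (E (A `|` B) u) = nsq (E A u) + nsq (E B u).
Proof.
move=> mA mB AB; have [m mE] := spectral_measureP u.
apply/EFin_inj; rewrite EFinD -!mE//; last exact: measurableU.
by rewrite measureU.
Qed.

(** Multiplicativity of [E] is extracted from norms: applied to x = E B u, the projection of the
    union has squared norm |E A x|^2 + |x|^2, and a projection does not increase the norm. *)
Lemma spectral_disjoint u A B : measurable A -> measurable B -> A `&` B = set0 ->
  E A (E B u) = 0.
Proof.
move=> mA mB AB; apply: nsq_eq0; apply/eqP; rewrite eq_le nsq_ge0 andbT.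
have := nsq_projection_le (Eproj (measurableU _ _ mA mB)) (E B u).
by rewrite spectral_add// projection_idem ?gerDr//; exact: Eproj.
Qed.

(** By monotonicity E A is dominated in norm by E B, and E B annihilates u - E B u. *)
Lemma spectral_sub u A B : measurable A -> measurable B -> A `<=` B ->
  E A (E B u) = E A u.
Proof.
move=> mA mB AB; apply/esym/eqP; rewrite -subr_eq0 -(projectionB (Eproj mA)).
apply/eqP/nsq_eq0/eqP; rewrite eq_le nsq_ge0 andbT.
apply: le_trans (spectral_monotone _ mA mB AB) _.
rewrite (projectionB (Eproj mB)) projection_idem; last exact: Eproj.
by rewrite subrr nsq0.
Qed.

Lemma spectral_meet u A B : measurable A -> measurable B ->
  nsq (E A (E B u)) = nsq (E (A `&` B) u).
Proof.
move=> mA mB; rewrite -{1}(setUIDK A B) spectral_add; last 3 first.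
- exact: measurableI.
- exact: measurableD.
- by rewrite setDE setIACA setICr setI0.
rewrite spectral_sub//; last exact: measurableI.
rewrite spectral_disjoint//; last 2 first.
- exact: measurableD.
- by rewrite setDE -setIA setICl setI0.
by rewrite nsq0 addr0.
Qed.

Lemma spectral_diff u A B : measurable A -> measurable B ->
  nsq (E A (u - E B u)) = nsq (E (A `\` B) u).
Proof.
move=> mA mB; rewrite -{1}(setUIDK A B) spectral_add; last 3 first.
- exact: measurableI.
- exact: measurableD.
- by rewrite setDE setIACA setICr setI0.
rewrite !projectionB; [|by apply: Eproj; exact: measurableD|by apply: Eproj; exact: measurableI].
rewrite spectral_sub//; last exact: measurableI.
rewrite spectral_disjoint//; last 2 first.
- exact: measurableD.
- by rewrite setDE -setIA setICl setI0.
by rewrite subr0 subrr nsq0 add0r.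
Qed.

End SpectralUniqueness.

(** * Quadratic forms of spectral integrals *)

Section SpectralIntegralForm.
Context d (X : measurableType d) (R : realType) (mu : {measure set X -> \bar R}).
Variable E : set R -> L2 mu -> L2 mu.
Hypothesis Esp : spectral_measure (L2dot mu) E.
Implicit Types (u v f g : L2 mu) (A B : set R).

Let Eproj A : measurable A -> orthogonal_projection (L2dot mu) (E A).
Proof. by case: Esp => + _ _; apply. Qed.

(** A genuine measure that agrees with [diag_measure] on Borel sets, so that the library of
    integration becomes applicable. *)
Definition scalar_spectral_measure u : {measure set R -> \bar R} :=
  sval (spectral_measureP Esp u).

Local Notation m := scalar_spectral_measure.

Lemma scalar_spectral_measureE u A : measurable A -> m u A = (nsq (E A u))%:E.
Proof. exact: (svalP (spectral_measureP Esp u)). Qed.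

Lemma integral_diag_scalar u (D : set R) (F : R -> \bar R) :
  (\int[diag_measure (L2dot mu) E u]_(t in D) F t = \int[m u]_(t in D) F t)%E.
Proof.
apply: eq_setfun_integral => A mA; rewrite scalar_spectral_measureE//.
by congr EFin; apply: projection_nsq; exact: Eproj.
Qed.

Local Notation D := (`[0%R, +oo[%classic : set R).

Let mD : measurable D. Proof. exact: measurable_itv. Qed.

Section Form.
Variable th : R -> R.
Hypotheses (mth : measurable_fun setT th) (th0 : forall t, 0 <= th t).

Definition spectral_form u : \bar R := (\int[m u]_(t in D) (th t)%:E)%E.

Let mEth : measurable_fun setT (EFin \o th).
Proof. exact/measurable_EFinP. Qed.

Lemma spectral_form_ge0 u : (0 <= spectral_form u)%E.
Proof. by apply: integral_ge0 => t _; rewrite lee_fin. Qed.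

(** The scalar measures of E B u and of u - E B u are the restrictions of that of u to [B] and to
    its complement. *)
Lemma spectral_form_split u B : measurable B ->
  spectral_form u = (spectral_form (E B u) + spectral_form (u - E B u)%R)%E.
Proof.
move=> mB; rewrite /spectral_form -ge0_integral_measure_add//; last 2 first.
- by move=> t _; rewrite lee_fin.
- exact: measurable_funTS.
apply: eq_measure_integral => A mA _; rewrite [RHS]measure_addE.
rewrite !scalar_spectral_measureE// -EFinD spectral_meet// spectral_diff//.
rewrite -spectral_add//; last 3 first.
- exact: measurableI.
- exact: measurableD.
- by rewrite setDE setIACA setICr setI0.
by rewrite setUIDK.
Qed.

Lemma spectral_formZ (a : R[i]) u :
  spectral_form (a *: u) = ((abs2 a)%:E * spectral_form u)%E.
Proof.
have mf : measurable_fun D (EFin \o th) by exact: measurable_funTS.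
have f0 : forall t, D t -> (0 <= (EFin \o th) t)%E by move=> t _; rewrite lee_fin.
have E1 := ge0_integral_mscale (m u) mD (NngNum (abs2_ge0 a)) mf f0.
rewrite /= in E1; rewrite /spectral_form -E1.
apply: eq_measure_integral => A mA _; transitivity ((abs2 a)%:E * m u A)%E; last by [].
by rewrite !scalar_spectral_measureE// (projectionZ (Eproj mA)) nsqZ EFinM.
Qed.

Lemma spectral_formD_le u v :
  (spectral_form (u + v)%R <= 2%:E * spectral_form u + 2%:E * spectral_form v)%E.
Proof.
have mf : measurable_fun D (EFin \o th) by exact: measurable_funTS.
have f0 : forall t, D t -> (0 <= (EFin \o th) t)%E by move=> t _; rewrite lee_fin.
have two : (0 <= 2 :> R) by [].
have E1 := ge0_integral_mscale (m u) mD (NngNum two) mf f0.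
have E2 := ge0_integral_mscale (m v) mD (NngNum two) mf f0.
rewrite /= in E1, E2; rewrite /spectral_form -E1 -E2 -ge0_integral_measure_add//.
apply: ge0_le_measure_integral => // A mA.
apply: (@le_trans _ _ (2%:E * m u A + 2%:E * m v A)%E); last by rewrite [leRHS]measure_addE.
rewrite !scalar_spectral_measureE// -!EFinM -EFinD lee_fin.
by rewrite (projectionD (Eproj mA)) nsqD_le.
Qed.

End Form.

Let mnorm : measurable_fun setT (fun t : R => `|t|).
Proof. exact: measurableT_comp. Qed.

Let msqr : measurable_fun setT (fun t : R => t ^+ 2).
Proof. exact: measurable_funX. Qed.

(** On the domain of integration |t| is t; the absolute value meets the requirement that the
    integrand be nonnegative on the whole line. *)
Let J := spectral_form (fun t => `|t|).
Let K := spectral_form (fun t => t ^+ 2).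

Let idE u : (\int[diag_measure (L2dot mu) E u]_(t in D) (idfun t)%:E)%E = J u.
Proof.
rewrite integral_diag_scalar; apply: eq_integral => t.
by rewrite inE /= in_itv /= andbT => t0; rewrite ger0_norm.
Qed.

Let domE u : spectral_dom (L2dot mu) id E u = (K u < +oo)%E :> Prop.
Proof. by rewrite /spectral_dom /= integral_diag_scalar. Qed.

Let J_fin u : (K u < +oo)%E -> J u \is a fin_num.
Proof.
move=> Ku; rewrite ge0_fin_numE ?spectral_form_ge0//.
have m1 : measurable_fun D (fun t : R => `|t|%:E).
  by apply/measurable_EFinP; exact: measurable_funTS.
have m2 : measurable_fun D (fun t : R => (t ^+ 2)%:E).
  by apply/measurable_EFinP; exact: measurable_funTS.
apply: (@le_lt_trans _ _ (\int[m u]_(t in D) (cst 1%:E t + (t ^+ 2)%:E))%E).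
  apply: ge0_le_integral => //.
  - exact: emeasurable_funD.
  - move=> t _; rewrite /= -EFinD lee_fin -(real_normK (num_real t)).
    by have := sqr_ge0 (`|t| - 1); nra.
rewrite ge0_integralD//; last by move=> t _; rewrite lee_fin sqr_ge0.
rewrite integral_cst// mul1e lte_add_pinfty//.
by rewrite scalar_spectral_measureE// ltry.
Qed.

Let domD u v : (K u < +oo)%E -> (K v < +oo)%E -> (K (u + v)%R < +oo)%E.
Proof.
move=> Ku Kv; apply: le_lt_trans (spectral_formD_le msqr (fun t => sqr_ge0 t) u v) _.
by rewrite lte_add_pinfty// lte_mul_pinfty// spectral_form_ge0// => t; exact: sqr_ge0.
Qed.

Let domZ a u : (K u < +oo)%E -> (K (a *: u)%R < +oo)%E.
Proof.
move=> Ku; rewrite /K spectral_formZ// ?lte_mul_pinfty ?lee_fin ?abs2_ge0// => t.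
exact: sqr_ge0.
Qed.

Let domP B u : measurable B -> (K u < +oo)%E -> (K (E B u) < +oo)%E.
Proof.
move=> mB; apply: le_lt_trans.
rewrite {2}/K (spectral_form_split msqr (fun t => sqr_ge0 t) u mB).
by rewrite leeDl// spectral_form_ge0// => t; exact: sqr_ge0.
Qed.

Let abs2_iX k : abs2 ('i ^+ k : R[i]) = 1.
Proof.
elim: k => [|k IH]; first by rewrite expr0 /abs2 /= expr1n expr0n addr0.
by rewrite exprS abs2M IH mulr1 -complexiE /abs2 /= expr1n expr0n add0r.
Qed.

Local Notation S := (spectral_integral (L2dot mu) id E).

Lemma spectral_integral_id f g : S (f, g) <-> (K f < +oo)%E /\
  forall v, (K v < +oo)%E -> ip g v =
    4^-1 * \sum_(k < 4) 'i ^+ k * ((fine (J (f + 'i ^+ k *: v)))%:C)%C.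
Proof.
rewrite /spectral_integral /= domE L2_inner.unlock; split=> -[Kf fg]; split=> // v.
- move=> Kv; rewrite [LHS](fg v _); last by rewrite domE.
  by congr (_ * _); apply: eq_bigr => k _; rewrite idE.
- rewrite domE => Kv; rewrite [LHS](fg v Kv).
  by congr (_ * _); apply: eq_bigr => k _; rewrite idE.
Qed.

(* In both polarization sums the k-th term is <t E B (f + i^k v), f + i^k v> up to
   a summand independent of k. *)
Lemma spectral_projection_commute f g B : measurable B ->
  S (f, g) -> S (E B f, E B g).
Proof.
move=> mB /spectral_integral_id[Kf fg]; apply/spectral_integral_id; split; first exact: domP.
move=> v Kv; have pB := Eproj mB.
rewrite (projection_sym pB) fg; last exact: domP.
have split_form u : (K u < +oo)%E ->
    fine (J u) = fine (J (E B u)) + fine (J (u - E B u)).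
  move=> Ku; rewrite /J (spectral_form_split mnorm (fun t => normr_ge0 t) u mB) fineD//.
  - by apply: J_fin; exact: domP.
  - by apply: J_fin; rewrite -scaleN1r; apply: domD => //; apply/domZ/domP.
have E1 k : fine (J (f + 'i ^+ k *: E B v)) =
    fine (J (E B (f + 'i ^+ k *: v))) + fine (J (f - E B f)).
  rewrite split_form; last by apply: domD => //; apply/domZ/domP.
  rewrite !(projectionD pB) !(projectionZ pB) (projection_idem pB).
  by rewrite opprD addrACA subrr addr0.
have E2 k : fine (J (E B f + 'i ^+ k *: v)) =
    fine (J (E B (f + 'i ^+ k *: v))) + fine (J (v - E B v)).
  rewrite split_form; last by apply: domD; [exact: domP|exact: domZ].
  rewrite !(projectionD pB) !(projectionZ pB) (projection_idem pB).
  rewrite opprD addrACA subrr add0r -scalerBr.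
  by rewrite [in X in _ + X = _]/J spectral_formZ// abs2_iX mul1e.
exact: (polarization_sum_shift E1 E2).
Qed.

Lemma spectral_integral_fin f g : S (f, g) -> J f \is a fin_num.
Proof. by move=> /spectral_integral_id[/J_fin]. Qed.

(** Test with [f] itself: the form at f + i^k f is |1 + i^k|^2 times that at f. The factors 4, 2, 0,
    2 for k = 0, 1, 2, 3 make the polarization sum equal to J f. *)
Lemma spectral_integral_dot f g : S (f, g) -> ip g f = (fine (J f))%:C%C.
Proof.
move=> /spectral_integral_id[Kf fg]; rewrite (fg _ Kf).
have E1 (c : R[i]) : fine (J (f + c *: f)) = abs2 (1 + c) * fine (J f).
  rewrite -{1}[f]scale1r -scalerDl /J spectral_formZ// fineM//; exact: J_fin.
rewrite (eq_bigr (fun k : 'I_4 => 'i ^+ k * ((abs2 (1 + 'i ^+ k) * fine (J f))%:C)%C));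
  last by move=> k _; rewrite (E1 ('i ^+ k)).
move: (fine (J f)) => j.
rewrite (polarization_sum (fun k => abs2 (1 + 'i ^+ k) * j)).
have i2 : 'i ^+ 2 = - 1 :> R[i] by rewrite -complexiE sqr_i.
have i3 : 'i ^+ 3 = - 'i :> R[i] by rewrite exprS i2 mulrN1.
rewrite i2 i3 expr0 expr1 -complexiE.
by congr Complex; rewrite /abs2 /=; field.
Qed.

End SpectralIntegralForm.

Lemma integral_gt0_null d (T : measurableType d) (R : realType)
    (m : {measure set T -> \bar R}) (D : set T) (g : T -> R) :
  measurable D -> measurable_fun D g -> (forall t, D t -> 0 < g t) ->
  (\int[m]_(t in D) (g t)%:E = 0)%E -> m D = 0%E.
Proof.
move=> mD mg g0 i0.
have : (\int[m]_(t in D) `|(g t)%:E| = 0)%E.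
  rewrite -i0; apply: eq_integral => t /set_mem Dt.
  by rewrite gee0_abs// lee_fin ltW// g0.
move/(ae_eq_integral_abs m mD (proj2 (measurable_EFinP _ _) mg)) => [N [mN N0 DN]].
apply/eqP; rewrite -measure_le0 -N0 le_measure ?inE// => t Dt.
by apply: DN => /(_ Dt)[/eqP]; rewrite gt_eqF// g0.
Qed.

Lemma ae_le_Rintegral d (T : measurableType d) (R : realType)
    (m : {measure set T -> \bar R}) (f g : T -> R) :
  m.-integrable setT (EFin \o f) -> m.-integrable setT (EFin \o g) ->
  {ae m, forall x, f x <= g x} -> \int[m]_x f x <= \int[m]_x g x.
Proof.
move=> fi gi fg; rewrite -subr_ge0 -RintegralB//.
have mfg : measurable_fun setT (fun x => g x - f x).
  by apply: measurable_funB; apply/measurable_EFinP; [exact: measurable_int gi|exact: measurable_int fi].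
have -> : \int[m]_x (g x - f x) = \int[m]_x `|g x - f x|.
  congr fine; apply: ae_eq_integral => //.
  - exact/measurable_EFinP.
  - by apply/measurable_EFinP; exact: measurableT_comp.
  - by apply: filterS fg => x fgx _; rewrite ger0_norm// subr_ge0.
exact: Rintegral_ge0.
Qed.

Lemma ae_weight_eq0 d (T : measurableType d) (R : realType)
    (m : {measure set T -> \bar R}) (k : T -> R) (v : L2 m) :
  m.-integrable setT (EFin \o (fun x => k x * abs2 (repr v x))) ->
  {ae m, forall x, repr v x = 0 \/ 0 < k x} ->
  \int[m]_x (k x * abs2 (repr v x)) <= 0 -> v = 0.
Proof.
move=> ki k0 i0.
have mk : measurable_fun setT (fun x => k x * abs2 (repr v x)).
  by apply/measurable_EFinP; exact: measurable_int ki.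
have : (\int[m]_x `|(k x * abs2 (repr v x))%:E| = 0)%E.
  rewrite -[LHS]fineK; last first.
    apply: integrable_fin_num => //; exact: integrable_abse ki.
  congr EFin; apply/eqP; rewrite eq_le fine_ge0 ?andbT; last by apply: integral_ge0.
  apply: le_trans i0; rewrite [leLHS](_ : _ = \int[m]_x (k x * abs2 (repr v x)))//.
  congr fine; apply: ae_eq_integral => //.
  - by apply: measurableT_comp => //; exact/measurable_EFinP.
  - exact/measurable_EFinP.
  - apply: filterS k0 => x [->|kx] _; rewrite ?abs20 ?mulr0 ?abse0//.
    by rewrite gee0_abs// lee_fin mulr_ge0 ?abs2_ge0// ltW.
move/(ae_eq_integral_abs m measurableT (proj2 (measurable_EFinP _ _) mk)) => z.
apply: L2_ext; move: z k0 (repr0 m); apply: filterS3 => x /(_ I)[] /eqP zx kx ->.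
move: zx; rewrite mulf_eq0 abs2_eq0 => /orP[/eqP k0x|/eqP //].
by case: kx => //; rewrite k0x ltxx.
Qed.

(** * Identification of the diagonal measures by means of rays *)

Section SpectralDetermined.
Context d (X : measurableType d) (R : realType) (mu : {measure set X -> \bar R}).
Variable s : X -> R.
Hypotheses (ms : measurable_fun setT s) (s0 : forall x, 0 <= s x).
Variable E : set R -> L2 mu -> L2 mu.
Hypothesis Esp : spectral_measure (L2dot mu) E.
Hypothesis SE : spectral_integral (L2dot mu) id E = mulop mu s.
Implicit Types (u v f g : L2 mu) (A B : set R).

Let Eproj A : measurable A -> orthogonal_projection (L2dot mu) (E A).
Proof. by case: Esp => + _ _; apply. Qed.

(** Puts an everywhere defined map such as [E B] in the form required by the commutant calculus. *)
Definition graph (p : L2 mu -> L2 mu) : operator (L2 mu) := [set fg | fg.2 = p fg.1].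

Lemma graph_projection_selfadjoint p : orthogonal_projection (L2dot mu) p ->
  adjoint (L2dot mu) (graph p) = graph p.
Proof.
move=> pp; apply/seteqP; split=> -[u v] /=.
- move=> /adjointP uv; apply: dotP => z; rewrite -(projection_sym pp).
  by apply/esym/uv.
- rewrite /graph /= => ->; apply/adjointP => f g; rewrite /graph /= => ->; exact: projection_sym.
Qed.

Let h x : R := s x ^+ 2.
Let mh : measurable_fun setT h. Proof. exact: measurable_funX. Qed.
Let h0 x : 0 <= h x. Proof. exact: sqr_ge0. Qed.

(** A spectral projection commutes with the integral of t, which is the multiplication by s.
    Applying this twice gives commutation with s^2, and uniqueness of the solution of (1 + T) f = u
    gives it for the resolvent. *)
Let commutes_E_resolvent B : measurable B -> commutes (graph (E B)) (resolvent h).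
Proof.
move=> mB; have br := bounded_resolvent mh h0; split=> // f g.
rewrite {1}/graph /= => ->; rewrite /graph /=.
have := mulop_resolvent mh h0 f; rewrite /h -(mulop_comp mu ms s0) => -[m /= fm mf].
apply/esym/(eq_bmul_resolvent mh h0); rewrite /h -(mulop_comp mu ms s0).
exists (E B m) => /=; first by rewrite -SE; apply: spectral_projection_commute; rewrite ?SE.
rewrite -(projectionB (Eproj mB)) -SE.
by apply: spectral_projection_commute; rewrite ?SE.
Qed.

Let q (c : R) u : L2 mu := bmul (\1_[set x | s x < c]) u.

Let mq c : measurable [set x | s x < c].
Proof.
rewrite (_ : [set x | s x < c] = s @^-1` `]-oo, c[%classic).
  by apply: measurable_preim => //; exact: measurable_itv.
by apply/seteqP; split=> x /=; rewrite in_itv.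
Qed.

Let bq c : bounded_mfun (\1_[set x | s x < c] : X -> R).
Proof. exact: bounded_mfun_indic. Qed.

Let commutes_E_q B c u : measurable B -> 0 < c -> E B (q c u) = q c (E B u).
Proof.
move=> mB c0; have Gsa := graph_projection_selfadjoint (Eproj mB).
have cr := commutes_E_resolvent mB.
have cr' : commutes (graph (E B)) (fun x => 1 - resolvent h x).
  by apply: commutesB => //; exact: commutes_cst.
(* On t >= 0 the function 1 - (1 + t^2)^-1 is increasing with value c' at c. Hence {s < c} is the
   complement of the level set {1 - resolvent >= c'}, and c > 0 ensures c' > 0. *)
pose c' := 1 - (1 + c ^+ 2)^-1.
have cp : 0 < 1 + c ^+ 2 by rewrite ltr_pwDl// sqr_ge0.
have c'0 : 0 < c'.
  rewrite subr_gt0 invf_lt1// ltrDl exprn_gt0//.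
have c'1 : c' <= 1 by rewrite gerBl invr_ge0 ltW.
have r01 x : 0 <= 1 - resolvent h x <= 1.
  by have /andP[r0 r1] := resolvent01 h0 x; apply/andP; split; lra.
have := commutes_indic Gsa cr' r01 c'0 c'1.
move=> /(commutesB Gsa (commutes_cst Gsa 1)).
rewrite (_ : (fun x => _) = \1_[set x | s x < c]); last first.
  apply/funext => x; rewrite !indicE.
  have -> : (x \in [set x | c' <= 1 - resolvent h x]) = (c <= s x).
    have E1 : (c' <= 1 - resolvent h x) = (c <= s x).
      rewrite /c' lerD2l lerN2 /resolvent lef_pV2 ?posrE//; last by rewrite ltr_pwDl.
      by rewrite lerD2l /h ler_sqr ?nnegrE// ltW.
    by rewrite -E1; apply/idP/idP => [/set_mem|/mem_set].
  have -> : (x \in [set x | s x < c]) = (s x < c).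
    by apply/idP/idP => [/set_mem|/mem_set].
  by case: (ltP (s x) c) => _; rewrite ?subr0 ?subrr.
by move=> [_ H]; have := H u (E B u) erefl; rewrite /graph /= => e; exact: esym e.
Qed.

Let J u : \bar R := spectral_form Esp (fun t => `|t|) u.

Let mJ : measurable_fun setT (fun t : R => `|t|).
Proof. exact: measurableT_comp. Qed.

Let J_mu v w : mulop mu s (v, w) ->
  fine (J v) = \int[mu]_x (s x * abs2 (repr v x)).
Proof.
move=> vw; have := mulop_pos ms s0 vw; rewrite -SE in vw.
by rewrite (spectral_integral_dot Esp vw) => -[].
Qed.

Let J_fin v w : mulop mu s (v, w) -> J v \is a fin_num.
Proof. by rewrite -SE => /spectral_integral_fin; exact. Qed.

Let c_mul_nsq (c : R) v : c * nsq v = \int[mu]_x (c * abs2 (repr v x)).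
Proof.
rewrite L2_normsq.unlock RintegralZl//.
by have := integrable_abs2 (isL2_repr v); apply: eq_integrable.
Qed.

Let int_abs2 (c : R) v :
  mu.-integrable setT (EFin \o (fun x => c * abs2 (repr v x))).
Proof. by have := integrableZl measurableT c (integrable_abs2 (isL2_repr v)); apply: eq_integrable. Qed.

Local Notation m := (scalar_spectral_measure Esp).

Section Threshold.
Variable c : R.
Hypothesis c0 : 0 < c.

Local Notation B := (`]-oo, c[%classic : set R).
Local Notation C := (`[c, +oo[%classic : set R).
Local Notation D0 := (`[0, c[%classic : set R).

Let mB : measurable B. Proof. exact: measurable_itv. Qed.
Let mC : measurable C. Proof. exact: measurable_itv. Qed.
Let mD0 : measurable D0. Proof. exact: measurable_itv. Qed.

Let D0C : `[0, +oo[%classic = D0 `|` C.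
Proof.
apply/seteqP; split=> t /=; rewrite !in_itv /= !andbT.
  by move=> t0; case: (ltP t c); [left; rewrite t0|right].
by move=> [/andP[]//|]; apply: le_trans; exact: ltW.
Qed.

Let D0C0 : D0 `&` C = set0.
Proof.
by apply/seteqP; split=> t //= [] /=; rewrite !in_itv /= andbT => /andP[_ tc]; rewrite leNgt tc.
Qed.

Let J_split v : J v = (\int[m v]_(t in D0) t%:E + \int[m v]_(t in C) t%:E)%E.
Proof.
rewrite /J /spectral_form D0C ge0_integral_setU//; last 2 first.
- by apply/measurable_EFinP; exact: measurable_funTS.
- exact/disj_set2P.
congr (_ + _)%E; apply: eq_integral => t; rewrite inE /= in_itv /=.
  by move=> /andP[t0 _]; rewrite ger0_norm.
by rewrite andbT => ct; rewrite ger0_norm// (le_trans (ltW c0)).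
Qed.

Let m_total v : m v D0 = ((nsq v)%:E - m v C)%E.
Proof.
have <- : m v `[0, +oo[%classic = (nsq v)%:E.
  rewrite scalar_spectral_measureE; last exact: measurable_itv.
  by case: Esp => _ -> _.
by rewrite D0C measureU// addeK// [X in X \is a fin_num]scalar_spectral_measureE.
Qed.

(* In both lemmas <S v, v> is computed as the integral of t against the scalar
   spectral measure of v and as the integral of s |v|^2: one of them is at least
   c |v|^2 and the other one is smaller than that unless v = 0. *)
Let vanish_below v w : mulop mu s (v, w) -> E B v = v -> q c v = 0 -> v = 0.
Proof.
move=> vw Ev qv; have Jfin := J_fin vw.
have mC0 : m v C = 0%E.
  rewrite scalar_spectral_measureE// -Ev spectral_disjoint ?nsq0//.
  apply/seteqP; split=> t //= [] /=; rewrite !in_itv /= andbT => ct.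
  by rewrite ltNge ct.
have mD0E : m v D0 = (nsq v)%:E by rewrite m_total mC0 sube0.
have JE : J v = (\int[m v]_(t in D0) t%:E)%E.
  by rewrite J_split [X in (_ + X)%E]null_set_integral ?adde0.
have cJ : c * nsq v <= fine (J v).
  rewrite (J_mu vw) c_mul_nsq; apply: ae_le_Rintegral.
  - exact: int_abs2.
  - exact: mulop_pos_integrable vw.
  - have := bmulE v (bq c); rewrite -[bmul _ _]/(q c v) qv.
    have r0 := repr0 mu; move: r0; apply: filterS2 => x -> /esym.
    rewrite indicE; case: (boolP (x \in _)) => [_|].
      by rewrite mul1r => ->; rewrite abs20 !mulr0.
    move=> /negP xc _; rewrite ler_wpM2r ?abs2_ge0// leNgt; apply/negP => sc.
    by apply: xc; rewrite inE.
have m1 : measurable_fun D0 (fun t : R => t%:E) by exact/measurable_EFinP.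
have m2 : measurable_fun D0 (fun t : R => c - t) by exact: measurable_funB.
have p1 t : D0 t -> (0 <= (c - t)%:E)%E.
  by rewrite /= in_itv /= lee_fin subr_ge0 => /andP[_ /ltW].
have p2 t : D0 t -> (0 <= t%:E)%E by rewrite /= in_itv /= lee_fin => /andP[].
have m2' : measurable_fun D0 (fun t : R => (c - t)%:E) by exact/measurable_EFinP.
(* All the mass |v|^2 of [m v] sits on [0, c[. Since J v >= c |v|^2, the integral of c - t > 0 over
   [0, c[ must vanish, and with it the mass. *)
have cD : ((c * nsq v)%:E = \int[m v]_(t in D0) (c - t)%:E + J v)%E.
  rewrite JE -ge0_integralD//.
  under eq_integral do rewrite -EFinD subrK.
  by rewrite integral_cst// mD0E EFinM.
have i0 : (\int[m v]_(t in D0) (c - t)%:E = 0)%E.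
  apply/eqP; rewrite eq_le integral_ge0 ?andbT//.
  by rewrite -(leeD2rE _ _ Jfin) add0e -cD -(fineK Jfin) lee_fin.
apply: nsq_eq0; apply/EFin_inj; rewrite -mD0E.
apply: (integral_gt0_null _ m2 _ i0) => // t /=.
by rewrite in_itv /= subr_gt0 => /andP[].
Qed.

Let vanish_above v w : mulop mu s (v, w) -> E B v = 0 -> q c v = v -> v = 0.
Proof.
move=> vw Ev qv; have Jfin := J_fin vw.
have mD00 : m v D0 = 0%E.
  apply/eqP; rewrite -measure_le0.
  have -> : 0%E = m v B by rewrite scalar_spectral_measureE// Ev nsq0.
  rewrite le_measure ?inE// => t /=; rewrite !in_itv /=.
  by move=> /andP[].
have mCE : m v C = (nsq v)%:E.
  have /eqP := m_total v; rewrite mD00.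
  rewrite scalar_spectral_measureE// -EFinB eqe eq_sym subr_eq0 => /eqP ->.
  by [].
have cJ : c * nsq v <= fine (J v).
  have z0 : (\int[m v]_(t in D0) t%:E = 0)%E.
    by rewrite null_set_integral//; apply/measurable_EFinP; exact: measurable_funTS.
  rewrite -lee_fin (fineK Jfin) J_split z0 add0e.
  rewrite EFinM -mCE -integral_cst//; apply: ge0_le_integral => //.
  - by move=> t _; rewrite lee_fin ltW.
  - by move=> t /=; rewrite in_itv /= andbT lee_fin.
have i1 := mulop_pos_integrable ms vw; have i2 := int_abs2 c v.
have iB : mu.-integrable setT (EFin \o (fun x => (c - s x) * abs2 (repr v x))).
  have := integrableB measurableT i2 i1; apply: eq_integrable => // x _.
  by rewrite /= mulrBl EFinB.
apply: (ae_weight_eq0 iB).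
- have := bmulE v (bq c); rewrite -[bmul _ _]/(q c v) qv.
  apply: filterS => x; rewrite indicE; case: (boolP (x \in _)) => [/set_mem sc _|_ ->].
    by right; rewrite subr_gt0.
  by left; rewrite mul0r.
- under eq_Rintegral do rewrite mulrBl.
  by rewrite RintegralB// -c_mul_nsq -(J_mu vw) subr_le0.
Qed.

Let Ssa := mulop_selfadjoint mu ms s0.

Let S_sub v w v' w' : mulop mu s (v, w) -> mulop mu s (v', w') ->
  mulop mu s (v - v', w - w').
Proof.
move=> vw vw'; have := selfadjoint_lin Ssa (-1) vw' vw.
by rewrite !scaleN1r ![- _ + _]addrC.
Qed.

Let S_q v w : mulop mu s (v, w) -> mulop mu s (q c v, q c w).
Proof.
move=> vw; rewrite mulopE; move: vw (bmulE v (bq c)) (bmulE w (bq c)).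
by apply: filterS3 => x /= vw -> ->; rewrite vw mulrCA.
Qed.

Let S_E v w : mulop mu s (v, w) -> mulop mu s (E B v, E B w).
Proof. by rewrite -SE; exact: spectral_projection_commute. Qed.

Let q_lin v w : q c (v - w) = q c v - q c w.
Proof.
by have := bmul_lin (-1) w v (bq c); rewrite !scaleN1r ![- _ + _]addrC.
Qed.

Let q_idem v : q c (q c v) = q c v.
Proof. by rewrite /q -bmulM//; apply: eq_bmul => [|x]; [exact: bounded_mfunM|exact: indicK]. Qed.

(** E B and q c coincide as soon as E B (1 - q c) and (1 - E B) q c are 0. These products are killed
    by [vanish_below] and [vanish_above], whose use of the form of s confines [f] to its domain. *)
Let E_q_dom f g : mulop mu s (f, g) -> E B f = q c f.
Proof.
move=> fg; have pB := Eproj mB.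
have V1 : E B (f - q c f) = 0.
  apply: (vanish_below (S_E (S_sub fg (S_q fg)))); first exact: projection_idem.
  by rewrite -commutes_E_q// q_lin q_idem subrr projection0.
have V2 : q c f - E B (q c f) = 0.
  apply: (vanish_above (S_sub (S_q fg) (S_E (S_q fg)))).
    by rewrite projectionB// projection_idem// subrr.
  by rewrite q_lin -commutes_E_q// q_idem.
by move/eqP: V1; rewrite projectionB// subr_eq0 => /eqP ->; move/eqP: V2; rewrite subr_eq0 => /eqP <-.
Qed.

(** Truncated vectors lie in the domain of s; symmetry of both projections and of the truncation
    shifts the identity from them to an arbitrary [u]. *)
Lemma spectral_projection_ray u : E B u = q c u.
Proof.
apply: (bmul_trunc_ext ms) => n; have bt := bounded_trunc n ms.
have tr z : mulop mu s (bmul (trunc s n) z, bmul (fun x => s x * trunc s n x) z).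
  by apply: mulop_bmul => //; exact: bounded_mul_trunc.
apply: dotP => z; rewrite -!dot_bmulC// -(projection_sym (Eproj mB)) (E_q_dom (tr z)).
by rewrite dot_bmulC.
Qed.

End Threshold.

Let E_q c u : E `]-oo, c[%classic u = q c u.
Proof.
have [c0|c0] := ltP 0 c; first exact: spectral_projection_ray.
transitivity (0 : L2 mu).
  have [_ ED _] := Esp; rewrite -{1}(ED u) spectral_disjoint//; try exact: measurable_itv.
  apply/seteqP; split=> t //= []; rewrite !in_itv /= andbT => tc.
  by rewrite leNgt (lt_le_trans tc).
rewrite -(scale0r u) -[0](rmorph0 (real_complex R)) -bmul_cst; apply: eq_bmul.
  exact: bounded_mfun_cst.
by move=> x; rewrite indicE memNset//= => sc; have := s0 x; rewrite leNgt (lt_le_trans sc).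
Qed.

(** The rays ]-oo, c[ are stable under intersection and generate the Borel sets, and both measures
    are finite on them; agreement on rays thus determines the measure. *)
Lemma diag_spectral_unique u A : measurable A ->
  diag_measure (L2dot mu) E u A = (\int[mu]_(x in s @^-1` A) (abs2 (repr u x))%:E)%E.
Proof.
move=> mA.
have [n nE] := density_measureP mu (measurable_abs2_repr u) (fun x => abs2_ge0 _).
have [M ME] := pushforward_measureP n ms.
have pre B : measurable B -> measurable (s @^-1` B) by exact: measurable_preim.
rewrite -nE; last exact: pre.
rewrite -ME//.
transitivity (scalar_spectral_measure Esp u A).
  rewrite scalar_spectral_measureE//; congr EFin; apply: projection_nsq; exact: Eproj.
pose g (k : nat) := `]-oo, (k%:R : R)[%classic.
have Gm : forall B, (@RGenInftyO.G R) B -> scalar_spectral_measure Esp u B = M B.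
  move=> _ [c ->]; have mc : measurable (`]-oo, c[%classic : set R) by exact: measurable_itv.
  rewrite scalar_spectral_measureE// ME// nE//; last exact: pre.
  have -> : s @^-1` `]-oo, c[%classic = [set x | s x < c].
    by apply/seteqP; split=> x /=; rewrite in_itv.
  by rewrite E_q nsq_indic.
apply: (measure_unique (@RGenInftyO.G R) g) => //.
- exact: RGenInftyO.measurableE.
- move=> _ _ [x ->] [y ->]; exists (Num.min x y); apply/seteqP; split=> t /=;
    rewrite !in_itv /= lt_min.
    by move=> [-> ->].
  by move=> /andP[].
- by move=> i; exists i%:R.
- apply/seteqP; split=> // t _; exists (Num.bound `|t|) => //=.
  by rewrite /g /= in_itv /= (le_lt_trans (ler_norm _))// archi_boundP.
- by move=> k; rewrite scalar_spectral_measureE ?ltry//; exact: measurable_itv.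
Qed.
End SpectralDetermined.

Section OperatorPowers.
Context d (X : measurableType d) (R : realType) (mu : {measure set X -> \bar R}).
Variable s : X -> R.
Hypotheses (ms : measurable_fun setT s) (s0 : forall x, 0 <= s x).

(** [mulop_spectrum] guarantees that the choice in [spectral_measure_of] has a candidate. Whichever
    one is chosen, its diagonal measures are the expected ones, and the integral depends on nothing
    else. *)
Lemma oppow_mulop (a : R) :
  oppow (L2dot mu) (mulop mu s) a = mulop mu (fun x => s x `^ a).
Proof.
have ex : exists E, [set E | spectral_measure (L2dot mu) E /\
    spectral_integral (L2dot mu) id E = mulop mu s] E.
  exists (mulop_spectrum s); split; first exact: mulop_spectrum_spectral.
  have := @spectral_integral_mulop _ _ _ _ _ ms s0 _ (diag_mulop_spectrum ms) idfun.
  by apply => //; exact: measurable_id.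
rewrite /oppow /spectral_measure_of.
have [Esp SE] := xgetPex ((fun=> idfun) : set R -> L2 mu -> L2 mu) ex.
apply: (spectral_integral_mulop ms s0 _ (th := fun t => t `^ a)).
- by move=> f A mA; exact: (diag_spectral_unique ms s0 Esp SE).
- exact: measurable_powR.
- by move=> t _; exact: powR_ge0.
Qed.

End OperatorPowers.

(** * Polar decomposition of a weighted composition operator *)

Section InnerPolarization.
Context d (X : measurableType d) (R : realType) (mu : {measure set X -> \bar R}).
Implicit Types u v : L2 mu.

Lemma real_scaleA (a b c e : R) (z : R[i]) : a * b = c * e ->
  a%:C%C * (b%:C%C * z) = c%:C%C * (e%:C%C * z).
Proof. by move=> E; rewrite !mulrA -!rmorphM E. Qed.

Lemma real_scale3 (a b c : R) (z : R[i]) : a * (b * c) = 1 ->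
  a%:C%C * (z * b%:C%C * c%:C%C) = z.
Proof. by move=> E; rewrite -mulrA mulrCA -!rmorphM E rmorph1 mulr1. Qed.

Lemma real_scale3_inj (a b c : R) (z : R[i]) : z != 0 ->
  z = a%:C%C * (z * b%:C%C * c%:C%C) -> a * (b * c) = 1.
Proof.
move=> z0; rewrite -mulrA mulrCA -!rmorphM -{1}[z]mulr1 => /(mulfI z0).
by rewrite -(rmorph1 (real_complex R)) => /complexI ->.
Qed.

Lemma nsqD_expand u v (c : R[i]) :
  nsq (u + c *: v) = nsq u + abs2 c * nsq v + 2 * complex.Re (c^* * ip u v).
Proof.
have : ip (u + c *: v) (u + c *: v) =
    ip u u + c^* * ip u v + (c * ip v u + c * (c^* * ip v v)).
  by rewrite dotDl !dotDr !dotZl !dotZr.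
rewrite !dotuu (dotC v u); case: (ip u v) => a b; case: c => c1 c2.
by move=> [-> _]; rewrite /abs2 /=; ring.
Qed.

Lemma eq_ip_nsq u v u' v' :
  (forall c, nsq (u + c *: v) = nsq (u' + c *: v')) -> ip u v = ip u' v'.
Proof.
move=> H; have := H 1; have := H (-1); have := H 'i; have := H (- 'i).
rewrite !nsqD_expand -complexiE; case: (ip u v) => a b; case: (ip u' v') => a' b'.
by rewrite /abs2 /= => H1 H2 H3 H4; congr Complex; lra.
Qed.

End InnerPolarization.

(** * Modulus and polar isometry of C *)

Section WeightedComposition.
Context d (X : measurableType d) (R : realType) (mu : {measure set X -> \bar R}).
Variables (w : X -> R[i]) (phi : X -> X) (h : X -> R).
Hypotheses (mw : cmeasurable w) (mphi : measurable_fun setT phi).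
Hypotheses (mh : measurable_fun setT h) (h0 : forall x, 0 <= h x).
Hypothesis ns : nonsingular mu w phi.
Hypothesis change_of_var : forall F : X -> R, measurable_fun setT F ->
  (forall x, 0 <= F x) ->
  (\int[mu]_x (F (phi x) * abs2 (w x))%:E = \int[mu]_x (F x * h x)%:E)%E.
Implicit Types (u f g k : L2 mu).

Let s x : R := Num.sqrt (h x).
Let ms : measurable_fun setT s. Proof. exact: measurable_sqrt_comp. Qed.
Let s0 x : 0 <= s x. Proof. exact: sqrtr_ge0. Qed.
Let hs x : h x = s x ^+ 2. Proof. by rewrite sqr_sqrtr. Qed.

Local Notation C := (wcomp mu w phi).
Local Notation S := (mulop mu s).

Let cmeas_comp (z : X -> R[i]) f : cmeasurable z ->
  cmeasurable (fun x => z x * repr f (phi x)).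
Proof.
move=> mz; apply: cmeasurableM => //.
by apply: (cmeasurable_comp _ mphi); case: (isL2_repr f).
Qed.

(** The change of variables turns |w|^2 |f o phi|^2 into h |f|^2 = |s f|^2. Equality of the domains
    and of the norms of C and S rests on this. *)
Let int_comp f : (\int[mu]_x (abs2 (w x * repr f (phi x)))%:E =
  \int[mu]_x (abs2 ((s x)%:C%C * repr f x))%:E)%E.
Proof.
under eq_integral do rewrite abs2M mulrC.
rewrite (change_of_var (measurable_abs2_repr f)) => [|x]; last exact: abs2_ge0.
by apply: eq_integral => x _; rewrite abs2M abs2C hs mulrC.
Qed.

Lemma wcomp_modulus_dom f g : C (f, g) -> exists k, S (f, k).
Proof.
move=> fg; exists (toL2 mu (fun x => (s x)%:C%C * repr f x)); apply: repr_toL2; split.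
  by apply: cmeasurableM; [exact: cmeasurable_real|case: (isL2_repr f)].
rewrite /square_integrable -int_comp.
rewrite (ae_eq_integral (fun x => (abs2 (repr g x))%:E))//.
- by case: (isL2_repr g).
- by apply/measurable_EFinP/cmeasurable_abs2; exact: cmeas_comp.
- exact/measurable_EFinP/measurable_abs2_repr.
- by apply: filterS fg => x /= -> _.
Qed.

Lemma modulus_wcomp_dom f k : S (f, k) -> exists g, C (f, g).
Proof.
move=> fk; exists (toL2 mu (fun x => w x * repr f (phi x))); apply: repr_toL2; split.
  exact: cmeas_comp.
rewrite /square_integrable int_comp.
rewrite (ae_eq_integral (fun x => (abs2 (repr k x))%:E))//.
- by case: (isL2_repr k).
- apply/measurable_EFinP/cmeasurable_abs2.
  by apply: cmeasurableM; [exact: cmeasurable_real|case: (isL2_repr f)].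
- exact/measurable_EFinP/measurable_abs2_repr.
- by apply: filterS fk => x /= -> _.
Qed.

Lemma wcomp_modulus_nsq f g k : C (f, g) -> S (f, k) -> nsq g = nsq k.
Proof.
move=> fg fk; apply/EFin_inj; rewrite !nsqE.
transitivity (\int[mu]_x (abs2 (w x * repr f (phi x)))%:E)%E.
  apply: ae_eq_integral => //.
  - exact/measurable_EFinP/measurable_abs2_repr.
  - by apply/measurable_EFinP/cmeasurable_abs2; exact: cmeas_comp.
  - by apply: filterS fg => x /= -> _.
rewrite int_comp; apply: ae_eq_integral => //.
- apply/measurable_EFinP/cmeasurable_abs2.
  by apply: cmeasurableM; [exact: cmeasurable_real|case: (isL2_repr f)].
- exact/measurable_EFinP/measurable_abs2_repr.
- by apply: filterS fk => x /= -> _.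
Qed.

Let C_lin : linear_operator C. Proof. exact: wcomp_linear. Qed.
Let S_lin : linear_operator S. Proof. exact/wcomp_linear/nonsingular_id. Qed.
Let S_sa : adjoint (L2dot mu) S = S. Proof. exact: mulop_selfadjoint. Qed.

Lemma wcomp_modulus_ip f g k f' g' k' : C (f, g) -> S (f, k) ->
  C (f', g') -> S (f', k') -> ip g' g = ip k' k.
Proof.
move=> fg fk fg' fk'; apply: eq_ip_nsq => c.
have [_ CL _] := C_lin; have [_ SL _] := S_lin.
apply: (wcomp_modulus_nsq (f := f' + c *: f)); rewrite ![_ + c *: _]addrC.
  exact: CL.
exact: SL.
Qed.

(** C and S share their domain and their inner products there, so a vector l fulfils the condition
    for C f to be mapped to l by the adjoint of C exactly when it fulfils that for S f and the
    adjoint of S, which is S. *)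
Lemma adjoint_wcomp_comp : opcomp (adjoint (L2dot mu) C) C = mulop mu h.
Proof.
rewrite (funext hs) -(mulop_comp mu ms s0); apply/seteqP; split=> -[f l] [g /= fg gl].
- have [k fk] := wcomp_modulus_dom fg; exists k => //=.
  rewrite -S_sa; apply/adjointP => f' k' fk'.
  have [g' fg'] := modulus_wcomp_dom fk'.
  rewrite -(wcomp_modulus_ip fg fk fg' fk').
  by move/adjointP: gl; apply.
- have [z fz] := modulus_wcomp_dom fg; exists z => //=.
  apply/adjointP => f' g' fg'; have [k' fk'] := wcomp_modulus_dom fg'.
  rewrite (wcomp_modulus_ip fz fg fg' fk').
  by move: gl; rewrite -{1}S_sa => /adjointP; apply.
Qed.

Lemma mulop_positive_selfadjoint : positive_selfadjoint (L2dot mu) S.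
Proof.
split=> //; first exact: mulop_dense.
move=> f g fg; suff: 0 <= ip g f by rewrite L2_inner.unlock.
rewrite (mulop_pos ms s0 fg) lecR; apply: Rintegral_ge0 => x _.
by rewrite mulr_ge0// abs2_ge0.
Qed.

Lemma modulus_wcomp : modulus (L2dot mu) C = S.
Proof.
apply: xget_unique.
  split; first exact: mulop_positive_selfadjoint.
  by rewrite adjoint_wcomp_comp mulop_comp// (funext hs).
move=> P [Psa PP]; apply: (positive_sqrt_unique mh h0 Psa).
by rewrite PP adjoint_wcomp_comp.
Qed.

(** The inverse of 0 is 0, so this weight vanishes where s o phi does; by [polar_weight_neq0] that
    happens, up to a null set, only where w = 0. *)
Definition polar_weight x : R[i] := w x * ((s (phi x))^-1)%:C%C.

Local Notation v := polar_weight.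
Local Notation U := (wcomp mu v phi).

Lemma nonsingular_polar : nonsingular mu v phi.
Proof.
move=> P /ns; apply: filterS => x [wx|]; last by right.
by left; rewrite /v wx mul0r.
Qed.

Let ms_inv : measurable_fun setT (fun x => (s x)^-1).
Proof.
have -> : (fun x => (s x)^-1) = (fun t => t `^ (-1)) \o s.
  by apply/funext => x; rewrite /= powR_inv1.
by apply: measurableT_comp => //; exact: measurable_powR.
Qed.

Lemma cmeasurable_polar : cmeasurable v.
Proof.
apply: cmeasurableM => //; apply: cmeasurable_real.
exact: (measurableT_comp ms_inv mphi).
Qed.

(** Take for G the indicator of {s = 0} in the change of variables: the right-hand side integrates h
    over a set on which h = s^2 = 0. *)
Lemma polar_weight_neq0 : {ae mu, forall x, w x = 0 \/ 0 < s (phi x)}.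
Proof.
pose F := \1_(s @^-1` [set 0]) : X -> R.
have mF : measurable (s @^-1` [set 0]).
  by apply: measurable_preim => //; exact: measurable_set1.
have : (\int[mu]_x (F (phi x) * abs2 (w x))%:E = 0)%E.
  rewrite change_of_var; last 2 first.
  - exact: measurable_indic.
  - by move=> x; rewrite /F indicE.
  rewrite integral0_eq// => x _; rewrite /F indicE; case: (boolP (x \in _)).
    by rewrite inE /= => sx; rewrite hs sx expr0n mulr0.
  by rewrite mul0r.
have mFw : measurable_fun setT (fun x => F (phi x) * abs2 (w x)).
  apply: measurable_funM; last exact: cmeasurable_abs2.
  by apply: measurableT_comp => //; exact: measurable_indic.
have Fw0 x : 0 <= F (phi x) * abs2 (w x) by rewrite mulr_ge0 ?abs2_ge0// /F indicE.
move=> i0; have : (\int[mu]_x `|(F (phi x) * abs2 (w x))%:E| = 0)%E.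
  by rewrite -[RHS]i0; apply: eq_integral => x _; rewrite gee0_abs// lee_fin.
move/(ae_eq_integral_abs mu measurableT (proj2 (measurable_EFinP _ _) mFw)).
apply: filterS => x /(_ I)[] /eqP; rewrite mulf_eq0 abs2_eq0 => /orP[|/eqP ->]; last by left.
rewrite /F indicE; case: (boolP (_ \in _)) => [_|/negP sx _]; first by rewrite oner_eq0.
right; rewrite lt_neqAle s0 andbT eq_sym; apply/eqP => sx0; apply: sx.
by rewrite inE.
Qed.

Lemma polar_weightE : {ae mu, forall x, v x * (s (phi x))%:C%C = w x}.
Proof.
apply: filterS polar_weight_neq0 => x [wx|sx]; first by rewrite /v wx !mul0r.
by rewrite /v -mulrA -rmorphM mulVf ?mulr1// gt_eqF.
Qed.

(** Multiplication by [pos] is the initial projection of U: it keeps {s > 0} and removes the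
    kernel. *)
Let pos x : R := \1_(~` (s @^-1` [set 0])) x.

Let posE x : (s x)^-1 ^+ 2 * h x = pos x.
Proof.
rewrite hs /pos indicE; case: (boolP (x \in _)) => [/set_mem sx|/negP sx].
  by rewrite -exprMn mulVf ?expr1n//; apply/eqP.
have -> : s x = 0 by apply: contrapT => sx0; apply: sx; rewrite inE.
by rewrite expr0n mulr0.
Qed.

Let mpos : measurable (~` (s @^-1` [set 0])).
Proof. by apply: measurableC; apply: measurable_preim => //; exact: measurable_set1. Qed.

Let polar_int f : (\int[mu]_x (abs2 (v x * repr f (phi x)))%:E = (nsq (bmul pos f))%:E)%E.
Proof.
rewrite nsq_indic// [RHS]integral_mkcond.
pose G y := abs2 (repr f y) * (s y)^-1 ^+ 2.
transitivity (\int[mu]_x (G (phi x) * abs2 (w x))%:E)%E.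
  by apply: eq_integral => x _; congr EFin; rewrite /G !abs2M abs2C; ring.
rewrite change_of_var; last 2 first.
- by apply: measurable_funM; [exact: measurable_abs2_repr|exact: measurable_funX].
- by move=> x; rewrite mulr_ge0 ?abs2_ge0// sqr_ge0.
apply: eq_integral => x _; rewrite -mulrA posE /pos indicE patchE.
by case: ifPn => _; rewrite ?mulr1 ?mulr0.
Qed.

Lemma polar_total f : exists g, U (f, g).
Proof.
exists (toL2 mu (fun x => v x * repr f (phi x))); apply: repr_toL2; split.
  by apply: cmeas_comp; exact: cmeasurable_polar.
by rewrite /square_integrable polar_int ltry.
Qed.

Lemma polar_nsq f g : U (f, g) -> nsq g = nsq (bmul pos f).
Proof.
move=> fg; apply/EFin_inj; rewrite -polar_int nsqE; apply: ae_eq_integral => //.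
- exact/measurable_EFinP/measurable_abs2_repr.
- by apply/measurable_EFinP/cmeasurable_abs2; apply: cmeas_comp; exact: cmeasurable_polar.
- by apply: filterS fg => x /= -> _.
Qed.

Let bpos : bounded_mfun pos. Proof. exact: bounded_mfun_indic. Qed.

Let pos_proj : orthogonal_projection (L2dot mu) (bmul pos).
Proof.
split; first by move=> a f g; exact: bmul_lin.
- by move=> f; rewrite -bmulM//; apply: eq_bmul => [|x]; [exact: bounded_mfunM|exact: indicK].
- by move=> f g; have := dot_bmulC f g bpos; rewrite L2_inner.unlock.
Qed.

Let U_lin : linear_operator U.
Proof. exact/wcomp_linear/nonsingular_polar. Qed.

Lemma polar_partial_isometry : partial_isometry (L2dot mu) U.
Proof.
split=> //.
- by apply/seteqP; split=> // f _; exact: polar_total.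
- exists 1 => f g fg; suff: ip g g <= 1%:C%C * ip f f by rewrite L2_inner.unlock.
  by rewrite !dotuu mul1r lecR (polar_nsq fg); exact: nsq_projection_le.
- move=> f g fg fker; suff: ip g g = ip f f by rewrite L2_inner.unlock.
  rewrite !dotuu (polar_nsq fg); congr (_%:C%C).
  (* U annihilates f - pos f, so the hypothesis on [f] makes f orthogonal to it, whence f and pos f
     have equal norms. *)
  have [e ke] := polar_total (f - bmul pos f).
  have e0 : e = 0.
    by apply: nsq_eq0; rewrite (polar_nsq ke) projectionB// projection_idem// subrr nsq0.
  rewrite e0 in ke.
  have : ip f (f - bmul pos f) = 0 by rewrite L2_inner.unlock; exact: fker ke.
  rewrite dotBr dotuu -{1}(projection_idem pos_proj) -projection_sym// dotuu -rmorphB.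
  by move=> [/eqP]; rewrite subr_eq0 => /eqP ->.
Qed.

Lemma opker_polar : opker U = opker C.
Proof.
apply/seteqP; split=> f fk; move: fk (repr0 mu) polar_weightE;
  apply: filterS3 => x /= E z vE; rewrite z in E *.
- by rewrite -vE mulrAC -E mul0r.
- by rewrite /v mulrAC -E mul0r.
Qed.

Lemma polar_comp : C = opcomp U S.
Proof.
have comp f k g : S (f, k) -> C (f, g) <-> U (k, g).
  move=> fk.
  have fk' := nonsingular_polar fk.
  have E : {ae mu, forall x, w x * repr f (phi x) = v x * repr k (phi x)}.
    move: fk' polar_weightE; apply: filterS2 => x [vx|->] <-.
      by rewrite vx !mul0r.
    by rewrite mulrA.
  by split; move: E => /[swap]; apply: filterS2 => x /= -> ->.
apply/seteqP; split=> -[f g] /=.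
  move=> fg; have [k fk] := wcomp_modulus_dom fg; exists k => //=.
  exact/(comp _ _ _ fk).
by move=> [k /= fk kg]; exact/(comp _ _ _ fk).
Qed.

Let lin_sub (A : operator (L2 mu)) f g f' g' : linear_operator A ->
  A (f, g) -> A (f', g') -> A (f - f', g - g').
Proof.
move=> [_ lA _] fg fg'; have := lA (-1) _ _ _ _ fg' fg.
by rewrite !scaleN1r ![- _ + _]addrC.
Qed.

Let lin_add (A : operator (L2 mu)) f g f' g' : linear_operator A ->
  A (f, g) -> A (f', g') -> A (f + f', g + g').
Proof. by move=> [_ lA _] fg fg'; have := lA 1 _ _ _ _ fg fg'; rewrite !scale1r. Qed.

(* [f] is approximated by elements of [ker C + ran |C|], where [V] and [U] agree. *)
Lemma polar_unique (V : operator (L2 mu)) : partial_isometry (L2dot mu) V ->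
  opker V = opker C -> C = opcomp V S -> V `<=` U.
Proof.
move=> [V_lin _ [M0 VM] _] kerV CV [f g'] fg'.
have [g fg] := polar_total f; suff -> : g' = g by [].
pose M := Num.max M0 0; have M_ge0 : 0 <= M by rewrite le_max lexx orbT.
have VMn k e : V (k, e) -> nsq e <= M * nsq k.
  move=> /VM; suff: ip e e <= M0%:C%C * ip k k -> nsq e <= M * nsq k.
    by rewrite L2_inner.unlock.
  rewrite !dotuu -rmorphM lecR => /le_trans; apply.
  by rewrite ler_wpM2r ?nsq_ge0// le_max lexx.
have UMn k e : U (k, e) -> nsq e <= nsq k.
  by move=> ke; rewrite (polar_nsq ke); exact: nsq_projection_le.
(* On {1/s <= n} the vector c = f / s is square integrable, so b = s c lies in the range of |C|.
   Where s = 0 the convention 1/0 = 0 keeps the cut-off equal to 1, and that part of f goes into the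
   kernel component [a]. *)
pose si x := (s x)^-1; have si0 x : 0 <= si x by rewrite invr_ge0.
have close n : nsq (g' - g) <= 2 * (M + 1) * nsq (f - bmul (trunc si n) f).
  have bt := bounded_trunc n ms_inv : bounded_mfun (trunc si n).
  have bst := bounded_mul_trunc n ms_inv si0 : bounded_mfun (fun x => si x * trunc si n x).
  pose c := bmul (fun x => si x * trunc si n x) f.
  pose b := bmul pos (bmul (trunc si n) f); pose a := bmul (trunc si n) f - b.
  have cb : S (c, b).
    rewrite mulopE; move: (bmulE f bst) (bmulE (bmul (trunc si n) f) bpos) (bmulE f bt).
    apply: filterS3 => x -> -> ->.
    apply: real_scaleA; rewrite [RHS]mulrA; congr (_ * trunc si n x); rewrite /pos indicE /si.
    case: (boolP (x \in _)) => [/set_mem sx|/negP sx].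
      by rewrite mulfV//; apply/eqP.
    have -> : s x = 0 by apply: contrapT => sx0; apply: sx; rewrite inE.
    by rewrite mul0r.
  have [e ce] := modulus_wcomp_dom cb.
  have Ube : U (b, e).
    move: ce; rewrite {1}polar_comp => -[b' /= cb' b'e].
    by rewrite (wcomp_ext cb cb').
  have Vbe : V (b, e).
    move: ce; rewrite {1}CV => -[b' /= cb' b'e].
    by rewrite (wcomp_ext cb cb').
  have [a' aa'] := polar_total a.
  have a'0 : a' = 0.
    apply: nsq_eq0; rewrite (polar_nsq aa') /a projectionB//.
    by rewrite /b projection_idem// subrr nsq0.
  rewrite {}a'0 in aa'.
  have Va : V (a, 0).
    have : opker V a by rewrite kerV -opker_polar.
    by [].
  have fab : a + b = bmul (trunc si n) f by rewrite subrK.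
  have Un : U (bmul (trunc si n) f, 0 + e) by rewrite -fab; exact: lin_add.
  have Vn : V (bmul (trunc si n) f, 0 + e) by rewrite -fab; exact: lin_add.
  have := UMn _ _ (lin_sub U_lin fg Un); have := VMn _ _ (lin_sub V_lin fg' Vn).
  set z := nsq (f - _); rewrite add0r => H1 H2.
  (* V and U send the truncation of [f] to the same [e]: the first difference is bounded with M, the
     second with 1, and the factor 2 is that of [nsqD_le]. *)
  have -> : g' - g = (g' - e) + (-1) *: (g - e) by rewrite scaleN1r opprB addrA subrK.
  apply: le_trans (nsqD_le _ _) _; rewrite nsqZ.
  have -> : abs2 (-1 : R[i]) = 1 by rewrite /abs2 /=; ring.
  lra.
apply/eqP; rewrite -subr_eq0; apply/eqP/nsq_eq0/eqP.
rewrite eq_le nsq_ge0 andbT; apply/ler_addgt0Pr => e e0; rewrite add0r.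
have K0 : 0 < 2 * (M + 1) by rewrite mulr_gt0// ltr_wpDl.
have [n ne] := bmul_trunc_cvg f ms_inv (divr_gt0 e0 K0).
apply: le_trans (close n) _; rewrite mulrC -ler_pdivlMr//.
exact: ltW.
Qed.

Lemma polar_isometry_wcomp : polar_isometry (L2dot mu) C = U.
Proof.
apply: xget_unique.
  split; [exact: polar_partial_isometry|exact: opker_polar|].
  by rewrite modulus_wcomp; exact: polar_comp.
move=> V [Vpi kerV]; rewrite modulus_wcomp => CV.
have VU := polar_unique Vpi kerV CV; apply/seteqP; split=> // -[f g] fg.
have [_ Vdom _ _] := Vpi.
have [g' fg'] : opdom V f by rewrite Vdom.
by rewrite (wcomp_ext fg (VU _ fg')).
Qed.

(** The indicator of [A n] is in the domain of C because [F n] has finite measure and s is bounded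
    by n there. Each phi x lies in some [A n], where the indicator is 1 and the identity reduces to
    w = r. *)
Lemma test_function (r : X -> R[i]) (F : nat -> set X) :
  (forall n, measurable (F n)) -> (forall n, (mu (F n) < +oo)%E) ->
  nondecreasing_seq F -> \bigcup_n F n = setT ->
  (forall f g, C (f, g) -> {ae mu, forall x, w x * repr f (phi x) = r x * repr f (phi x)}) ->
  {ae mu, forall x, w x = 0 \/ w x = r x}.
Proof.
move=> mF Foo ndF FT wr.
pose A n := F n `&` [set x | s x <= n%:R].
have mA n : measurable (A n).
  apply: measurableI => //.
  by rewrite -[X in measurable X]setTI; exact: measurable_fun_le.
have ind n : isL2 mu (fun x => (\1_(A n) x)%:C%C).
  split; first by apply: cmeasurable_real.
  rewrite /square_integrable (eq_integral (fun x => (\1_(A n) x)%:E)).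
    rewrite integral_indic// setIT (le_lt_trans _ (Foo n))// le_measure ?inE//.
    exact: subIsetl.
  by move=> x _; rewrite abs2C expr2 indicK.
have H : {ae mu, forall x n, w x = 0 \/ A n (phi x) -> w x = 0 \/ w x = r x}.
  apply/ae_foralln => n; pose f := toL2 mu (fun x => (\1_(A n) x)%:C%C).
  have fE := repr_toL2 (ind n).
  have sf : S (f, bmul (fun x => s x * trunc s n x) f).
    have bst := bounded_mul_trunc n ms s0 : bounded_mfun (fun x => s x * trunc s n x).
    rewrite mulopE; move: (bmulE f bst) fE; apply: filterS2 => x -> ->.
    rewrite rmorphM -mulrA; congr (_ * _); rewrite -rmorphM; congr (_%:C%C).
    rewrite indicE; case: (boolP (x \in A n)) => [/set_mem[_ sx]|_]; last by rewrite mulr0.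
    by rewrite truncE sx mulr1.
  have [g fg] := modulus_wcomp_dom sf.
  move: (wr _ _ fg) (ns fE); apply: filterS2 => x wrx [->|fx [->|An]]; try by left.
  right; move: wrx; rewrite fx indicE mem_set//= => wrx.
  have n0 : (1%:C%C : R[i]) != 0 by rewrite rmorph1 oner_eq0.
  exact: (mulIf n0 wrx).
apply: filterS H => x H.
have [n _ Fn] : (\bigcup_n F n) (phi x) by rewrite FT.
pose N := maxn n (Num.bound `|s (phi x)|).
apply: (H N); right; split.
  by move: Fn; apply/subsetPset/ndF; exact: leq_maxl.
rewrite /= (le_trans (ler_norm _))// ltW// (lt_le_trans (archi_boundP _))//.
by rewrite ler_nat leq_maxr.
Qed.

(** * Both properties expressed by invariance of s under phi *)

Section Equivalence.
Variable F : nat -> set X.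
Hypotheses (mF : forall n, measurable (F n)) (Foo : forall n, (mu (F n) < +oo)%E).
Hypotheses (ndF : nondecreasing_seq F) (FT : \bigcup_n F n = setT).

(** Since U |C| = C, the inclusion to be studied is that of C in |C| U. On test functions it says w
    = s v where w is nonzero, and v = w / (s o phi). *)
Lemma quasinormal_wcompP : quasinormal (L2dot mu) C <->
  {ae mu, forall x, w x = 0 \/ s (phi x) = s x}.
Proof.
rewrite /quasinormal polar_isometry_wcomp modulus_wcomp -polar_comp; split=> [CSU|sphi].
- have H : {ae mu, forall x, w x = 0 \/ w x = (s x)%:C%C * v x}.
    apply: (test_function mF Foo ndF FT) => f g fg.
    have [m /= fm mg] := CSU _ fg.
    have {}fg : {ae mu, forall x, repr g x = w x * repr f (phi x)} := fg.
    by move: fg fm mg; apply: filterS3 => x /= <- E ->; rewrite E mulrA.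
  move: H polar_weight_neq0; apply: filterS2 => x [?|E] [?|sx]; try by left.
  have [->|w0] := eqVneq (w x) 0; [by left|right].
  move: E; rewrite /v mulrCA -{1}[w x]mulr1 => /(mulfI w0); rewrite -rmorphM => -[E].
  by rewrite -[LHS]mul1r E mulfVK// gt_eqF.
- move=> [f g] fg; have [m fm] := polar_total f; exists m => //=.
  rewrite mulopE.
  have {}fg : {ae mu, forall x, repr g x = w x * repr f (phi x)} := fg.
  move: sphi; have vE := polar_weightE; move: vE fm fg => vE fm fg sphi.
  near=> x.
  have -> : repr m x = v x * repr f (phi x) by near: x.
  have -> : repr g x = w x * repr f (phi x) by near: x.
  have <- : v x * (s (phi x))%:C%C = w x by near: x.
  have [w0|->] : w x = 0 \/ s (phi x) = s x by near: x.
    by rewrite /v w0 !mul0r mulr0.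
  by rewrite mulrA [_ * v x]mulrC.
Unshelve. all: by end_near. Qed.

Variable alpha : R.
Hypotheses (alpha_gt0 : 0 < alpha) (alpha_le1 : alpha <= 1).

Let r x : R[i] := (s x `^ alpha)%:C%C * (v x * (s (phi x) `^ (1 - alpha))%:C%C).

Let rE x : w x = 0 \/ 0 < s (phi x) -> w x = 0 \/ s (phi x) = s x -> r x = w x.
Proof.
rewrite /r /v => -[->|sx]; first by rewrite !mul0r mulr0.
move=> [->|sE]; first by rewrite !mul0r mulr0.
apply: real_scale3; rewrite -sE mulrCA.
rewrite -powRD; last by apply/implyP => _; rewrite gt_eqF.
by rewrite addrC subrK powRr1 ?(ltW sx)// mulVf// gt_eqF.
Qed.

Let mpow (a : R) : measurable_fun setT (fun x => s x `^ a).
Proof. by apply: (measurableT_comp (measurable_powR a)). Qed.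

(** On its natural domain the triple product sends f to r (f o phi), but that domain is not read off
    from [r]; [DE] is therefore an implication only, and the converse includes a separate argument
    on domains. *)
Lemma aluthge_wcompP : aluthge (L2dot mu) alpha C = C <->
  {ae mu, forall x, w x = 0 \/ s (phi x) = s x}.
Proof.
rewrite /aluthge polar_isometry_wcomp modulus_wcomp !(oppow_mulop _ ms s0).
have DE f g : opcomp (mulop mu (fun x => s x `^ alpha))
    (opcomp U (mulop mu (fun x => s x `^ (1 - alpha)))) (f, g) ->
    {ae mu, forall x, repr g x = r x * repr f (phi x)}.
  move=> [k [m /= fm mk] kg]; have fm' := nonsingular_polar fm.
  have {}mk : {ae mu, forall x, repr k x = v x * repr m (phi x)} := mk.
  have {}kg : {ae mu, forall x, repr g x = (s x `^ alpha)%:C%C * repr k x} := kg.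
  move: fm' mk kg; apply: filterS3 => x + -> ->; rewrite /r => -[->|->].
    by rewrite !mul0r mulr0 mul0r.
  by rewrite !mulrA.
split=> [DC|sphi].
- have H : {ae mu, forall x, w x = 0 \/ w x = r x}.
    apply: (test_function mF Foo ndF FT) => f g fg.
    have := fg; rewrite -{1}DC => /DE.
    have {}fg : {ae mu, forall x, repr g x = w x * repr f (phi x)} := fg.
    by move: fg; apply: filterS2 => x <-.
  move: H polar_weight_neq0; apply: filterS2 => x [?|E] [?|sx]; try by left.
  have [->|w0] := eqVneq (w x) 0; [by left|right].
  (* This is s^alpha (s o phi)^-1 (s o phi)^(1 - alpha) = 1. It forces equality of the powers with
     exponent alpha, and raising to alpha^-1 recovers s, as alpha > 0. *)
  have {}E := real_scale3_inj w0 E.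
  have sp : s (phi x) `^ alpha != 0 by rewrite gt_eqF// powR_gt0.
  have Eq : s x `^ alpha = s (phi x) `^ alpha.
    move: E; rewrite mulrCA -[X in X * _](powR_inv1 (ltW sx)) => E.
    apply: (mulIf (x := s (phi x) `^ (1 - alpha))).
      by rewrite gt_eqF// powR_gt0.
    rewrite -powRD; last by apply/implyP => _; rewrite gt_eqF.
    rewrite [alpha + _]addrC subrK powRr1 ?(ltW sx)//.
    apply: (mulfI (x := s (phi x) `^ (-1))); first by rewrite gt_eqF// powR_gt0.
    by rewrite E powR_inv1 ?(ltW sx)// mulVf// gt_eqF.
  have inj (a : R) : 0 <= a -> (a `^ alpha) `^ alpha^-1 = a.
    by move=> a0; rewrite -powRrM mulfV ?powRr1// gt_eqF.
  by rewrite -(inj _ (s0 (phi x))) -Eq inj.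
- have rw : {ae mu, forall x, r x = w x}.
    by move: polar_weight_neq0 sphi; apply: filterS2 => x; exact: rE.
  apply/seteqP; split=> -[f g] fg.
    move: (DE _ _ fg) rw => {}fg rw.
    suff: {ae mu, forall x, repr g x = w x * repr f (phi x)} by [].
    by move: fg rw; apply: filterS2 => x -> ->.
  have [k fk] := wcomp_modulus_dom fg.
  (* A vector in the domain of s must be shown to lie in that of s^(1 - alpha). From s^(1 - alpha)
     <= 1 + s, squaring gives the bound 2 (1 + s^2), the origin of the factor 2. *)
  have mL2 : isL2 mu (fun x => (s x `^ (1 - alpha))%:C%C * repr f x).
    apply: (isL2_dom (G := fun x => 2 * (abs2 (repr f x) + abs2 (repr k x)))).
    + by apply: cmeasurableM; [exact: cmeasurable_real|case: (isL2_repr f)].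
    + have i1 := integrable_abs2 (isL2_repr f); have i2 := integrable_abs2 (isL2_repr k).
      have := integrableZl measurableT 2 (integrableD measurableT i1 i2).
      by apply: eq_integrable.
    + apply: filterS fk => x /= ->; rewrite !abs2M !abs2C.
      have := abs2_ge0 (repr f x); set t := abs2 _ => t0.
      have pw : s x `^ (1 - alpha) <= 1 + s x.
        have [s1|s1] := leP (s x) 1.
          apply: (@le_trans _ _ (1 `^ (1 - alpha))).
            by apply: ge0_ler_powR; rewrite ?nnegrE ?subr_ge0.
          by rewrite powR1 lerDl.
        rewrite (le_trans (_ : _ <= s x `^ 1))//.
          by rewrite ler_powR ?(ltW s1)// gerBl ltW.
        by rewrite powRr1// lerDr.
      have p0 := powR_ge0 (s x) (1 - alpha); have sx0 := s0 x.
      have : (s x `^ (1 - alpha)) ^+ 2 <= 2 * (1 + s x ^+ 2).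
        by have := sqr_ge0 (1 - s x); nra.
      by nra.
  pose m := toL2 mu (fun x => (s x `^ (1 - alpha))%:C%C * repr f x).
  have fm : mulop mu (fun x => s x `^ (1 - alpha)) (f, m) by exact: repr_toL2.
  have [e me] := polar_total m.
  exists e; first by exists m.
  have fm' := nonsingular_polar fm.
  have {}me : {ae mu, forall x, repr e x = v x * repr m (phi x)} := me.
  have {}fg : {ae mu, forall x, repr g x = w x * repr f (phi x)} := fg.
  rewrite mulopE /=; near=> x.
  have -> : repr g x = w x * repr f (phi x) by near: x.
  have -> : repr e x = v x * repr m (phi x) by near: x.
  have <- : r x = w x by near: x.
  have : v x = 0 \/ repr m (phi x) = (s (phi x) `^ (1 - alpha))%:C%C * repr f (phi x).
    by near: x.
  rewrite /r => -[->|->]; first by rewrite !mul0r mulr0 mul0r.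
  by rewrite !mulrA.
Unshelve. all: by end_near. Qed.

End Equivalence.

End WeightedComposition.

(** * The Radon-Nikodym derivative *)

Section Approximation.
Context d (X : measurableType d) (R : realType) (mu : {measure set X -> \bar R}).
Variable F : nat -> set X.
Hypotheses (mF : forall n, measurable (F n)) (Foo : forall n, (mu (F n) < +oo)%E).
Hypotheses (ndF : nondecreasing_seq F) (FT : \bigcup_n F n = setT).

Lemma isL2_indic n : isL2 mu (fun x => (\1_(F n) x)%:C%C).
Proof.
split; first by apply: cmeasurable_real.
rewrite /square_integrable (eq_integral (fun x => (\1_(F n) x)%:E)).
  by rewrite integral_indic// setIT; exact: Foo.
by move=> x _; rewrite abs2C expr2 indicK.
Qed.

Lemma four_nsq (u : L2 mu) :
  ((4 * nsq u)%:E = \int[mu]_x (4%:E * (abs2 (repr u x))%:E))%E.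
Proof.
have mu2 : measurable_fun setT (fun x => (abs2 (repr u x))%:E).
  exact/measurable_EFinP/measurable_abs2_repr.
have u0 x : setT x -> (0 <= (abs2 (repr u x))%:E)%E by rewrite lee_fin abs2_ge0.
by rewrite EFinM nsqE -ge0_integralZl_EFin.
Qed.

(** The threshold is 1/2 for |f|: where |f| < 1/2, one has 4 |1 - f|^2 >= 1, so the error of
    approximating an indicator controls the measure of the points of its set that are missed. *)
Definition half_level (f : L2 mu) : set X := [set x | 4^-1 <= abs2 (repr f x)].

Lemma measurable_half_level f : measurable (half_level f).
Proof.
rewrite -[X in measurable X]setTI; apply: measurable_fun_le => //.
exact: measurable_abs2_repr.
Qed.

(** On the preimage |f o phi|^2 >= 1/4, so |w|^2 is at most 4 |w (f o phi)|^2 = 4 |g|^2. *)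
Lemma half_level_image_fin (w : X -> R[i]) (phi : X -> X) (f g : L2 mu) :
  cmeasurable w -> measurable_fun setT phi -> wcomp mu w phi (f, g) ->
  (\int[mu]_(x in phi @^-1` half_level f) (abs2 (w x))%:E < +oo)%E.
Proof.
move=> mw mphi fg.
have {}fg : {ae mu, forall x, repr g x = w x * repr f (phi x)} := fg.
have mA : measurable (phi @^-1` half_level f).
  by rewrite -[X in measurable X]setTI; apply: mphi => //; exact: measurable_half_level.
have mw2 := cmeasurable_abs2 mw.
apply: (@le_lt_trans _ _ (4 * nsq g)%:E); last exact: ltry.
rewrite four_nsq integral_mkcond; apply: ae_ge0_le_integral => //.
- by move=> x _; rewrite erestrict_ge0// => y _; rewrite lee_fin abs2_ge0.
- apply/(measurable_restrictT _ mA).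
  by apply/measurable_EFinP/measurable_funTS.
- by move=> x _; rewrite -EFinM lee_fin mulr_ge0// abs2_ge0.
- by apply: measurable_funeM; apply/measurable_EFinP; exact: measurable_abs2_repr.
- apply: filterS fg => x -> _; rewrite patchE -EFinM abs2M.
  case: ifPn => [/set_mem /= fk|_]; rewrite lee_fin; last by rewrite !mulr_ge0 ?abs2_ge0.
  by rewrite mulrCA ler_peMr ?abs2_ge0// mulrC -ler_pdivrMr// mul1r.
Qed.

(** What is missed inside [F N] is, for every k >= N, contained in [F k] and outside the level set
    of [f k]; its measure is thus at most 4 / (k + 1). *)
Lemma half_level_cover (f : nat -> L2 mu) :
  (forall k, nsq (toL2 mu (fun x => (\1_(F k) x)%:C%C) - f k) < k.+1%:R^-1) ->
  mu (~` \bigcup_k half_level (f k)) = 0%E.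
Proof.
move=> fP; have mA k := measurable_half_level (f k).
have mC : measurable (~` \bigcup_k half_level (f k)).
  by apply: measurableC; exact: bigcup_measurable.
rewrite -[~` _]setIT -FT setI_bigcupr.
have mCF i : measurable (~` (\bigcup_k half_level (f k)) `&` F i) by exact: measurableI.
apply: measure_negligible; first exact: bigcup_measurable.
apply: negligible_bigcup => N.
exists (~` (\bigcup_k half_level (f k)) `&` F N); split=> //.
apply/eqP; rewrite -measure_le0.
apply/lee_addgt0Pr => e e0; rewrite add0e.
(* The index max N M serves two ends: [F N] is contained in [F k], and 4 / (k + 1) is at most
   [e]. *)
have [M Me] : exists M : nat, 4 * (maxn N M).+1%:R^-1 <= e.
  exists (Num.bound (4 / e)); rewrite ler_pdivrMr ?ltr0n// mulrC -ler_pdivrMr//.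
  apply: le_trans (ltW (archi_boundP _)) _; first by rewrite divr_ge0// ltW.
  by rewrite ler_nat (leq_trans (leq_maxr N _)).
set k := maxn N M in Me.
apply: (@le_trans _ _ (4 * nsq (toL2 mu (fun x => (\1_(F k) x)%:C%C) - f k))%:E); last first.
  by rewrite lee_fin (le_trans _ Me)// ler_wpM2l// ltW.
apply: (@le_trans _ _ (\int[mu]_x (\1_(~` (\bigcup_k half_level (f k)) `&` F N) x)%:E)%E).
  by rewrite integral_indic// setIT.
rewrite four_nsq; apply: ae_ge0_le_integral => //.
- by apply/measurable_EFinP; exact: measurable_indic.
- by move=> x _; rewrite -EFinM lee_fin mulr_ge0// abs2_ge0.
- by apply: measurable_funeM; apply/measurable_EFinP; exact: measurable_abs2_repr.
- move: (repr_toL2 (isL2_indic k)) (reprB (toL2 mu (fun x => (\1_(F k) x)%:C%C)) (f k)).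
  apply: filterS2 => x ox -> _.
  rewrite ox !indicE -EFinM lee_fin.
  case: (boolP (x \in _ `&` F N)) => [/set_mem [nA FN]|_]; last by rewrite mulr_ge0// abs2_ge0.
  rewrite mem_set/=; last by move: FN; apply/subsetPset/ndF; exact: leq_maxl.
  have : ~ half_level (f k) x by move=> Ak; apply: nA; exists k.
  rewrite /half_level /= => /negP; rewrite -ltNge.
  case: (repr (f k) x) => a b; rewrite /abs2 /= => ab.
  by nra.
Qed.

End Approximation.

Section RadonNikodymDensity.
Context d (X : measurableType d) (R : realType).
Variables (mu : {sigma_finite_measure set X -> \bar R}) (w : X -> R[i]) (phi : X -> X).
Hypotheses (mw : cmeasurable w) (mphi : measurable_fun setT phi).
Hypothesis ac : pushforward (weighted_measure mu w) phi `<< mu.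

Lemma abs_continuous_nonsingular : nonsingular mu w phi.
Proof.
move=> P [N [mN N0 PN]].
have mpre : measurable (phi @^-1` N) by rewrite -[X in measurable X]setTI; apply: mphi.
have mw2 : measurable_fun (phi @^-1` N) (fun x => (abs2 (w x))%:E).
  by apply/measurable_EFinP/measurable_funTS; exact: cmeasurable_abs2.
have : (\int[mu]_(x in phi @^-1` N) `|(abs2 (w x))%:E| = 0)%E.
  move/null_content_dominatesP : ac => /(_ N mN N0) <-.
  by apply: eq_integral => x _; rewrite gee0_abs// lee_fin abs2_ge0.
move/(ae_eq_integral_abs mu mpre mw2); apply: filterS => x wx.
have [/wx[/eqP]|nN] := pselect (N (phi x)); first by rewrite abs2_eq0 => /eqP; left.
by right; apply: contrapT => nP; apply: nN; exact: PN.
Qed.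

Variable F : nat -> set X.
Hypotheses (mF : forall n, measurable (F n)) (Foo : forall n, (mu (F n) < +oo)%E).
Hypotheses (ndF : nondecreasing_seq F) (FT : \bigcup_n F n = setT).
Hypothesis C_dense : densely_defined (L2dot mu) (wcomp mu w phi).

(* Since [f n] approximates the indicator of [F n], the sets [|f n|^2 >= 1/4]
   cover almost everything; the image measure is finite on each of them
   because [w (f n o phi)] is square integrable. *)
Lemma dense_change_of_var : exists h : X -> R,
  [/\ measurable_fun setT h, forall x, 0 <= h x &
    forall G : X -> R, measurable_fun setT G -> (forall x, 0 <= G x) ->
    (\int[mu]_x (G (phi x) * abs2 (w x))%:E = \int[mu]_x (G x * h x)%:E)%E].
Proof.
have mw2 := cmeasurable_abs2 mw.
have [n nE] := density_measureP mu mw2 (fun x => abs2_ge0 _).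
have [nu nuE] := pushforward_measureP n mphi.
have mpre A : measurable A -> measurable (phi @^-1` A).
  by move=> mA; rewrite -[X in measurable X]setTI; apply: mphi.
have {}nuE A : measurable A -> nu A = (\int[mu]_(x in phi @^-1` A) (abs2 (w x))%:E)%E.
  by move=> mA; rewrite nuE// nE//; exact: mpre.
have nu_mu : nu `<< mu.
  apply/null_content_dominatesP => A mA A0; rewrite nuE//.
  by move/null_content_dominatesP : ac => /(_ A mA A0).
have /choice[f fP] k : exists f, opdom (wcomp mu w phi) f /\
    nsq (toL2 mu (fun x => (\1_(F k) x)%:C%C) - f) < k.+1%:R^-1.
  have k0 : 0 < k.+1%:R^-1 :> R by rewrite invr_gt0 ltr0n.
  move/densely_definedP : C_dense => H.
  by have [f] := H (toL2 mu (fun x => (\1_(F k) x)%:C%C)) _ k0; exists f.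
pose A k := half_level (f k).
have mA k : measurable (A k) by exact: measurable_half_level.
have nuA k : (nu (A k) < +oo)%E.
  by rewrite nuE//; have [[g fg] _] := fP k; exact: (half_level_image_fin mw mphi fg).
have nuC : (nu (~` \bigcup_k A k) = 0)%E.
  move/null_content_dominatesP : nu_mu; apply.
    by apply: measurableC; exact: bigcup_measurable.
  by apply: (half_level_cover mF Foo ndF FT) => k; case: (fP k).
have [h [mh h0 hE]] := radon_nikodym_exhaustion nu_mu mA nuA nuC.
exists h; split=> // G mG G0.
(* Both sides are the integral of [G] against [nu], seen once as an image under [phi] with density
   |w|^2 and once as the measure of density [h]. *)
rewrite -(@ge0_integral_transfer _ _ _ _ _ mu nu phi (fun x => abs2 (w x)))//; last first.
  by move=> x; exact: abs2_ge0.
by rewrite (@ge0_integral_transfer _ _ _ _ _ mu nu id h)//; exact: measurable_id.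
Qed.

End RadonNikodymDensity.

Theorem proposition30 (d : measure_display) (X : measurableType d)
    (R : realType) (mu : {sigma_finite_measure set X -> \bar R})
    (w : X -> R[i]) (phi : X -> X) (alpha : R)
    (w_meas : cmeasurable w) (phi_meas : measurable_fun setT phi)
    (ac : pushforward (weighted_measure mu w) phi `<< mu)
    (alpha_gt0 : 0 < alpha) (alpha_le1 : alpha <= 1)
    (C_dense : densely_defined (L2dot mu) (wcomp mu w phi)) :
  quasinormal (L2dot mu) (wcomp mu w phi) <->
  aluthge (L2dot mu) alpha (wcomp mu w phi) = wcomp mu w phi.
Proof.
have [F [FT ndF /all_and2[mF Foo]]] := (sigma_finiteP _ _).1 (sigma_finiteT mu).
have ns := abs_continuous_nonsingular w_meas phi_meas ac.
have [h [mh h0 cv]] := dense_change_of_var w_meas phi_meas ac mF Foo ndF (esym FT) C_dense.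
rewrite (quasinormal_wcompP w_meas phi_meas mh h0 ns cv mF Foo ndF (esym FT)).
by rewrite (aluthge_wcompP w_meas phi_meas mh h0 ns cv mF Foo ndF (esym FT) alpha_gt0 alpha_le1).
Qed.
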